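(* There are absolute constants $C,C'>0$ such that the following holds. Let $d,k\in\mathbb{N}$, $z\ge1$, let $X=\{x_1,\dots,x_n\}\subset\mathbb{R}^d$ be any set of points, and let $R\subset\mathbb{R}^d$ be an optimal $(k,z)$-subspace approximation of $X$, i.e. a linear subspace of dimension at most $k$ minimizing $\mathrm{cost}_z(X,\cdot)$ over all linear subspaces of $\mathbb{R}^d$ of dimension at most $k$. Let $\varepsilon\in(0,1)$ and $$t\ \ge\ C\cdot\frac{z\,k^2\,(1+\log(k/\varepsilon))^{C'}}{\varepsilon^3}.$$ Then with probability at least $0.9$ over the draw of $\Pi\sim\mathcal{J}_{d,t}$, $$\frac{1}{1+\varepsilon}\,\mathrm{cost}_z(X,R)\ \le\ \min_{R'\subset\mathbb{R}^t\ \text{linear subspace},\ \dim R'\le k}\mathrm{cost}_z(\Pi(X),R')\ \le\ (1+\varepsilon)\,\mathrm{cost}_z(X,R).$$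
   Context: $\mathcal{J}_{d,t}$ denotes the distribution of the linear map $\Pi:\mathbb{R}^d\to\mathbb{R}^t$, $x\mapsto Gx$, where $G$ is a $t\times d$ matrix with i.i.d. $\mathcal{N}(0,1/t)$ entries. For a linear subspace $R\subset\mathbb{R}^m$, $\rho_R$ is the orthogonal projection onto $R$, and for finite $Y\subset\mathbb{R}^m$, $\mathrm{cost}_z(Y,R)=\big(\sum_{y\in Y}\|y-\rho_R(y)\|_2^z\big)^{1/z}$. The paper writes the bound on $t$ as $t\gtrsim z k^2\,\mathrm{polylog}(k/\varepsilon)/\varepsilon^3$. *)

(* Defs.v *)
From mathcomp Require Import all_boot all_order all_algebra finmap.
From mathcomp Require Import all_classical all_reals all_analysis.

Set Implicit Arguments.
Unset Strict Implicit.
Unset Printing Implicit Defensive.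

Import Order.TTheory GRing.Theory Num.Theory.

Local Open Scope classical_set_scope.
Local Open Scope ring_scope.

Section SubspaceApproximation.
Context {R : realType}.

Definition dotv m (u v : 'cV[R]_m) : R := \sum_i u i 0 * v i 0.

(* The norm `|v| that the library puts on matrices is the sup norm, so the
   Euclidean norm is defined separately. *)
Definition norm2 m (v : 'cV[R]_m) : R := Num.sqrt (\sum_i v i 0 ^+ 2).

Definition is_orthoproj m (S : {vspace 'cV[R]_m}) (v p : 'cV[R]_m) : Prop :=
  p \in S /\ forall u, u \in S -> dotv (v - p) u = 0.

(* xget never falls back on its default value: orthoprojP and is_orthoproj_inj
   show that exactly one such p exists. *)
Definition orthoproj m (S : {vspace 'cV[R]_m}) (v : 'cV[R]_m) : 'cV[R]_m :=
  xget 0 [set p | is_orthoproj S v p].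

Definition cost m (z : R) (Y : {fset 'cV[R]_m}) (S : {vspace 'cV[R]_m}) : R :=
  (\sum_(y <- Y) norm2 (y - orthoproj S y) `^ z) `^ z^-1.

Definition optimal_subspace m (k : nat) (z : R) (Y : {fset 'cV[R]_m})
    (S : {vspace 'cV[R]_m}) : Prop :=
  (\dim S <= k)%N /\
  forall S' : {vspace 'cV[R]_m}, (\dim S' <= k)%N -> cost z Y S <= cost z Y S'.

Lemma dotvE m (u v : 'cV[R]_m) : dotv u v = (v^T *m u) 0 0.
Proof. by rewrite mxE; apply: eq_bigr => i _; rewrite mxE mulrC. Qed.

Lemma dotvv_eq0 m (u : 'cV[R]_m) : dotv u u = 0 -> u = 0.
Proof.
move=> /eqP; rewrite psumr_eq0 => [/allP u0|i _]; last exact: sqr_ge0.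
apply/colP => i; rewrite mxE; apply/eqP.
by have := u0 i (mem_index_enum i); rewrite /= mulf_eq0 orbb.
Qed.

Lemma is_orthoproj_inj m (S : {vspace 'cV[R]_m}) v p q :
  is_orthoproj S v p -> is_orthoproj S v q -> p = q.
Proof.
move=> [pS hp] [qS hq]; apply/eqP; rewrite -subr_eq0; apply/eqP/dotvv_eq0.
have pqS : p - q \in S by rewrite rpredB.
have pqE : p - q = (v - q) - (v - p) by rewrite opprB [RHS]addrC addrA subrK.
rewrite {1}pqE dotvE mulmxBr mxE [X in _ + X]mxE -!dotvE.
by rewrite hp// hq// subrr.
Qed.

Lemma is_orthoproj_ex m (S : {vspace 'cV[R]_m}) v : exists p, is_orthoproj S v p.
Proof.
pose B : 'M[R]_(m, \dim S) := \matrix_(i, j) (vbasis S)`_j i 0.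
have BE (c : 'cV[R]_(\dim S)) : B *m c = \sum_i c i 0 *: (vbasis S)`_i.
  apply/colP => i; rewrite mxE summxE.
  by apply: eq_bigr => j _; rewrite !mxE mulrC.
have B_inj (c : 'cV[R]_(\dim S)) : B *m c = 0 -> c = 0.
  rewrite BE => c0; apply/colP => i; rewrite mxE.
  by have /freeP/(_ (fun i => c i 0) c0 i) := basis_free (vbasisP S).
have Bunit : B^T *m B \in unitmx.
  rewrite -row_free_unit -kermx_eq0; apply/rowV0P => w /sub_kermxP wB.
  apply: trmx_inj; rewrite trmx0; apply/B_inj/dotvv_eq0.
  by rewrite dotvE trmx_mul trmxK mulmxA -(mulmxA w) wB mul0mx mxE.
exists (B *m (invmx (B^T *m B) *m (B^T *m v))); split.
  rewrite BE; apply: rpred_sum => i _; apply: rpredZ.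
  by apply: vbasis_mem; rewrite mem_nth// size_tuple.
move=> u /coord_vbasis uE.
have -> : u = B *m (\col_i coord (vbasis S) i u).
  by rewrite BE {1}uE; apply: eq_bigr => i _; rewrite mxE.
rewrite dotvE trmx_mul -mulmxA mulmxBr (mulmxA B^T B) mulKVmx//.
by rewrite subrr mulmx0 mxE.
Qed.

Lemma orthoprojP m (S : {vspace 'cV[R]_m}) v :
  is_orthoproj S v (orthoproj S v).
Proof. by have [p hp] := is_orthoproj_ex S v; apply: (xgetPex 0 (ex_intro _ p hp)). Qed.

End SubspaceApproximation.

Section GaussianProjection.
Context {disp : measure_display} {Omega : measurableType disp} {R : realType}.
Context (P : probability Omega R).

Definition mutually_independent (I : choiceType) (X : I -> {RV P >-> R}) : Prop :=
  forall (J : {fset I}) (B : I -> set R), (forall i, measurable (B i)) ->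
    P (\bigcap_(i in [set` J]) (X i @^-1` B i)) =
    (\prod_(i <- J) P (X i @^-1` B i))%E.

(* The second parameter of normal_prob is the standard deviation, so the
   entries are N(0, 1/t). *)
Definition gaussian_JL (d t : nat) (G : 'I_t -> 'I_d -> {RV P >-> R}) : Prop :=
  (forall i j (B : set R), measurable B ->
     distribution P (G i j) B = normal_prob 0 (Num.sqrt t%:R^-1) B) /\
  mutually_independent (fun ij : 'I_t * 'I_d => G ij.1 ij.2).

Definition JL_matrix (d t : nat) (G : 'I_t -> 'I_d -> {RV P >-> R})
    (w : Omega) : 'M[R]_(t, d) := \matrix_(i, j) G i j w.

End GaussianProjection.

Definition image_mx (R : realType) (d t : nat) (A : 'M[R]_(t, d))
    (X : {fset 'cV[R]_d}) : {fset 'cV[R]_t} := [fset A *m x | x in X]%fset.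

(* Main.v *)
(* Let S be optimal for X, with residuals r(x) = |x - P_S x| and
   opt = cost_z(X, S). The upper bound uses only S: the image of S under the
   Gaussian map A costs at most the l_z-norm of the vectors |A (x - P_S x)|,
   which exceed (1 + eps/4) r(x) only by a total that Markov's inequality makes
   small.

   For the lower bound, suppose a subspace S' of dimension at most k
   approximates A X at cost less than (1 - eps/2) opt. As long as A nearly
   preserves norms on the span V of S, of the points chosen so far and of a
   typical further point x (drawn with probability proportional to r(x)^z),
   many points x are witnesses: A x is markedly closer to its projection p
   on S' than to the projection of p on A V. Adding a witness to V contracts
   the distance from p to A V by a factor bounded away from 1. The
   regularised determinant of the quadratic form q |-> dist(q, A V)^2 on S'
   then drops by a factor 1 - c eps, while it stays above a fixed fraction
   of its initial value; hence at most O(k log(1/eps) / eps) witnesses can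
   be added in succession. So if such an S' exists, a random tuple of that
   length, drawn from this distribution, spans together with S a subspace on
   which A fails to be an embedding with probability at least some eps^O(z k
   log(1/eps) / eps). On average over A this probability is at most exp(- c
   eps^2 t) times the size of a net, so Markov's inequality rules out S' for
   most A. *)
Require Import Defs.
From HB Require Import structures.
From mathcomp Require Import all_boot all_order all_algebra finmap.
From mathcomp Require Import all_classical all_reals all_analysis.
From mathcomp Require Import measurable_realfun.
From mathcomp Require Import ring lra.

Set Implicit Arguments.
Unset Strict Implicit.
Unset Printing Implicit Defensive.

Import Order.TTheory GRing.Theory Num.Theory.

Local Open Scope classical_set_scope.
Local Open Scope ring_scope.

(** * Euclidean norms, orthogonal projections and power means *)

(** No union bound over the points of X or over the candidates S' is possible: the number of points
    is arbitrary and S' may depend on A. So the tuples come from a law fixed before A is drawn, and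
    S' enters only through a deterministic implication: a too cheap S' forces the bad tuples to have
    large total mass. The determinant is regularised because one witness may bring a direction of S'
    into A V; the plain determinant would then be 0, and later witnesses could no longer be counted
    by its decrease. With L = 1 + log(k/eps), about k L / eps witnesses are used. Each costs a
    factor exp(-O(z L)) of mass, and the subspaces to be embedded, of dimension O(k L / eps), have
    nets of exp(O(k L^2 / eps)) points. Hence t eps^2 has to dominate z k L^2 / eps. The image of X
    is a set, so colliding points count once. This can only lower a cost, which suits the upper
    bound; the lower bound uses that A is almost surely injective on X. *)

Section EuclideanNorm.
Context {R : realType}.

Lemma dotvC m (u v : 'cV[R]_m) : dotv u v = dotv v u.
Proof. by apply: eq_bigr => i _; rewrite mulrC. Qed.

Lemma dotvDl m (u v w : 'cV[R]_m) : dotv (u + v) w = dotv u w + dotv v w.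
Proof. by rewrite -big_split; apply: eq_bigr => i _ /=; rewrite mxE mulrDl. Qed.

Lemma dotvZl m a (u w : 'cV[R]_m) : dotv (a *: u) w = a * dotv u w.
Proof. by rewrite mulr_sumr; apply: eq_bigr => i _ /=; rewrite mxE mulrA. Qed.

Lemma dotvNl m (u w : 'cV[R]_m) : dotv (- u) w = - dotv u w.
Proof. by rewrite -scaleN1r dotvZl mulN1r. Qed.

Lemma dotvBl m (u v w : 'cV[R]_m) : dotv (u - v) w = dotv u w - dotv v w.
Proof. by rewrite dotvDl dotvNl. Qed.

Lemma dotvDr m (u v w : 'cV[R]_m) : dotv w (u + v) = dotv w u + dotv w v.
Proof. by rewrite dotvC dotvDl !(dotvC w). Qed.

Lemma dotvZr m a (u w : 'cV[R]_m) : dotv w (a *: u) = a * dotv w u.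
Proof. by rewrite dotvC dotvZl (dotvC w). Qed.

Lemma dotvNr m (u w : 'cV[R]_m) : dotv w (- u) = - dotv w u.
Proof. by rewrite dotvC dotvNl (dotvC w). Qed.

Lemma dotvBr m (u v w : 'cV[R]_m) : dotv w (u - v) = dotv w u - dotv w v.
Proof. by rewrite dotvDr dotvNr. Qed.

Lemma dotv0l m (u : 'cV[R]_m) : dotv 0 u = 0.
Proof. by rewrite -(subrr u) dotvBl subrr. Qed.

Lemma dotvv_ge0 m (u : 'cV[R]_m) : 0 <= dotv u u.
Proof. by apply: sumr_ge0 => i _; rewrite -expr2 sqr_ge0. Qed.

Lemma norm2E m (u : 'cV[R]_m) : norm2 u = Num.sqrt (dotv u u).
Proof. by congr Num.sqrt; apply: eq_bigr => i _; rewrite expr2. Qed.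

Lemma norm2_ge0 m (u : 'cV[R]_m) : 0 <= norm2 u.
Proof. exact: sqrtr_ge0. Qed.

Lemma sqr_norm2 m (u : 'cV[R]_m) : norm2 u ^+ 2 = dotv u u.
Proof. by rewrite norm2E sqr_sqrtr// dotvv_ge0. Qed.

Lemma norm2_eq0 m (u : 'cV[R]_m) : norm2 u = 0 -> u = 0.
Proof. by move=> u0; apply: dotvv_eq0; rewrite -sqr_norm2 u0 expr0n. Qed.

Lemma norm20 m : norm2 (0 : 'cV[R]_m) = 0.
Proof. by rewrite norm2E dotv0l sqrtr0. Qed.

Lemma norm2Z m a (u : 'cV[R]_m) : norm2 (a *: u) = `|a| * norm2 u.
Proof.
by rewrite !norm2E dotvZl dotvZr mulrA -expr2 sqrtrM ?sqr_ge0// sqrtr_sqr.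
Qed.

Lemma norm2N m (u : 'cV[R]_m) : norm2 (- u) = norm2 u.
Proof. by rewrite !norm2E dotvNl dotvNr opprK. Qed.

Lemma dotv_sqr_le m (u v : 'cV[R]_m) : dotv u v ^+ 2 <= dotv u u * dotv v v.
Proof.
have [v0|v0] := eqVneq (dotv v v) 0.
  by rewrite (dotvv_eq0 v0) (dotvC u) !dotv0l mulr0 expr0n.
have vp : 0 < dotv v v by rewrite lt_neqAle eq_sym v0 dotvv_ge0.
have := dotvv_ge0 (dotv v v *: u - dotv u v *: v).
rewrite !(dotvBl, dotvBr, dotvZl, dotvZr) (dotvC v u) => h.
rewrite -subr_ge0 -(pmulr_rge0 _ vp); apply: le_trans h _.
by rewrite le_eqVlt; apply/orP; left; apply/eqP; ring.
Qed.

Lemma dotv_le m (u v : 'cV[R]_m) : dotv u v <= norm2 u * norm2 v.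
Proof.
apply: le_trans (ler_norm _) _.
rewrite -(ler_pXn2r (n := 2)) ?nnegrE ?mulr_ge0 ?norm2_ge0//.
by rewrite real_normK ?num_real// exprMn !sqr_norm2 dotv_sqr_le.
Qed.

Lemma ler_norm2D m (u v : 'cV[R]_m) : norm2 (u + v) <= norm2 u + norm2 v.
Proof.
rewrite -(ler_pXn2r (n := 2)) ?nnegrE ?addr_ge0 ?norm2_ge0//.
rewrite sqr_norm2 dotvDl !dotvDr sqrrD !sqr_norm2 (dotvC v u).
by have := dotv_le u v; lra.
Qed.

Lemma ler_norm2B m (u v : 'cV[R]_m) : norm2 (u - v) <= norm2 u + norm2 v.
Proof. by rewrite (le_trans (ler_norm2D _ _))// norm2N. Qed.

Lemma norm2B m (u v : 'cV[R]_m) : norm2 (u - v) = norm2 (v - u).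
Proof. by rewrite -norm2N opprB. Qed.

Lemma ler_norm2_sum m (I : Type) (r : seq I) (f : I -> 'cV[R]_m) :
  norm2 (\sum_(i <- r) f i) <= \sum_(i <- r) norm2 (f i).
Proof.
elim/big_ind2 : _ => [|u a v b ua vb|//]; first by rewrite norm20.
by apply: le_trans (ler_norm2D _ _) _; exact: lerD.
Qed.

End EuclideanNorm.

Section OrthogonalProjection.
Context {R : realType}.

Lemma orthoproj_mem m (S : {vspace 'cV[R]_m}) v : orthoproj S v \in S.
Proof. by case: (orthoprojP S v). Qed.

Lemma orthoproj_ortho m (S : {vspace 'cV[R]_m}) v u :
  u \in S -> dotv (v - orthoproj S v) u = 0.
Proof. by case: (orthoprojP S v) => _; exact. Qed.

Lemma orthoproj_eq m (S : {vspace 'cV[R]_m}) v p :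
  p \in S -> (forall u, u \in S -> dotv (v - p) u = 0) -> orthoproj S v = p.
Proof. by move=> pS hp; apply: (is_orthoproj_inj (orthoprojP S v)); split. Qed.

Lemma orthoproj_is_linear m (S : {vspace 'cV[R]_m}) : linear (orthoproj S).
Proof.
move=> a u v; apply: orthoproj_eq.
  by rewrite rpredD ?rpredZ// orthoproj_mem.
move=> w wS; rewrite opprD addrACA -scalerBr dotvDl dotvZl.
by rewrite !orthoproj_ortho// mulr0 addr0.
Qed.

HB.instance Definition _ m (S : {vspace 'cV[R]_m}) :=
  GRing.isLinear.Build R 'cV[R]_m 'cV[R]_m *:%R (orthoproj S)
    (orthoproj_is_linear S).

Lemma norm2_pythagoras m (S : {vspace 'cV[R]_m}) v u : u \in S ->
  norm2 (v - u) ^+ 2 =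
  norm2 (v - orthoproj S v) ^+ 2 + norm2 (orthoproj S v - u) ^+ 2.
Proof.
move=> uS.
have o : dotv (v - orthoproj S v) (orthoproj S v - u) = 0.
  by rewrite orthoproj_ortho// rpredB// orthoproj_mem.
have -> : v - u = (v - orthoproj S v) + (orthoproj S v - u).
  by rewrite addrA subrK.
move: (v - _) (orthoproj S v - u) o => a b o.
by rewrite !sqr_norm2 dotvDl !dotvDr (dotvC b) o addr0 add0r.
Qed.

Lemma orthoproj_min m (S : {vspace 'cV[R]_m}) v u : u \in S ->
  norm2 (v - orthoproj S v) <= norm2 (v - u).
Proof.
move=> uS; rewrite -(ler_pXn2r (n := 2)) ?nnegrE ?norm2_ge0//.
by rewrite (norm2_pythagoras v uS) lerDl sqr_ge0.
Qed.

Lemma norm2_orthoproj_le m (S : {vspace 'cV[R]_m}) v :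
  norm2 (orthoproj S v) <= norm2 v.
Proof.
rewrite -(ler_pXn2r (n := 2)) ?nnegrE ?norm2_ge0//.
have := norm2_pythagoras v (mem0v S); rewrite !subr0 => ->.
by rewrite lerDr sqr_ge0.
Qed.

Lemma dist_subv m (S S' : {vspace 'cV[R]_m}) v : (S <= S')%VS ->
  norm2 (v - orthoproj S' v) <= norm2 (v - orthoproj S v).
Proof. by move=> SS'; apply/orthoproj_min/(subvP SS')/orthoproj_mem. Qed.

End OrthogonalProjection.

Section PowerMean.
Context {R : realType}.

Lemma powR_div (x y p : R) : 0 <= x -> 0 < y -> (x / y) `^ p = x `^ p / y `^ p.
Proof.
move=> x0 y0; rewrite powRM ?invr_ge0 ?(ltW y0)//; congr (_ * _).
by rewrite -powR_inv1 ?(ltW y0)// -powRrM mulN1r powRN.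
Qed.

Lemma powR_inv (x p : R) : 0 < x -> (x `^ p)^-1 = x^-1 `^ p.
Proof.
by move=> x0; rewrite -[in RHS](mul1r x^-1) (powR_div _ ler01 x0) powR1 mul1r.
Qed.

(** Indexed by a sequence, so that costs of images can be summed over the points of X themselves,
    with multiplicity. *)
Definition lz (z : R) (I : Type) (r : seq I) (f : I -> R) : R :=
  (\sum_(i <- r) f i `^ z) `^ z^-1.

Variables (z : R).
Hypothesis z1 : 1 <= z.

Let z0 : 0 < z. Proof. exact: lt_le_trans z1. Qed.

Lemma sum_powR_ge0 (I : Type) (r : seq I) (f : I -> R) :
  0 <= \sum_(i <- r) f i `^ z.
Proof. by apply: sumr_ge0 => i _; exact: powR_ge0. Qed.

Lemma lz_ge0 (I : Type) (r : seq I) (f : I -> R) : 0 <= lz z r f.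
Proof. exact: powR_ge0. Qed.

Lemma powR_lz (I : Type) (r : seq I) (f : I -> R) :
  lz z r f `^ z = \sum_(i <- r) f i `^ z.
Proof.
by rewrite -powRrM mulVf ?gt_eqF// powRr1// sum_powR_ge0.
Qed.

Lemma lz_le_powR (I : Type) (r : seq I) (f : I -> R) c : 0 <= c ->
  (lz z r f <= c) = (\sum_(i <- r) f i `^ z <= c `^ z).
Proof.
move=> c0; rewrite -powR_lz; apply/idP/idP => [h|].
  by apply: ge0_ler_powR => //; rewrite ?nnegrE ?lz_ge0// ltW.
by apply: contraTT; rewrite -!ltNge => h; apply: gt0_ltr_powR;
  rewrite ?nnegrE ?lz_ge0.
Qed.

Lemma powR_le_lz (I : Type) (r : seq I) (f : I -> R) c : 0 <= c ->
  (c <= lz z r f) = (c `^ z <= \sum_(i <- r) f i `^ z).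
Proof.
move=> c0; rewrite -powR_lz; apply/idP/idP => [h|].
  by apply: ge0_ler_powR => //; rewrite ?nnegrE ?lz_ge0// ltW.
by apply: contraTT; rewrite -!ltNge => h; apply: gt0_ltr_powR;
  rewrite ?nnegrE ?lz_ge0.
Qed.

Lemma lz_le (I : eqType) (r : seq I) (f g : I -> R) :
  (forall i, i \in r -> 0 <= f i <= g i) -> lz z r f <= lz z r g.
Proof.
move=> fg; rewrite lz_le_powR ?lz_ge0// powR_lz.
rewrite big_seq [leRHS]big_seq; apply: ler_sum => i /fg /andP[f0 h].
by apply: (ge0_ler_powR (ltW z0)) => //; rewrite nnegrE// (le_trans f0 h).
Qed.

Lemma lzZ (I : Type) (r : seq I) (f : I -> R) c : 0 <= c ->
  (forall i, 0 <= f i) -> lz z r (fun i => c * f i) = c * lz z r f.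
Proof.
move=> c0 f0; rewrite /lz; under eq_bigr do rewrite powRM//.
rewrite -mulr_sumr powRM ?powR_ge0 ?sum_powR_ge0// -powRrM mulfV ?gt_eqF//.
by rewrite powRr1.
Qed.

Lemma lz_eq0 (I : eqType) (r : seq I) (f : I -> R) i :
  lz z r f = 0 -> i \in r -> f i = 0.
Proof.
move=> l0 ir; have := powR_lz r f; rewrite l0 powR0 ?gt_eqF// => /esym/eqP.
rewrite psumr_eq0 => [/allP/(_ _ ir)/=|? _]; last exact: powR_ge0.
by rewrite powR_eq0 => /andP[/eqP].
Qed.

Lemma eq_lz (I : eqType) (r : seq I) (f g : I -> R) :
  (forall i, i \in r -> f i = g i) -> lz z r f = lz z r g.
Proof.
by move=> fg; congr (_ `^ _); apply: eq_big_seq => i /fg ->.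
Qed.

Lemma powR_conv (t x y : R) : 0 <= t <= 1 -> 0 <= x -> 0 <= y ->
  (t * x + (1 - t) * y) `^ z <= t * x `^ z + (1 - t) * y `^ z.
Proof.
move=> t01 x0 y0.
have tP : Itv.spec (@Itv.num_sem R) (Itv.Real `[0%Z, 1%Z]) t.
  by apply/and3P; split; [exact: num_real|..]; rewrite /= ?bnd_simp;
    case/andP: t01.
have := @convex_powR R z z1 (Itv.mk tP) x y.
rewrite !inE/= !in_itv/= !andbT => /(_ x0 y0).
rewrite [X in X `^ _ <= _ -> _]convRE convRE.
by [].
Qed.

(** After scaling [f] and [g] to norm 1, their sum is a + b times a convex combination of the two,
    and convexity of the z-th power concludes. Norm 0 is treated apart because of the division. *)
Lemma minkowski_lz (I : eqType) (r : seq I) (f g : I -> R) :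
  (forall i, 0 <= f i) -> (forall i, 0 <= g i) ->
  lz z r (fun i => f i + g i) <= lz z r f + lz z r g.
Proof.
move=> f0 g0; set a := lz z r f; set b := lz z r g.
have a0 : 0 <= a by exact: lz_ge0.
have b0 : 0 <= b by exact: lz_ge0.
have [aE|aN] := eqVneq a 0.
  rewrite aE add0r; apply: lz_le => i ir.
  by rewrite (lz_eq0 aE ir) add0r g0 lexx.
have [bE|bN] := eqVneq b 0.
  rewrite bE addr0; apply: lz_le => i ir.
  by rewrite (lz_eq0 bE ir) addr0 f0 lexx.
have aP : lz z r f = a := erefl.
have bP : lz z r g = b := erefl.
clearbody a b.
have ap : 0 < a by rewrite lt0r aN a0.
have bp : 0 < b by rewrite lt0r bN b0.
have abp : 0 < a + b by rewrite addr_gt0.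
rewrite lz_le_powR ?addr_ge0//.
pose t := a / (a + b).
have t1 : 1 - t = b / (a + b).
  by rewrite /t -[1](@divff _ (a + b)) ?gt_eqF// -mulrBl addrAC subrr add0r.
have t01 : 0 <= t <= 1.
  by rewrite divr_ge0 ?addr_ge0//= ler_pdivrMr// mul1r lerDl.
have fgE i : f i + g i = (a + b) * (t * (f i / a) + (1 - t) * (g i / b)).
  by rewrite t1 /t; field; rewrite !gt_eqF ?aN ?bN.
apply: (@le_trans _ _ (\sum_(i <- r)
    (a + b) `^ z * (t * (f i / a) `^ z + (1 - t) * (g i / b) `^ z))).
  apply: ler_sum => i _; have [t0 t'0] : 0 <= t /\ 0 <= 1 - t.
    by case/andP: t01 => ? ?; rewrite subr_ge0.
  have fa0 : 0 <= f i / a by rewrite divr_ge0.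
  have gb0 : 0 <= g i / b by rewrite divr_ge0.
  rewrite fgE powRM ?(ltW abp)//; last by rewrite addr_ge0// mulr_ge0.
  by rewrite ler_wpM2l ?powR_ge0// powR_conv.
rewrite -mulr_sumr big_split/= -!mulr_sumr.
have nf (c : R) (h : I -> R) : 0 < c -> (forall i, 0 <= h i) ->
    lz z r h = c -> \sum_(i <- r) (h i / c) `^ z = 1.
  move=> cp h0 hc; under eq_bigr do rewrite powRM ?invr_ge0 ?(ltW cp)//.
  rewrite -mulr_suml -powR_lz hc -powRM ?invr_ge0 ?(ltW cp)//.
  by rewrite divff ?gt_eqF// powR1.
by rewrite (nf a)// (nf b)// !mulr1 subrKC mulr1.
Qed.

End PowerMean.

(** * Determinants of positive semidefinite forms *)

Section PositiveForms.
Context {R : realType}.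

Definition qform n (A : 'M[R]_n) (x : 'cV[R]_n) : R := (x^T *m A *m x) 0 0.

Definition psd n (A : 'M[R]_n) := A^T = A /\ forall x, 0 <= qform A x.

Definition schur n (A : 'M[R]_(1 + n)) : 'M[R]_n :=
  drsubmx A - (ulsubmx A 0 0)^-1 *: (dlsubmx A *m ursubmx A).

Lemma qform_block n (A : 'M[R]_(1 + n)) s (y : 'cV[R]_n) : A^T = A ->
  qform A (col_mx s%:M y) =
  ulsubmx A 0 0 * s ^+ 2 + 2 * s * (ursubmx A *m y) 0 0 + qform (drsubmx A) y.
Proof.
move=> As; rewrite /qform -{1}(submxK A) tr_col_mx tr_scalar_mx mul_row_block.
rewrite mul_row_col !mulmxDl.
have -> : y^T *m dlsubmx A *m s%:M = s *: (ursubmx A *m y)^T.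
  by rewrite mul_mx_scalar trmx_mul trmx_ursub As.
rewrite {1}(mx11_scalar (ulsubmx A)) -!scalar_mxM mul_scalar_mx -scalemxAl.
move: (y^T *m _ *m y) (ursubmx A *m y) (ulsubmx A 0 0) => D u a.
by rewrite !mxE eqxx mulr1n; ring.
Qed.

(** Completing the square in [s]: for a positive corner the Schur complement is the minimum of the
    form over the first coordinate. *)
Lemma qform_schur n (A : 'M[R]_(1 + n)) s (y : 'cV[R]_n) : A^T = A ->
  ulsubmx A 0 0 != 0 ->
  qform A (col_mx s%:M y) =
  ulsubmx A 0 0 * (s + (ursubmx A *m y) 0 0 / ulsubmx A 0 0) ^+ 2
  + qform (schur A) y.
Proof.
move=> As a0; rewrite qform_block// /schur.
have -> : qform (drsubmx A - (ulsubmx A 0 0)^-1 *: (dlsubmx A *m ursubmx A)) y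
    = qform (drsubmx A) y - (ulsubmx A 0 0)^-1 * (ursubmx A *m y) 0 0 ^+ 2.
  rewrite /qform mulmxBr mulmxBl mxE [X in _ + X]mxE; congr (_ - _).
  rewrite -scalemxAr -scalemxAl mxE; congr (_ * _).
  have -> : y^T *m (dlsubmx A *m ursubmx A) *m y
      = (ursubmx A *m y)^T *m (ursubmx A *m y).
    by rewrite trmx_mul trmx_ursub As !mulmxA.
  by rewrite mxE big_ord1 mxE expr2.
by field.
Qed.

Lemma det_schur n (A : 'M[R]_(1 + n)) : ulsubmx A 0 0 != 0 ->
  \det A = ulsubmx A 0 0 * \det (schur A).
Proof.
move=> a0; pose L : 'M[R]_(1 + n) :=
  block_mx 1%:M 0 (- (ulsubmx A 0 0)^-1 *: dlsubmx A) 1%:M.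
have dL : \det L = 1 by rewrite det_lblock !det1 mulr1.
have LA : L *m A = block_mx (ulsubmx A) (ursubmx A) 0 (schur A).
  rewrite -[X in L *m X](submxK A) mulmx_block !mul1mx !mul0mx !addr0 -!scalemxAl.
  rewrite {3}(mx11_scalar (ulsubmx A)) mul_mx_scalar scalerA mulNr mulVf//.
  by rewrite scaleN1r addNr /schur scaleNr [X in block_mx _ _ _ X]addrC.
rewrite -[LHS]mul1r -dL -det_mulmx LA det_ublock.
by rewrite {1}(mx11_scalar (ulsubmx A)) det_scalar1.
Qed.

Lemma schur_sym n (A : 'M[R]_(1 + n)) : A^T = A -> (schur A)^T = schur A.
Proof.
move=> As; rewrite /schur linearB/= linearZ/= trmx_mul trmx_drsub As.
by rewrite trmx_ursub trmx_dlsub As.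
Qed.

(** With a zero corner the form is affine in the first coordinate, so a nonzero first row would let
    it become negative; [s] below is tuned to reach the value -1. *)
Lemma psd_block0 n (A : 'M[R]_(1 + n)) : psd A -> ulsubmx A 0 0 = 0 -> \det A = 0.
Proof.
move=> [As Ap] a0.
have u0 : ursubmx A = 0.
  pose y := (ursubmx A)^T; pose s := - (1 + qform (drsubmx A) y) / 2.
  pose q := \sum_i ursubmx A 0 i ^+ 2.
  have uyE : (ursubmx A *m y) 0 0 = q.
    by rewrite mxE; apply: eq_bigr => i _; rewrite [y i 0]mxE expr2.
  have q0 : 0 <= q by apply: sumr_ge0 => i _; exact: sqr_ge0.
  have qE : q = 0.
    apply/eqP; rewrite eq_le q0 andbT leNgt; apply/negP => qp.
    have := Ap (col_mx (s / q)%:M y); rewrite qform_block// a0 mul0r add0r uyE.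
    have -> : 2 * (s / q) * q + qform (drsubmx A) y = -1.
      by rewrite /s; field; rewrite gt_eqF//.
    by lra.
  apply/rowP => i; rewrite [RHS]mxE; apply/eqP; rewrite -sqrf_eq0; apply/eqP.
  move/eqP: qE; rewrite psumr_eq0 => [/allP/(_ i (mem_index_enum i))/eqP//|j _].
  exact: sqr_ge0.
by rewrite -(submxK A) u0 det_lblock (mx11_scalar (ulsubmx A)) det_scalar1 a0 mul0r.
Qed.

Lemma qform_e0 n (A : 'M[R]_(1 + n)) : A^T = A ->
  qform A (col_mx 1%:M 0) = ulsubmx A 0 0.
Proof.
move=> As; rewrite qform_block// /qform !mulmx0 [in 2 * 1 * _]mxE.
by rewrite [X in _ + X]mxE mulr0 !addr0 expr1n mulr1.
Qed.

Lemma psd_ul n (A : 'M[R]_(1 + n)) : psd A -> 0 <= ulsubmx A 0 0.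
Proof.
by move=> [As Ap]; rewrite -qform_e0.
Qed.

Lemma psd_schur n (A : 'M[R]_(1 + n)) : psd A -> ulsubmx A 0 0 != 0 ->
  psd (schur A).
Proof.
move=> [As Ap] a0; split=> [|y]; first exact: schur_sym.
have := Ap (col_mx (- ((ursubmx A *m y) 0 0 / ulsubmx A 0 0))%:M y).
by rewrite qform_schur// addNr expr0n mulr0 add0r.
Qed.

(** Schur complements are minima over the first coordinate, hence monotone; [s] is the minimiser for
    [A]. *)
Lemma schur_le n (A B : 'M[R]_(1 + n)) : psd A -> psd B ->
  (forall x, qform B x <= qform A x) ->
  ulsubmx A 0 0 != 0 -> ulsubmx B 0 0 != 0 ->
  forall y, qform (schur B) y <= qform (schur A) y.
Proof.
move=> Ap Bp BA a0 b0 y.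
pose s := - ((ursubmx A *m y) 0 0 / ulsubmx A 0 0).
have := BA (col_mx s%:M y); rewrite !qform_schur ?(proj1 Ap) ?(proj1 Bp)//.
have -> : s + (ursubmx A *m y) 0 0 / ulsubmx A 0 0 = 0 by rewrite addNr.
rewrite expr0n mulr0 add0r.
by apply: le_trans; rewrite lerDr mulr_ge0 ?sqr_ge0// psd_ul.
Qed.

Lemma qform_mul n (A U : 'M[R]_n) x : qform (U^T *m A *m U) x = qform A (U *m x).
Proof. by rewrite /qform trmx_mul !mulmxA. Qed.

Lemma psd_mul n (A U : 'M[R]_n) : psd A -> psd (U^T *m A *m U).
Proof.
move=> [As Ap]; split=> [|x]; last by rewrite qform_mul.
by rewrite !trmx_mul trmxK As mulmxA.
Qed.

Lemma qformZ n (A : 'M[R]_n) a x : qform A (a *: x) = a ^+ 2 * qform A x.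
Proof.
rewrite /qform.
have -> : (a *: x)^T = a *: x^T by apply/matrixP => i j; rewrite !mxE.
by rewrite -!scalemxAl -scalemxAr scalerA mxE expr2.
Qed.

(** Induction on the dimension through Schur complements. For the factor [c], a change of basis
    makes [p] a multiple of the first basis vector: the corner then drops by [c], and the Schur
    complement does not grow. *)
Lemma det_psd_le n (A B : 'M[R]_n) : psd A -> psd B ->
  (forall x, qform B x <= qform A x) ->
  0 <= \det B <= \det A /\
  (forall c p, 0 <= c <= 1 -> p != 0 -> qform B p <= c * qform A p ->
    \det B <= c * \det A).
Proof.
elim: n A B => [|n IH] A B Ap Bp BA.
  rewrite !det_mx00 ler01 lexx; split=> // c p _.
  by rewrite (flatmx0 p) eqxx.
have det_ge0 (C : 'M[R]_(1 + n)) : psd C -> 0 <= \det C.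
  move=> Cp; have [c0|c0] := eqVneq (ulsubmx C 0 0) 0; first by rewrite psd_block0.
  have Cs := psd_schur Cp c0.
  rewrite det_schur// mulr_ge0 ?psd_ul//.
  by have [/andP[]] := IH _ _ Cs Cs (fun x => lexx _).
have key (C D : 'M[R]_(1 + n)) c : psd C -> psd D ->
    (forall x, qform D x <= qform C x) -> 0 <= c <= 1 ->
    ulsubmx D 0 0 <= c * ulsubmx C 0 0 -> \det D <= c * \det C.
  move=> Cp Dp DC /andP[c0 c1] dc.
  have [d0|d0] := eqVneq (ulsubmx D 0 0) 0.
    by rewrite psd_block0// mulr_ge0// det_ge0.
  have a0 : ulsubmx C 0 0 != 0.
    apply: contra_neq d0 => e0; apply/eqP; rewrite eq_le psd_ul// andbT.
    by rewrite (le_trans dc)// e0 mulr0.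
  have Ds := psd_schur Dp d0; have Cs := psd_schur Cp a0.
  have [/andP[sd0 sdc] _] := IH _ _ Cs Ds (schur_le Cp Dp DC a0 d0).
  rewrite !det_schur//; apply: le_trans (ler_wpM2r sd0 dc) _.
  by rewrite -mulrA ler_wpM2l// ler_wpM2l// psd_ul.
have p0 (c : R) (p : 'cV[R]_(1 + n)) : 0 <= c <= 1 -> p != 0 ->
    qform B p <= c * qform A p -> \det B <= c * \det A.
  move=> c01 pN h; pose U : 'M[R]_(1 + n) := col_ebase p.
  have Uu : U \in unitmx by exact: col_ebase_unit.
  have rp : \rank p = 1%N.
    by rewrite -mxrank_tr rank_rV trmx_eq0 pN.
  pose e0 : 'cV[R]_(1 + n) := col_mx 1%:M 0.
  pose a := row_ebase p 0 0.
  have pE : p = a *: (U *m e0).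
    rewrite -[LHS]mulmx_ebase rp -/U pid_mx_col {1}(mx11_scalar (row_ebase p)).
    by rewrite mul_mx_scalar.
  have a2 : 0 < a ^+ 2.
    rewrite lt0r sqr_ge0 andbT sqrf_eq0; apply: contra_neq pN => a0.
    by rewrite pE a0 scale0r.
  have dU : 0 < \det U ^+ 2.
    by rewrite lt0r sqr_ge0 andbT sqrf_eq0 -unitfE -unitmxE.
  have qe0 (C : 'M[R]_(1 + n)) : psd C ->
      qform (U^T *m C *m U) e0 = ulsubmx (U^T *m C *m U) 0 0.
    by move=> /(psd_mul U) [Cs _]; rewrite qform_e0.
  have := key (U^T *m A *m U) (U^T *m B *m U) c (psd_mul U Ap) (psd_mul U Bp).
  have BAU x : qform (U^T *m B *m U) x <= qform (U^T *m A *m U) x.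
    by rewrite !qform_mul.
  rewrite -!qe0// => /(_ BAU c01); rewrite !qform_mul.
  move: h; rewrite pE !qformZ mulrCA ler_pM2l// => h /(_ h).
  rewrite !det_mulmx det_tr => {}h; rewrite -(ler_pM2r dU); move: h.
  by apply: etrans; congr (_ <= _); ring.
(* Monotonicity is the case c = 1, with any nonzero vector. *)
have dBA : \det B <= \det A.
  rewrite -[leRHS]mul1r; apply: (p0 1 (col_mx 1%:M 0)); rewrite ?ler01 ?lexx//.
    apply/eqP => /(congr1 (fun M : 'cV[R]_(1 + n) => usubmx M 0 0)).
    by rewrite col_mxKu !mxE eqxx => /eqP; rewrite oner_eq0.
  by rewrite mul1r.
split; first by rewrite det_ge0.
by move=> c p; exact: p0.
Qed.

Lemma qformD n (A B : 'M[R]_n) x : qform (A + B) x = qform A x + qform B x.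
Proof. by rewrite /qform mulmxDr mulmxDl mxE. Qed.

Lemma qformZl n (A : 'M[R]_n) a x : qform (a *: A) x = a * qform A x.
Proof. by rewrite /qform -scalemxAr -scalemxAl mxE. Qed.

Lemma qform_scalar n a (x : 'cV[R]_n) : qform a%:M x = a * dotv x x.
Proof.
by rewrite -scalemx1 qformZl /qform mulmx1 dotvE.
Qed.

(* D *: Q0 keeps the determinant above a fixed fraction of that at Q0; eta
   makes it positive when Q0 is singular. *)
Definition reg_form n (D eta : R) (Q0 Q : 'M[R]_n) : 'M[R]_n :=
  Q + D *: Q0 + eta%:M.

Lemma qform_reg n (D eta : R) (Q0 Q : 'M[R]_n) x :
  qform (reg_form D eta Q0 Q) x = qform Q x + D * qform Q0 x + eta * dotv x x.
Proof. by rewrite !qformD qformZl qform_scalar. Qed.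

Lemma psd_reg n (D eta : R) (Q0 Q : 'M[R]_n) : 0 <= D -> 0 <= eta ->
  psd Q0 -> psd Q -> psd (reg_form D eta Q0 Q).
Proof.
move=> D0 e0 [Q0s Q0p] [Qs Qp]; split=> [|x].
  by rewrite /reg_form !raddfD/= tr_scalar_mx Qs; congr (_ + _ + _);
    apply/matrixP => i j; rewrite -[in RHS]Q0s !mxE.
by rewrite qform_reg !addr_ge0// mulr_ge0// dotvv_ge0.
Qed.

(** At [p] each of the two regularising terms is at most Q(p), so Q(p) is at least a third of the
    regularised form. Losing the fraction 1 - c of it loses at least (1 - c) / 3 of the whole. *)
Lemma det_reg_step n (D eta c : R) (Q0 Q Q' : 'M[R]_n) p :
  0 <= D -> 0 <= eta -> psd Q0 -> psd Q -> psd Q' ->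
  (forall x, qform Q' x <= qform Q x) -> 0 <= c <= 1 ->
  0 < qform Q p -> D * qform Q0 p <= qform Q p -> eta * dotv p p <= qform Q p ->
  qform Q' p <= c * qform Q p ->
  \det (reg_form D eta Q0 Q') <= (c + 2) / 3 * \det (reg_form D eta Q0 Q).
Proof.
move=> D0 e0 Q0p Qp Q'p QQ' c01 qp Dp ep cp.
have [_] := @det_psd_le n (reg_form D eta Q0 Q) (reg_form D eta Q0 Q')
  (psd_reg D0 e0 Q0p Qp) (psd_reg D0 e0 Q0p Q'p)
  (fun x => ltac:(by rewrite !qform_reg !lerD2r)).
move=> /(_ ((c + 2) / 3) p); apply; first by lra.
  apply/eqP => p0; move: qp.
  by rewrite p0 -(scale0r (0 : 'cV[R]_n)) qformZ expr0n mul0r ltxx.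
rewrite !qform_reg.
have : 0 <= (1 - c) * (qform Q p - D * qform Q0 p) by rewrite mulr_ge0; lra.
have : 0 <= (1 - c) * (qform Q p - eta * dotv p p) by rewrite mulr_ge0; lra.
lra.
Qed.

(** Since Q >= 0, the regularised form at [Q] dominates D Q0 + eta, hence D / (1 + D) times the
    regularised form at [Q0]. This is what bounds the number of witnesses. *)
Lemma det_reg_lower n (D eta : R) (Q0 Q : 'M[R]_n) : 0 < D -> 0 < eta ->
  psd Q0 -> psd Q ->
  0 < \det (reg_form D eta Q0 Q0) /\
  (D / (1 + D)) ^+ n * \det (reg_form D eta Q0 Q0) <= \det (reg_form D eta Q0 Q).
Proof.
move=> D0 e0 Q0p Qp; have D1 : 0 < 1 + D by rewrite addr_gt0.
have A0p := psd_reg (ltW D0) (ltW e0) Q0p Q0p.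
have Ap := psd_reg (ltW D0) (ltW e0) Q0p Qp.
split.
  have ep : psd (eta%:M : 'M[R]_n).
    split=> [|x]; first by rewrite tr_scalar_mx.
    by rewrite qform_scalar mulr_ge0 ?(ltW e0)// dotvv_ge0.
  have := @det_psd_le n _ _ A0p ep; rewrite det_scalar => -[x|/andP[_ h] _].
    rewrite qform_reg qform_scalar lerDr addr_ge0 ?mulr_ge0 ?(ltW D0)//;
      by case: Q0p.
  by apply: lt_le_trans h; rewrite exprn_gt0.
have rp : psd (D / (1 + D) *: reg_form D eta Q0 Q0).
  case: A0p => As Ap'; split=> [|x].
    by apply/matrixP => i j; rewrite -[in RHS]As !mxE.
  by rewrite qformZl mulr_ge0 ?divr_ge0 ?(ltW D0) ?(ltW D1).
have := @det_psd_le n _ _ Ap rp; rewrite detZ => -[x|/andP[_ h] _ //].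
rewrite qformZl !qform_reg.
have -> : D / (1 + D) * (qform Q0 x + D * qform Q0 x + eta * dotv x x)
    = D * qform Q0 x + D / (1 + D) * (eta * dotv x x).
  by field; rewrite gt_eqF.
have : D / (1 + D) * (eta * dotv x x) <= eta * dotv x x.
  rewrite ler_piMl ?mulr_ge0 ?(ltW e0) ?dotvv_ge0//.
  by rewrite ler_pdivrMr// mul1r lerDr.
by have := proj2 Qp x; lra.
Qed.

End PositiveForms.

(** * Residual forms and weighted trees *)

Section ResidualForm.
Context {R : realType}.

Definition basis_mx m (S : {vspace 'cV[R]_m}) : 'M[R]_(m, \dim S) :=
  \matrix_(i, j) (vbasis S)`_j i 0.

Lemma basis_mxE m (S : {vspace 'cV[R]_m}) c :
  basis_mx S *m c = \sum_i c i 0 *: (vbasis S)`_i.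
Proof.
apply/colP => i; rewrite mxE summxE.
by apply: eq_bigr => j _; rewrite !mxE mulrC.
Qed.

Definition basis_coord m (S : {vspace 'cV[R]_m}) v : 'cV[R]_(\dim S) :=
  \col_i coord (vbasis S) i v.

Lemma basis_coordK m (S : {vspace 'cV[R]_m}) v : v \in S ->
  basis_mx S *m basis_coord S v = v.
Proof.
move=> /coord_vbasis vE; rewrite basis_mxE [RHS]vE.
by apply: eq_bigr => i _; rewrite mxE.
Qed.

Definition resid_mx m (S U : {vspace 'cV[R]_m}) : 'M[R]_(m, \dim S) :=
  \matrix_(i, j) ((vbasis S)`_j - orthoproj U (vbasis S)`_j) i 0.

Lemma resid_mxE m (S U : {vspace 'cV[R]_m}) c :
  resid_mx S U *m c = basis_mx S *m c - orthoproj U (basis_mx S *m c).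
Proof.
rewrite basis_mxE linear_sum -sumrB; apply/colP => i; rewrite mxE summxE.
by apply: eq_bigr => j _; rewrite linearZ/= -scalerBr !mxE mulrC.
Qed.

(** A Gram matrix, so positive semidefiniteness is immediate. The basis of [S] may be arbitrary, as
    only determinants in the same coordinates are compared. *)
Definition dist_form m (S U : {vspace 'cV[R]_m}) : 'M[R]_(\dim S) :=
  (resid_mx S U)^T *m resid_mx S U.

Lemma qform_dist m (S U : {vspace 'cV[R]_m}) c :
  qform (dist_form S U) c =
  norm2 (basis_mx S *m c - orthoproj U (basis_mx S *m c)) ^+ 2.
Proof.
by rewrite sqr_norm2 -resid_mxE dotvE trmx_mul /qform !mulmxA.
Qed.

Lemma psd_dist m (S U : {vspace 'cV[R]_m}) : psd (dist_form S U).
Proof.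
split=> [|c]; first by rewrite trmx_mul trmxK.
by rewrite qform_dist sqr_ge0.
Qed.

(** Project [p] on the line through p' = P_U p in the direction f = y - p'. With g = p - p', the
    squared distance left is |g|^2 - <f,g>^2 / |f|^2. It is at most |f - g|^2 |g|^2 / |f|^2 because
    (<f,g> - |g|^2)^2 >= 0, and |f - g| = |y - p| is below |f| / c. *)
Lemma dist_add_point m (U U' : {vspace 'cV[R]_m}) (y p : 'cV[R]_m) (c : R) :
  (U <= U')%VS -> y \in U' -> 0 < c ->
  c * norm2 (y - p) < norm2 (y - orthoproj U p) ->
  norm2 (p - orthoproj U' p) ^+ 2 <= c ^- 2 * norm2 (p - orthoproj U p) ^+ 2.
Proof.
move=> UU' yU' c0; set p' := orthoproj U p.
set g := p - p'; set f := y - p' => cbe.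
have p'U' : p' \in U' by apply/(subvP UU')/orthoproj_mem.
have fU' : f \in U' by rewrite rpredB.
have e0 : 0 < norm2 f by apply: le_lt_trans cbe; rewrite mulr_ge0 ?norm2_ge0 ?ltW.
have ff0 : 0 < dotv f f by rewrite -sqr_norm2 exprn_gt0.
have ypE : y - p = f - g by rewrite /f /g opprB addrA subrK.
have ppE v : p - (p' + v) = g - v by rewrite opprD addrA.
clearbody f g; pose l := dotv f g / dotv f f.
have uU' : p' + l *: f \in U' by rewrite rpredD ?rpredZ.
have h1 : norm2 (p - orthoproj U' p) ^+ 2 <= dotv g g - dotv f g ^+ 2 / dotv f f.
  apply: (@le_trans _ _ (norm2 (p - (p' + l *: f)) ^+ 2)).
    by rewrite ler_pXn2r ?nnegrE ?norm2_ge0// orthoproj_min.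
  rewrite ppE sqr_norm2 !(dotvBl, dotvBr, dotvZl, dotvZr).
  rewrite (dotvC g f) le_eqVlt; apply/orP; left; apply/eqP.
  by rewrite /l; field; rewrite gt_eqF.
have bE : norm2 (y - p) ^+ 2 = dotv f f - 2 * dotv f g + dotv g g.
  by rewrite ypE sqr_norm2 !(dotvBl, dotvBr) (dotvC g f); ring.
have cb2 : c ^+ 2 * norm2 (y - p) ^+ 2 <= dotv f f.
  by rewrite -exprMn -sqr_norm2 ler_pXn2r ?nnegrE ?mulr_ge0 ?norm2_ge0 ?ltW.
apply: le_trans h1 _; rewrite sqr_norm2.
have c2 : 0 < c ^+ 2 by rewrite exprn_gt0.
rewrite -(ler_pM2l (mulr_gt0 c2 ff0)).
have -> : c ^+ 2 * dotv f f * (dotv g g - dotv f g ^+ 2 / dotv f f)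
    = c ^+ 2 * (dotv f f * dotv g g - dotv f g ^+ 2).
  by field; rewrite gt_eqF.
have -> : c ^+ 2 * dotv f f * (c ^- 2 * dotv g g) = dotv f f * dotv g g.
  by field; rewrite gt_eqF.
have gg : 0 <= dotv g g by exact: dotvv_ge0.
apply: (@le_trans _ _ (c ^+ 2 * norm2 (y - p) ^+ 2 * dotv g g)); last first.
  by rewrite ler_wpM2r.
rewrite -mulrA ler_wpM2l ?(ltW c2)// bE -subr_ge0.
have -> : (dotv f f - 2 * dotv f g + dotv g g) * dotv g g -
   (dotv f f * dotv g g - dotv f g ^+ 2) = (dotv f g - dotv g g) ^+ 2 by ring.
exact: sqr_ge0.
Qed.

End ResidualForm.

(** Supplies the regulariser [eta]: one value small enough for all of the finitely many points with
    V x > 0. *)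
Lemma uniform_scale {R : realFieldType} (T : eqType) (s : seq T) (N V : T -> R) :
  exists eta : R, 0 < eta /\ forall x, x \in s -> 0 < V x -> eta * N x <= V x.
Proof.
elim: s => [|x s [eta [e0 IH]]]; first by exists 1.
have [Vx|Vx] := ltP 0 (V x); last first.
  exists eta; split=> // y; rewrite inE => /predU1P[->|]; last exact: IH.
  by rewrite ltNge Vx.
pose e := Num.min eta (V x / (1 + `|N x|)).
have Nx : 0 < 1 + `|N x| by rewrite ltr_pwDl.
have e'0 : 0 < e by rewrite lt_min e0 divr_gt0.
exists e; split=> // y ys Vy.
have [N0|N0] := leP (N y) 0.
  by apply: le_trans (ltW Vy); rewrite pmulr_rle0.
move: ys; rewrite inE => /predU1P[yx|ys].
  rewrite yx in N0 Vy *.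
  apply: (@le_trans _ _ (V x / (1 + `|N x|) * N x)).
    by rewrite ler_pM2r// ge_min lexx orbT.
  rewrite mulrAC ler_pdivrMr// ler_pM2l//.
  by apply: le_trans (ler_norm _) _; rewrite lerDr.
apply: le_trans (IH _ ys Vy).
by rewrite ler_pM2r// ge_min lexx.
Qed.

Section WeightedTrees.
Context {R : realType} {T : eqType}.
Variables (X : seq T) (sig : T -> R).

(* When sig sums to 1, the probability that s extended by j independent points
   of law sig satisfies bad. *)
Fixpoint mass (bad : seq T -> bool) (j : nat) (s : seq T) : R :=
  if j is j'.+1 then \sum_(x <- X) sig x * mass bad j' (x :: s)
  else (bad s)%:R.

Hypothesis sig0 : forall x, 0 <= sig x.

Lemma mass_ge0 bad j s : 0 <= mass bad j s.
Proof.
elim: j s => [|j IH] s /=; first exact: ler0n.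
by apply: sumr_ge0 => x _; rewrite mulr_ge0.
Qed.

(** A good sequence either has bad one-point extensions of weight above [kap], or branches with
    weight at least [q] into good extensions. Good sequences are shorter than [n], so every branch
    reaches the first case within [n] levels. *)
Lemma mass_tree (bad : seq T -> bool) (good : seq T -> Prop)
    (wit : seq T -> T -> bool) (q kap : R) (n : nat) :
  0 <= q <= 1 -> 0 <= kap -> (forall s, good s -> (size s < n)%N) ->
  (forall s, good s -> mass bad 1 s <= kap ->
     q <= \sum_(x <- X | wit s x) sig x /\
     forall x, x \in X -> wit s x -> good (x :: s)) ->
  good [::] -> q ^+ n * kap <= \sum_(j < n) mass bad j.+1 [::].
Proof.
move=> /andP[q0 q1] kap0 gs gw g0.
(* [m] is the number of levels left; m = 0 contradicts the length bound on good sequences. *)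
suff key m s : (size s + m = n)%N -> good s ->
    q ^+ m * kap <= \sum_(j < m) mass bad j.+1 s by exact: key.
elim: m s => [|m IH] s sm gds; first by have := gs _ gds; rewrite -sm addn0 ltnn.
have [h|h] := leP (mass bad 1 s) kap; last first.
  rewrite big_ord_recl; apply: (@le_trans _ _ (mass bad 1 s)); last first.
    by rewrite lerDl sumr_ge0// => j _; rewrite mass_ge0.
  by apply: le_trans (ltW h); rewrite ler_piMl// exprn_ile1.
have [qw gw'] := gw s gds h.
rewrite big_ord_recl; apply: ler_wpDl; first exact: mass_ge0.
rewrite [leRHS](_ : _ =
    \sum_(x <- X) sig x * \sum_(j < m) mass bad j.+1 (x :: s)); last first.
  rewrite exchange_big; apply: eq_bigr => x _.
  by rewrite mulr_sumr.
rewrite (bigID (wit s))/=; apply: ler_wpDr.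
  by apply: sumr_ge0 => x _; rewrite mulr_ge0// sumr_ge0// => j _; exact: (mass_ge0 bad j.+1).
apply: (@le_trans _ _ (\sum_(x <- X | wit s x) sig x * (q ^+ m * kap))).
  by rewrite -mulr_suml exprS -mulrA ler_wpM2r// mulr_ge0// exprn_ge0.
rewrite [leLHS]big_seq_cond [leRHS]big_seq_cond; apply: ler_sum => x /andP[xX wx].
apply: ler_wpM2l => //; apply: IH; last exact: gw'.
by rewrite /= addSnnS.
Qed.

End WeightedTrees.

(** * The deterministic lower bound *)

Section Arithmetic.
Context {R : realFieldType}.
Implicit Types e a b r q x c : R.

(** For a point whose addition is bad: [r] is its residual, [x] its excess, [nxr] its distance to
    the approximant, [q] the distance from its projection on S to the approximant; a leading [A]
    marks lengths after applying the map. *)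
Lemma bad_point_arith e (nxr r q Aq Axr Aa x : R) : 0 < e -> e < 1 -> 0 <= r ->
  nxr <= r + q -> (1 - e / 32) * q <= Aq -> Aq <= Axr + Aa ->
  Aa <= (1 + e / 4) * r + x -> (1 - e / 32) * nxr <= Axr + (3 * r + x).
Proof.
move=> e0 e1 r0 h1 h2 h3 h4; have e32 : 0 <= 1 - e / 32 by lra.
have g5 := ler_wpM2l e32 h1.
have g6 : (1 - e / 32) * r <= r by rewrite ler_piMl//; lra.
have g7 : e / 4 * r <= r by rewrite ler_piMl//; lra.
lra.
Qed.

Lemma cost_lower_arith e (O L L1 L2 L3 : R) : 0 < e -> e < 1 -> 0 < O ->
  (1 - e / 32) * O <= L + L1 -> L1 <= 3 * L2 + L3 -> L2 <= e / 200 * O ->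
  L3 <= e ^+ 2 / 100 * O -> (1 - e / 8) * O <= L.
Proof.
move=> e0 e1 O0 h1 h2 h3 h4.
have e2 : e ^+ 2 * O <= e * O by rewrite ler_pM2r// expr2 ler_piMl// ltW.
have eO : 0 < e * O by rewrite mulr_gt0.
lra.
Qed.

(** The gap makes (1 + e/4) b^2 <= ee^2, so a^2 must supply a fraction of order e of ee^2. The
    resulting factor 3 / sqrt e is relaxed to 3 / e to stay rational. *)
Lemma e_witness_arith e (ee b a : R) : 0 < e -> e < 1 -> 0 <= b -> 0 <= a ->
  0 <= ee -> (1 + e / 8) * b < ee -> ee ^+ 2 <= b ^+ 2 + a ^+ 2 ->
  ee <= 3 / e * a.
Proof.
move=> e0 e1 b0 a0 ee0 wx ea.
rewrite -(ler_pXn2r (n := 2)) ?nnegrE ?mulr_ge0 ?invr_ge0 ?(ltW e0)//.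
have b2 : (1 + e / 4) * b ^+ 2 <= ee ^+ 2.
  apply: (@le_trans _ _ (((1 + e / 8) * b) ^+ 2)).
    rewrite exprMn ler_wpM2r ?sqr_ge0// sqrrD; have := sqr_ge0 (e / 8); lra.
  rewrite ler_pXn2r ?nnegrE ?mulr_ge0 ?(ltW wx)//; lra.
have k1 : e * ee ^+ 2 <= 9 * a ^+ 2.
  have : 0 <= (1 - e) * a ^+ 2 by rewrite mulr_ge0 ?sqr_ge0//; lra.
  have e4 : 0 <= 1 + e / 4 by lra.
  have := ler_wpM2l e4 ea; have := sqr_ge0 a; lra.
rewrite -(ler_pM2l (exprn_gt0 2 e0)).
have -> : e ^+ 2 * (3 / e * a) ^+ 2 = 9 * a ^+ 2 by field; rewrite gt_eqF.
have := ler_wpM2l (ltW e0) k1.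
have : 0 <= (1 - e) * a ^+ 2 by rewrite mulr_ge0 ?sqr_ge0//; lra.
by lra.
Qed.

Lemma witness_point_arith e (ee b h0 h a r x f : R) :
  0 < e -> e < 1 -> 0 <= b -> 0 <= a -> 0 <= r -> 0 <= x ->
  h0 <= b + a -> a <= (1 + e / 4) * r + x -> ee <= b + h ->
  (ee <= 3 / e * a /\ f = r) \/
  ((ee <= (1 + e / 8) * b \/ h <= e / 100 * h0) /\ f = 0) ->
  ee <= (1 + e / 8 + e / 100) * b + (2 * (e / 100) * r +
    ((e / 100 + 3 / e) * x + 2 * (3 / e) * f)).
Proof.
move=> e0 e1 b0 a0 r0 x0 hh ax eh.
have eax : a <= 2 * r + x.
  by apply: le_trans ax _; rewrite lerD2r ler_wpM2r//; lra.
have c20 : 0 <= e / 100 by lra.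
have c30 : 0 <= 3 / e by rewrite divr_ge0// ltW.
move: c20 c30; set c2 := e / 100; set c3 := 3 / e => c20 c30.
have p1 := mulr_ge0 c20 b0; have p2 := mulr_ge0 c20 r0.
have p3 := mulr_ge0 c20 x0; have p4 := mulr_ge0 c30 x0.
have p5 := mulr_ge0 (ltW e0) b0.
move=> [[g ->]|[g ->]].
  have g2 := ler_wpM2l c30 eax.
  lra.
have g2 := ler_wpM2l c20 eax; have g3 := ler_wpM2l c20 hh.
by case: g => g; lra.
Qed.

(** The gain e/2 in [B] exceeds all the losses (e/8 twice, multiples of e/100 and the excess) by at
    least e/10, which only the witness term 6 F / e can supply. Hence F >= e^2 O / 60. *)
Lemma witness_total_arith e (O E B X F : R) :
  0 < e -> e < 1 -> 0 < O -> (1 - e / 8) * O <= E ->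
  E <= (1 + e / 8 + e / 100) * B + (2 * (e / 100) * O +
    ((e / 100 + 3 / e) * X + 2 * (3 / e) * F)) ->
  B <= (1 - e / 2) * O -> X <= e ^+ 2 / 100 * O ->
  e ^+ 2 / 100 * O <= F.
Proof.
move=> e0 e1 O0 h1 h2 h3 h4.
have c20 : 0 <= e / 100 by lra.
have c30 : 0 <= 3 / e by rewrite divr_ge0// ltW.
have g5 : (e / 100 + 3 / e) * X <= (e / 100 + 3 / e) * (e ^+ 2 / 100 * O).
  by rewrite ler_wpM2l// addr_ge0.
have c10 : 0 <= 1 + e / 8 + e / 100 by lra.
have g6 := ler_wpM2l c10 h3.
have E5 : (e / 100 + 3 / e) * (e ^+ 2 / 100 * O) =
    e ^+ 2 * (e * O) / 10000 + 3 / 100 * (e * O) by field; rewrite gt_eqF.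
have e2 : e ^+ 2 <= 1 by rewrite expr_le1 ?(ltW e0) ?(ltW e1).
have eO : 0 < e * O by rewrite mulr_gt0.
have e2O : e ^+ 2 * (e * O) <= e * O by rewrite ler_piMl// ltW.
have E6 : (1 + e / 8 + e / 100) * ((1 - e / 2) * O) =
    O - (3 / 8 - 1 / 100) * (e * O) - (1 / 16 + 1 / 200) * (e * (e * O)) by field.
have p : 0 <= e * (e * O) by rewrite mulr_ge0 ?(ltW eO) ?(ltW e0).
have g9 : e / 10 * O <= 2 * (3 / e) * F by lra.
have := ler_wpM2l (ltW e0) g9.
have -> : e * (2 * (3 / e) * F) = 6 * F by field; rewrite gt_eqF.
have : 0 < e * (e * O) by rewrite mulr_gt0.
lra.
Qed.

End Arithmetic.

(** * Witnesses and the mass forced by a too cheap subspace *)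

Section LowerBound.
Context {R : realType}.
Variables (d t k : nat) (z : R) (X : seq 'cV[R]_d) (S : {vspace 'cV[R]_d}).
Hypothesis z1 : 1 <= z.

Definition residual (x : 'cV[R]_d) : R := norm2 (x - orthoproj S x).

Definition opt : R := lz z X residual.

Definition weight (x : 'cV[R]_d) : R := (residual x / opt) `^ z.

Definition extend (s : seq 'cV[R]_d) : {vspace 'cV[R]_d} := (S + span s)%VS.

(** Controlled only in l_z norm over X, never point by point, since X may have arbitrarily many
    points. *)
Definition excess (eps : R) (A : 'M[R]_(t, d)) (x : 'cV[R]_d) : R :=
  Num.max 0 (norm2 (A *m (x - orthoproj S x)) - (1 + eps / 4) * residual x).

Hypothesis dimS : (\dim S <= k)%N.
Hypothesis optS : forall S' : {vspace 'cV[R]_d}, (\dim S' <= k)%N ->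
  opt <= lz z X (fun x => norm2 (x - orthoproj S' x)).
Hypothesis opt_gt0 : 0 < opt.

Variable A : 'M[R]_(t, d).
Variable bad : seq 'cV[R]_d -> bool.

(** [bad] may reject more sequences than those where [A] fails: only its negation carries
    information. This leaves room for a measurable test on a finite net. *)
Record good_embedding (eps : R) : Prop := {
  good_eps_gt0 : 0 < eps;
  good_eps_lt1 : eps < 1;
  good_lower : forall s w, ~~ bad s -> w \in extend s ->
    (1 - eps / 32) * norm2 w <= norm2 (A *m w);
  good_excess : lz z X (excess eps A) <= eps ^+ 2 / 100 * opt }.

Let z0 : 0 < z. Proof. exact: lt_le_trans z1. Qed.

Lemma residual_ge0 x : 0 <= residual x. Proof. exact: norm2_ge0. Qed.

Lemma excess_ge0 eps x : 0 <= excess eps A x. Proof. by rewrite le_max lexx. Qed.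

Lemma weight_ge0 x : 0 <= weight x. Proof. exact: powR_ge0. Qed.

Lemma norm2_mul_residual eps x :
  norm2 (A *m (x - orthoproj S x)) <= (1 + eps / 4) * residual x + excess eps A x.
Proof. by rewrite -lerBlDl le_max lexx orbT. Qed.

Lemma weightE x : weight x = residual x `^ z / opt `^ z.
Proof. by apply: powR_div opt_gt0; exact: residual_ge0. Qed.

Lemma sum_weight : \sum_(x <- X) weight x = 1.
Proof.
under eq_bigr do rewrite weightE.
rewrite -mulr_suml -(powR_lz z1) -/opt divff// gt_eqF// powR_gt0//.
Qed.

Lemma lz_restrict (P : pred 'cV[R]_d) :
  lz z X (fun x => if P x then residual x else 0) `^ z =
  opt `^ z * \sum_(x <- X | P x) weight x.
Proof.
rewrite mulr_sumr [RHS]big_mkcond; apply: (etrans (powR_lz z1 _ _)).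
apply: eq_bigr => x _.
case: (P x); last by rewrite powR0 ?gt_eqF.
by rewrite weightE mulrC divfK// gt_eqF// powR_gt0.
Qed.

Lemma sum_weight_le (P : pred 'cV[R]_d) c : 0 <= c ->
  \sum_(x <- X | P x) weight x <= c `^ z ->
  lz z X (fun x => if P x then residual x else 0) <= c * opt.
Proof.
move=> c0 h; rewrite (lz_le_powR z1) ?mulr_ge0 ?(ltW opt_gt0)//.
rewrite -(powR_lz z1) lz_restrict powRM ?(ltW opt_gt0)// mulrC.
by rewrite ler_wpM2r ?powR_ge0.
Qed.

Lemma sum_weight_ge (P : pred 'cV[R]_d) c : 0 <= c ->
  c * opt <= lz z X (fun x => if P x then residual x else 0) ->
  c `^ z <= \sum_(x <- X | P x) weight x.
Proof.
move=> c0; rewrite (powR_le_lz z1) ?mulr_ge0 ?(ltW opt_gt0)//.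
rewrite -(powR_lz z1) lz_restrict powRM ?(ltW opt_gt0)// mulrC.
by rewrite ler_pM2l// powR_gt0.
Qed.

(** A set of points of weight at most this carries at most eps / 200 of [opt] in l_z norm. *)
Definition threshold (eps : R) : R := (eps / 200) `^ z.

Lemma threshold_lt1 eps : 0 < eps < 1 -> threshold eps < 1.
Proof.
move=> /andP[e0 e1]; have h : eps / 200 < 1 by lra.
rewrite -[ltRHS](congr1 (@^~ z) (powR1 R)).
apply: (gt0_ltr_powR z0); rewrite ?nnegrE.
- by rewrite divr_ge0 ?ler0n ?(ltW e0).
- exact: ler01.
- exact: h.
Qed.

Lemma extendS x s : (extend s <= extend (x :: s))%VS.
Proof. by rewrite /extend span_cons; apply: addvS => //; exact: addvSr. Qed.

Lemma extend_mem x s : x \in extend (x :: s).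
Proof.
by rewrite /extend (subvP (addvSr _ _))// memv_span// inE eqxx.
Qed.

Lemma extend_orthoproj s x : orthoproj S x \in extend s.
Proof. by rewrite /extend (subvP (addvSl _ _))// orthoproj_mem. Qed.

(* If A distorted extend s, all one-point extensions of s would be bad, and
   they have total mass 1. *)
Lemma good_mass eps s : good_embedding eps ->
  mass X weight bad 1 s <= threshold eps ->
  forall w, w \in extend s -> (1 - eps / 32) * norm2 w <= norm2 (A *m w).
Proof.
move=> [e0 e1 badP _] h w ws; apply: contrapT => nw.
suff: 1 <= threshold eps by rewrite leNgt threshold_lt1// e0.
apply: le_trans h; rewrite /= -[leLHS]sum_weight; apply: ler_sum => x _.
have [_|gx] := boolP (bad (x :: s)); first by rewrite mulr1.
by case: nw; apply: (badP _ _ gx); apply: (subvP (extendS x s)).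
Qed.

(** As [r] takes values in a subspace of dimension at most k, the vectors x - r x have l_z norm at
    least [opt]. [A] preserves their length when x :: s is not bad. Otherwise x is replaced by its
    projection on S, which lies in [extend s], at a price proportional to the residual, plus the
    excess; bad points carry little residual. *)
Lemma cost_lower eps s (r : 'cV[R]_d -> 'cV[R]_d) (S' : {vspace 'cV[R]_d}) :
  good_embedding eps -> mass X weight bad 1 s <= threshold eps ->
  (\dim S' <= k)%N -> (forall x, r x \in S') -> (forall x, r x \in extend s) ->
  (1 - eps / 8) * opt <= lz z X (fun x => norm2 (A *m (x - r x))).
Proof.
move=> Hg h dS' rS' rs; have [e0 e1 badP excessP] := Hg.
have e32 : 0 <= 1 - eps / 32.
  by rewrite subr_ge0 ler_pdivrMr// mul1r (le_trans (ltW e1))// ler1n.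
pose B x := bad (x :: s).
pose f1 x := if B x then residual x else 0.
have B_le : lz z X f1 <= eps / 200 * opt.
  apply: sum_weight_le; first by rewrite divr_ge0 ?(ltW e0).
  apply: le_trans h; rewrite /= big_mkcond; apply: ler_sum => x _.
  by rewrite /B; case: (bad _); rewrite ?mulr1 ?mulr0.
have f10 x : 0 <= f1 x by rewrite /f1; case: (B x); rewrite ?residual_ge0.
have pt x : (1 - eps / 32) * norm2 (x - r x) <=
    norm2 (A *m (x - r x)) + (3 * f1 x + excess eps A x).
  have ex0 := excess_ge0 eps x; rewrite /f1 /B.
  have [bx|gx] := boolP (bad (x :: s)); last first.
    rewrite mulr0 add0r; apply: ler_wpDr => //; apply: (badP _ _ gx).
    by rewrite rpredB// ?extend_mem// (subvP (extendS x s)).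
  have := good_mass Hg h (rpredB (extend_orthoproj s x) (rs x)) => g1.
  have g2 : norm2 (x - r x) <= residual x + norm2 (orthoproj S x - r x).
    by apply: le_trans (ler_norm2D _ _); rewrite addrA subrK.
  have g3 : norm2 (A *m (orthoproj S x - r x)) <=
      norm2 (A *m (x - r x)) + norm2 (A *m (x - orthoproj S x)).
    have -> : orthoproj S x - r x = (x - r x) - (x - orthoproj S x).
      by rewrite opprB [RHS]addrC addrA subrK.
    by rewrite mulmxBr ler_norm2B.
  exact: (bad_point_arith e0 e1 (residual_ge0 x) g2 g1 g3
    (norm2_mul_residual eps x)).
have g1 : (1 - eps / 32) * opt <=
    lz z X (fun x => norm2 (A *m (x - r x)) + (3 * f1 x + excess eps A x)).
  apply: (@le_trans _ _ (lz z X (fun x => (1 - eps / 32) * norm2 (x - r x)))).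
    rewrite (@lzZ R z z1 _ X _ _ e32 (fun x => norm2_ge0 (x - r x))).
    apply: (ler_wpM2l e32).
    apply: le_trans (optS dS') _; apply: (lz_le z1) => x _.
    by rewrite norm2_ge0/= orthoproj_min.
  by apply: (lz_le z1) => x _; rewrite pt andbT mulr_ge0 ?norm2_ge0.
have f0 x : 0 <= 3 * f1 x by rewrite mulr_ge0.
have g2 := minkowski_lz z1 X (fun x => norm2_ge0 (A *m (x - r x)))
  (fun x => addr_ge0 (f0 x) (excess_ge0 eps x)).
have g3 := minkowski_lz z1 X f0 (excess_ge0 eps).
rewrite (@lzZ R z z1 _ X f1 3 (ler0n _ 3) f10) in g3.
exact: (cost_lower_arith e0 e1 opt_gt0 (le_trans g1 g2) g3 B_le excessP).
Qed.

Section Violation.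
Variable S' : {vspace 'cV[R]_t}.
Hypothesis dimS' : (\dim S' <= k)%N.

Definition image_ext (s : seq 'cV[R]_d) : {vspace 'cV[R]_t} :=
  (linfun (mulmx A) @: extend s)%VS.

(** [b] is the cost of the cheap candidate, [e] the cost once [p] is rounded into the image of
    [extend s], where it can be lifted back to the source space, and [h] the length of that
    rounding. *)
Let p x := orthoproj S' (A *m x).
Let b x := norm2 (A *m x - p x).
Let e s x := norm2 (A *m x - orthoproj (image_ext s) (p x)).
Let h s x := norm2 (p x - orthoproj (image_ext s) (p x)).

Lemma image_ext_mem s w : w \in extend s -> A *m w \in image_ext s.
Proof. by move=> ws; rewrite -[A *m w](lfunE (mulmx A)) memv_img. Qed.

Lemma image_extS x s : (image_ext s <= image_ext (x :: s))%VS.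
Proof. exact/limgS/extendS. Qed.

(* The second condition makes the regularising term D *: Q0 negligible at p x,
   as det_reg_step needs. *)
Definition witness (eps : R) s x := ((1 + eps / 8) * b x < e s x) &&
  (eps / 100 * h [::] x <= h s x).

Let b0 x : 0 <= b x. Proof. exact: norm2_ge0. Qed.
Let h0 s x : 0 <= h s x. Proof. exact: norm2_ge0. Qed.
Let es0 s x : 0 <= e s x. Proof. exact: norm2_ge0. Qed.

Lemma h_le x : h [::] x <= b x + norm2 (A *m (x - orthoproj S x)).
Proof.
have m := image_ext_mem (extend_orthoproj [::] x).
apply: le_trans (orthoproj_min (p x) m) _.
have -> : p x - A *m orthoproj S x =
    A *m (x - orthoproj S x) - (A *m x - p x).
  by rewrite mulmxBr opprB [RHS]addrC addrA subrK.
by rewrite [leRHS]addrC ler_norm2B.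
Qed.

(** Pythagoras at the image of [extend s]: the orthogonal part is compared with the image of the
    projection of x on S, and the part inside is the projection of A x - p x. *)
Lemma e_sqr_le s x : e s x ^+ 2 <= b x ^+ 2 + norm2 (A *m (x - orthoproj S x)) ^+ 2.
Proof.
rewrite /e (norm2_pythagoras _ (orthoproj_mem _ _)) addrC; apply: lerD.
  rewrite ler_pXn2r ?nnegrE ?norm2_ge0// -linearB; exact: norm2_orthoproj_le.
rewrite ler_pXn2r ?nnegrE ?norm2_ge0// mulmxBr.
exact/orthoproj_min/image_ext_mem/extend_orthoproj.
Qed.

Lemma e_le s x : e s x <= b x + h s x.
Proof. by apply: le_trans (ler_norm2D _ _); rewrite addrA subrK. Qed.

Lemma e_witness_le eps s x : good_embedding eps -> witness eps s x ->
  e s x <= 3 / eps * norm2 (A *m (x - orthoproj S x)).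
Proof.
move=> [e0 e1 _ _] /andP[wx _]; have := e_sqr_le s x.
move=> ee.
exact: (e_witness_arith e0 e1 (b0 x) (norm2_ge0 _) (es0 s x) wx ee).
Qed.

(** Produces an approximant to which the optimality of S applies. Preimages are chosen only for a
    basis of S' and extended linearly; lifting each point separately would not bound the
    dimension. *)
Lemma lift_projection s : exists (r : 'cV[R]_d -> 'cV[R]_d)
    (S1 : {vspace 'cV[R]_d}),
  [/\ (\dim S1 <= k)%N, forall x, r x \in S1, forall x, r x \in extend s &
      forall x, A *m r x = orthoproj (image_ext s) (p x)].
Proof.
have pre u : exists v, u \in image_ext s -> v \in extend s /\ A *m v = u.
  have [/memv_imgP[v vs ->]|un] := boolP (u \in image_ext s).
    by exists v => _; rewrite lfunE.
  by exists 0.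
have [g gP] := choice pre.
pose q (i : 'I_(\dim S')) := g (orthoproj (image_ext s) (vbasis S')`_i).
have qP i : q i \in extend s /\ A *m q i = orthoproj (image_ext s) (vbasis S')`_i.
  by apply: gP; exact: orthoproj_mem.
exists (fun x => \sum_i coord (vbasis S') i (p x) *: q i).
exists (span [seq q i | i <- enum (ordinal (\dim S'))]); split.
- by rewrite (leq_trans (dim_span _))// size_map size_enum_ord.
- move=> x; apply: rpred_sum => i _; apply/rpredZ/memv_span.
  by apply/map_f; rewrite mem_enum.
- by move=> x; apply: rpred_sum => i _; apply: rpredZ; case: (qP i).
move=> x; have pS : p x \in S' by exact: orthoproj_mem.
rewrite mulmx_sumr [in RHS](coord_vbasis pS).
rewrite linear_sum; apply: eq_bigr => i _.
by rewrite -scalemxAr linearZ/=; case: (qP i) => _ ->.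
Qed.

(** By [cost_lower] the rounded cost is at least (1 - eps/8) [opt], although the candidate costs at
    most (1 - eps/2) [opt]. Points that are not witnesses cannot make up the difference, so
    witnesses carry a residual of l_z norm at least eps^2 / 100 of [opt]. *)
Lemma witness_weight eps s : good_embedding eps ->
  lz z X b <= (1 - eps / 2) * opt -> mass X weight bad 1 s <= threshold eps ->
  (eps ^+ 2 / 100) `^ z <= \sum_(x <- X | witness eps s x) weight x.
Proof.
move=> Hg violS' ms; have [e0 e1 badP excessP] := Hg.
have [r [S1 [dS1 rS1 rs rE]]] := lift_projection s.
have low := cost_lower Hg ms dS1 rS1 rs.
have eE : lz z X (fun x => norm2 (A *m (x - r x))) = lz z X (e s).
  by apply: eq_lz => // x _; rewrite mulmxBr rE.
rewrite {}eE in low.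
apply: sum_weight_ge; first by rewrite divr_ge0 ?exprn_ge0 ?(ltW e0).
pose f x := if witness eps s x then residual x else 0.
have f0 x : 0 <= f x by rewrite /f; case: ifP; rewrite ?residual_ge0.
have c1 : 0 <= 1 + eps / 8 + eps / 100.
  by rewrite !addr_ge0// divr_ge0// ltW.
have c2 : 0 <= eps / 100 by rewrite divr_ge0// ltW.
have c3 : 0 <= 3 / eps by rewrite divr_ge0// ltW.
have pt x := witness_point_arith e0 e1 (b0 x) (norm2_ge0 _) (residual_ge0 x)
  (excess_ge0 eps x) (h_le x) (norm2_mul_residual eps x) (e_le s x).
have {}pt x : e s x <= (1 + eps / 8 + eps / 100) * b x +
    (2 * (eps / 100) * residual x +
    ((eps / 100 + 3 / eps) * excess eps A x + 2 * (3 / eps) * f x)).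
  apply: pt; rewrite /f; have [wx|nw] := boolP (witness eps s x).
    by left; split=> //; exact: e_witness_le.
  right; split=> //; move: nw; rewrite negb_and -leNgt -ltNge => /orP[g|g].
    by left.
  by right; exact: ltW.
have f1 x : 0 <= (1 + eps / 8 + eps / 100) * b x by exact: mulr_ge0 c1 (b0 x).
have f2 x : 0 <= 2 * (eps / 100) * residual x.
  exact: mulr_ge0 (mulr_ge0 (ler0n _ 2) c2) (residual_ge0 x).
have f3 x : 0 <= (eps / 100 + 3 / eps) * excess eps A x.
  exact: mulr_ge0 (addr_ge0 c2 c3) (excess_ge0 eps x).
have f4 x : 0 <= 2 * (3 / eps) * f x.
  exact: mulr_ge0 (mulr_ge0 (ler0n _ 2) c3) (f0 x).
have g1 := lz_le z1 (fun x (_ : x \in X) =>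
  introT andP (conj (es0 s x) (pt x))).
have g2 := minkowski_lz z1 X f1 (fun x => addr_ge0 (f2 x) (addr_ge0 (f3 x) (f4 x))).
have g3 := minkowski_lz z1 X f2 (fun x => addr_ge0 (f3 x) (f4 x)).
have g4 := minkowski_lz z1 X f3 f4.
rewrite (@lzZ R z z1 _ X b _ c1 b0) in g2.
rewrite (@lzZ R z z1 _ X residual _ (mulr_ge0 (ler0n _ 2) c2) residual_ge0) in g3.
rewrite (@lzZ R z z1 _ X _ _ (addr_ge0 c2 c3) (excess_ge0 eps)) in g4.
rewrite (@lzZ R z z1 _ X f _ (mulr_ge0 (ler0n _ 2) c3) f0) in g4.
have g5 := le_trans g1 (le_trans g2 (lerD (lexx _) (le_trans g3 (lerD (lexx _) g4)))).
exact: (witness_total_arith e0 e1 opt_gt0 low g5 violS' excessP).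
Qed.

Lemma image_ext_nil s : (image_ext [::] <= image_ext s)%VS.
Proof. by apply: limgS; rewrite /extend span_nil addv0 addvSl. Qed.

Let Q s := dist_form S' (image_ext s).
Let cf x := basis_coord S' (p x).

Lemma qform_h s x : qform (Q s) (cf x) = h s x ^+ 2.
Proof. by rewrite qform_dist basis_coordK// orthoproj_mem. Qed.

Lemma witness_h_gt0 eps s x : 0 < eps -> witness eps s x -> 0 < h s x.
Proof.
move=> e0 /andP[wx _]; have bh := lt_le_trans wx (e_le s x).
rewrite mulrDl mul1r ltrD2l in bh; apply: le_lt_trans bh.
by rewrite mulr_ge0// divr_ge0// ltW.
Qed.

(** The factor (c + 2) / 3 of [det_reg_step] for the contraction c = (1 + eps/8)^-2 that
    [dist_add_point] gives at a witness. *)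
Definition shrink (eps : R) : R := ((1 + eps / 8) ^- 2 + 2) / 3.

Lemma shrink_itv eps : 0 < eps -> 0 < shrink eps < 1.
Proof.
move=> e0; have e8 : 1 < 1 + eps / 8 by rewrite ltrDl divr_gt0.
have e80 : 0 < 1 + eps / 8 := lt_trans ltr01 e8.
rewrite /shrink divr_gt0 ?addr_gt0 ?invr_gt0 ?exprn_gt0//=.
rewrite ltr_pdivrMr// mul1r -ltrBrDr.
have -> : (3 - 2 : R) = 1 by ring.
by rewrite invf_lt1 ?exprn_gt0// exprn_egt1.
Qed.

Lemma violation_mass eps n : good_embedding eps ->
  lz z X b <= (1 - eps / 2) * opt ->
  shrink eps ^+ n < ((eps / 100) ^+ 2 / (1 + (eps / 100) ^+ 2)) ^+ k ->
  ((eps ^+ 2 / 100) `^ z) ^+ n * threshold eps <=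
    \sum_(j < n) mass X weight bad j.+1 [::].
Proof.
move=> Hg violS' nk; have [e0 e1 _ _] := Hg.
have c0 : 0 < 1 + eps / 8 by rewrite addr_gt0// divr_gt0.
have c8 : 1 <= 1 + eps / 8 by rewrite lerDl divr_ge0// ltW.
have /andP[s0 s1] := shrink_itv e0.
(* The square of the ratio in the second condition of [witness], since the forms are squared
   distances. *)
move: nk; set D := (eps / 100) ^+ 2 => nk.
have D0 : 0 < D by rewrite exprn_gt0// divr_gt0.
have [eta [eta0 etaP]] :=
  uniform_scale X (fun x => dotv (cf x) (cf x)) (fun x => D * h [::] x ^+ 2).
pose pot s := \det (reg_form D eta (Q [::]) (Q s)).
have pQ s : psd (Q s) by exact: psd_dist.
have lowQ s := det_reg_lower D0 eta0 (pQ [::]) (pQ s).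
(* Good means that each point so far has paid its factor [shrink eps]; by the lower bound on the
   determinant this cannot go on for [n] points. *)
apply: (mass_tree weight_ge0
  (good := fun s => pot s <= shrink eps ^+ size s * pot [::])
  (wit := witness eps)).
- rewrite powR_ge0/= -[leRHS](congr1 (@^~ z) (powR1 R)).
  apply: (ge0_ler_powR (ltW z0)); rewrite ?nnegrE ?ler01//.
    by rewrite divr_ge0 ?exprn_ge0// ltW.
  rewrite ler_pdivrMr// mul1r (@le_trans _ _ 1)// ?ler1n//.
  by rewrite expr_le1// ltW.
- exact: powR_ge0.
- move=> s gs; rewrite ltnNge; apply/negP => ns.
  have [pot0 low] := lowQ s.
  have := le_trans low gs; rewrite (ler_pM2r pot0) leNgt => /negP; apply.
  apply: le_lt_trans (lt_le_trans nk _).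
    by rewrite ler_wiXn2l// ltW.
  (* The determinant bound has exponent \dim S' <= k, and D / (1 + D) <= 1. *)
  have r0 : 0 <= D / (1 + D) by rewrite divr_ge0 ?addr_ge0 ?(ltW D0).
  rewrite ler_wiXn2l// ler_pdivrMr ?addr_gt0// mul1r lerDr.
  exact: ler01.
- move=> s gs ms; split=> [|x xX wx]; first exact: witness_weight.
  have hs := witness_h_gt0 e0 wx.
  have hs0 : h s x <= h [::] x by exact: dist_subv (image_ext_nil s).
  have Dh : D * h [::] x ^+ 2 <= h s x ^+ 2.
    case/andP: (wx) => _; rewrite -exprMn => wh.
    by rewrite ler_pXn2r ?nnegrE ?h0// mulr_ge0 ?h0// divr_ge0// ltW.
  rewrite /= exprS -mulrA.
  apply: (@le_trans _ _ (shrink eps * pot s)); last by rewrite ler_pM2l.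
  have c2i : 0 <= (1 + eps / 8) ^- 2 <= 1.
    rewrite invr_ge0 exprn_ge0 ?(ltW c0)//= invf_le1 ?exprn_gt0//.
    exact: exprn_ege1.
  apply: (det_reg_step (p := cf x) (ltW D0) (ltW eta0)) => //.
  - move=> u; rewrite !qform_dist ler_pXn2r ?nnegrE ?norm2_ge0//.
    exact: dist_subv (image_extS x s).
  - by rewrite qform_h exprn_gt0.
  - by rewrite !qform_h.
  - rewrite qform_h; apply: le_trans Dh; apply: etaP => //.
    by rewrite mulr_gt0// exprn_gt0// (lt_le_trans hs).
  - rewrite !qform_h; apply: (dist_add_point (image_extS x s)) c0 _.
      exact: image_ext_mem (extend_mem x s).
    by case/andP: wx.
- by rewrite expr0 mul1r.
Qed.

End Violation.
End LowerBound.

(** * Nets *)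

Section OrthonormalBasis.
Context {R : realType}.

Lemma dotv_mulmx m n (B : 'M[R]_(m, n)) u v : dotv (B *m u) v = dotv u (B^T *m v).
Proof. by rewrite !dotvE trmx_mul trmxK mulmxA. Qed.

Lemma norm2_isometry m n (B : 'M[R]_(m, n)) c :
  B^T *m B = 1%:M -> norm2 (B *m c) = norm2 c.
Proof. by move=> BB; rewrite !norm2E dotv_mulmx mulmxA BB mul1mx. Qed.

(** Gram-Schmidt; a vector already in the span adds no column. *)
Lemma orthonormal_span m (X : seq 'cV[R]_m) :
  exists n (B : 'M[R]_(m, n)), [/\ (n <= size X)%N, B^T *m B = 1%:M &
    forall v, v \in (span X) <-> exists c, v = B *m c].
Proof.
elim: X => [|x X [n [B [nX BB Bspan]]]].
  exists 0%N, 0; split=> // [|v]; first by rewrite [RHS]flatmx0 [LHS]flatmx0.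
  rewrite span_nil memv0; split=> [/eqP->|[c ->]]; last by rewrite mul0mx.
  by exists 0; rewrite mul0mx.
pose u := x - B *m (B^T *m x).
have Bu : B^T *m u = 0 by rewrite mulmxBr !mulmxA BB mul1mx subrr.
have xE v : v \in span (x :: X) <-> exists a c, v = a *: x + B *m c.
  rewrite span_cons; split=> [/memv_addP[_ /vlineP[a ->] [w /Bspan[c ->] ->]]|].
    by exists a, c.
  move=> [a [c ->]]; apply: memv_add; first by rewrite memvZ ?memv_line.
  by apply/Bspan; exists c.
have [u0|u0] := eqVneq u 0.
  exists n, B; split=> // [|v]; first exact: leqW.
  split=> [/xE[a [c ->]]|[c ->]]; last first.
    by apply/xE; exists 0, c; rewrite scale0r add0r.
  exists (a *: (B^T *m x) + c).
  by rewrite mulmxDr -scalemxAr; move/eqP: u0; rewrite subr_eq0 => /eqP <-.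
have nu : norm2 u != 0 by apply: contra_neq u0 => /norm2_eq0.
pose e := (norm2 u)^-1 *: u.
have ee : e^T *m e = 1%:M.
  rewrite [LHS]mx11_scalar -dotvE dotvZl dotvZr -sqr_norm2; congr _%:M.
  by rewrite expr2; field.
have Be : B^T *m e = 0 by rewrite -scalemxAr Bu scaler0.
exists (n + 1)%N, (row_mx B e); split; first by rewrite addn1.
  rewrite tr_row_mx mul_col_row BB ee Be.
  have -> : e^T *m B = 0 by rewrite -[LHS]trmxK trmx_mul trmxK Be trmx0.
  by rewrite -scalar_mx_block.
move=> v; split=> [/xE[a [c ->]]|[c ->]].
  exists (col_mx (a *: (B^T *m x) + c) (a * norm2 u)%:M).
  rewrite mul_row_col mulmxDr -scalemxAr mul_mx_scalar scalerA mulfK// /u.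
  by rewrite scalerBr [RHS]addrC addrA subrK.
apply/xE; exists (dsubmx c 0 0 / norm2 u).
exists (usubmx c - (dsubmx c 0 0 / norm2 u) *: (B^T *m x)).
rewrite -[in LHS](vsubmxK c) mul_row_col {1}(mx11_scalar (dsubmx c)).
rewrite mul_mx_scalar /e scalerA mulmxBr -scalemxAr /u scalerBr.
by rewrite [LHS]addrC -addrA; congr (_ + _); rewrite addrC.
Qed.

Lemma orthonormal_basis m (S : {vspace 'cV[R]_m}) :
  exists n (B : 'M[R]_(m, n)), [/\ (n <= \dim S)%N, B^T *m B = 1%:M &
    forall v, v \in S <-> exists c, v = B *m c].
Proof.
have [n [B [nS BB BP]]] := orthonormal_span (vbasis S).
exists n, B; split=> //; first by rewrite size_tuple in nS.
by move=> v; rewrite -BP (span_basis (vbasisP S)).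
Qed.

Lemma orthoproj_mulmx m n (S : {vspace 'cV[R]_m}) (B : 'M[R]_(m, n)) v :
  B^T *m B = 1%:M -> (forall u, u \in S <-> exists c, u = B *m c) ->
  orthoproj S v = B *m (B^T *m v).
Proof.
move=> BB BS; apply: orthoproj_eq; first by apply/BS; exists (B^T *m v).
move=> u /BS[c ->]; rewrite dotvC dotv_mulmx mulmxBr !mulmxA BB mul1mx subrr.
by rewrite dotvC dotv0l.
Qed.

End OrthonormalBasis.

Section Net.
Context {R : realType}.

(** Coefficients run over the 2M + 1 multiples of 1/M in [-1, 1], a cube that contains all unit
    coefficient vectors. *)
Definition grid_point d m (B : 'M[R]_(d, m)) (M : nat)
    (g : {ffun 'I_m -> 'I_(2 * M).+1}) : 'cV[R]_d :=
  B *m \col_j ((g j)%:R / M%:R - 1).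

(** The crude bound on the images of the columns stands in for an operator norm bound when the
    rounding error is mapped. *)
Definition net_ok d t m (B : 'M[R]_(d, m)) (M : nat) (eps : R)
    (A : 'M[R]_(t, d)) : bool :=
  [forall g : {ffun 'I_m -> 'I_(2 * M).+1},
     (1 - eps) * norm2 (grid_point B g) <= norm2 (A *m grid_point B g)] &&
  [forall j, norm2 (A *m col j B) <= 2].

Lemma mulmx_sum_col d m (B : 'M[R]_(d, m)) (c : 'cV[R]_m) :
  B *m c = \sum_j c j 0 *: col j B.
Proof.
apply/colP => i; rewrite mxE summxE.
by apply: eq_bigr => j _; rewrite !mxE mulrC.
Qed.

Lemma coef_le_norm2 m (c : 'cV[R]_m) j : `|c j 0| <= norm2 c.
Proof.
rewrite -(ler_pXn2r (n := 2)) ?nnegrE ?norm2_ge0// real_normK ?num_real//.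
rewrite sqr_norm2 /dotv (bigD1 j)//= -expr2 lerDl.
by apply: sumr_ge0 => i _; rewrite -expr2 sqr_ge0.
Qed.

Lemma norm2_col_orthonormal d m (B : 'M[R]_(d, m)) j : B^T *m B = 1%:M ->
  norm2 (col j B) = 1.
Proof.
move=> BB; have -> : col j B = B *m delta_mx j 0 by rewrite -colE.
rewrite norm2_isometry// norm2E /dotv (bigD1 j)//= big1 => [|i ij].
  by rewrite mxE !eqxx mulr1 addr0 sqrtr1.
by rewrite mxE (negbTE ij) mul0r.
Qed.

(** Rounding a unit vector to the grid moves it by at most m/M and its image by at most 2m/M, whence
    the 3. *)
Lemma net_okP d t m (B : 'M[R]_(d, m)) M (eps : R) (A : 'M[R]_(t, d)) :
  (0 < M)%N -> 0 <= eps <= 1 -> B^T *m B = 1%:M -> net_ok B M eps A ->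
  forall c, (1 - (eps + 3 * m%:R / M%:R)) * norm2 (B *m c) <= norm2 (A *m (B *m c)).
Proof.
move=> M0 /andP[e0 e1] BB /andP[/forallP netA /forallP basA].
have Mp : 0 < M%:R :> R by rewrite ltr0n.
have colB j := norm2_col_orthonormal j BB.
suff unit c : norm2 c = 1 ->
    1 - (eps + 3 * m%:R / M%:R) <= norm2 (A *m (B *m c)).
  move=> c; have [c0|c0] := eqVneq (norm2 c) 0.
    by rewrite (norm2_eq0 c0) !mulmx0 !norm20 mulr0.
  have nc : 0 < norm2 c by rewrite lt0r c0 norm2_ge0.
  have := unit ((norm2 c)^-1 *: c).
  rewrite norm2Z ger0_norm ?invr_ge0 ?norm2_ge0// mulVf// => /(_ erefl).
  rewrite -!scalemxAr norm2Z ger0_norm ?invr_ge0 ?norm2_ge0// => h.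
  by rewrite norm2_isometry// -ler_pdivlMr// [leRHS]mulrC.
move=> c1.
have cj j : 0 <= (c j 0 + 1) * M%:R <= 2 * M%:R.
  have := coef_le_norm2 c j; rewrite c1 ler_norml => /andP[h1 h2].
  by rewrite mulr_ge0 ?ler0n//= ?ler_wpM2r ?ler0n//; lra.
(* Coordinates of a unit vector lie in [-1, 1], so rounding down yields an index at most 2M. *)
have gj j : (Num.truncn ((c j 0 + 1) * M%:R)%R < (2 * M).+1)%N.
  case/andP: (cj j) => h1 h2.
  by rewrite ltnS -(ler_nat R) natrM (le_trans _ h2)// truncn_le.
pose g := [ffun j => Ordinal (gj j)].
pose u := \col_j ((g j)%:R / M%:R - 1) : 'cV[R]_m.
have cu j : `|(c - u) j 0| <= M%:R^-1.
  case/andP: (cj j) => h1 h2.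
  rewrite !mxE ffunE /=; set q := Num.truncn _.
  have q1 : q%:R <= (c j 0 + 1) * M%:R by rewrite truncn_le.
  have q2 : (c j 0 + 1) * M%:R < q.+1%:R by exact: truncnS_gt.
  have -> : c j 0 - (q%:R / M%:R - 1) = ((c j 0 + 1) * M%:R - q%:R) / M%:R.
    by field; rewrite gt_eqF.
  rewrite normrM (ger0_norm (_ : 0 <= M%:R^-1)) ?invr_ge0 ?(ltW Mp)//.
  rewrite ler_piMl ?invr_ge0 ?(ltW Mp)// ger0_norm ?subr_ge0//.
  by rewrite lerBlDl natr1 ltW.
have dif : norm2 (B *m (c - u)) <= m%:R / M%:R.
  rewrite mulmx_sum_col; apply: le_trans (ler_norm2_sum _ _) _.
  apply: (@le_trans _ _ (\sum_(j < m) M%:R^-1)).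
    by apply: ler_sum => j _; rewrite norm2Z colB mulr1.
  by rewrite sumr_const card_ord mulr_natl.
have difA : norm2 (A *m (B *m (c - u))) <= 2 * m%:R / M%:R.
  rewrite (mulmx_sum_col B) mulmx_sumr; apply: le_trans (ler_norm2_sum _ _) _.
  apply: (@le_trans _ _ (\sum_(j < m) M%:R^-1 * 2)).
    apply: ler_sum => j _; rewrite -scalemxAr norm2Z.
    by rewrite ler_pM// norm2_ge0.
  rewrite sumr_const card_ord -[leLHS]mulr_natl.
  by rewrite (_ : m%:R * (M%:R^-1 * 2) = 2 * m%:R / M%:R)//; ring.
have h1 := netA g; rewrite /grid_point -/u in h1.
have h2 : 1 <= norm2 (B *m u) + norm2 (B *m (c - u)).
  rewrite -c1 -(norm2_isometry c BB); apply: le_trans (ler_norm2D _ _).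
  by rewrite -mulmxDr subrKC.
have h3 : norm2 (A *m (B *m u)) <=
    norm2 (A *m (B *m c)) + norm2 (A *m (B *m (c - u))).
  apply: le_trans (ler_norm2B _ _).
  by rewrite -!mulmxBr opprB subrKC.
set x := norm2 (A *m (B *m c)) in h3 *.
set y := norm2 (A *m (B *m u)) in h1 h3.
set v := norm2 (B *m u) in h1 h2.
set r := m%:R / M%:R in dif.
have E2 (a : R) : a * m%:R / M%:R = a * r by rewrite mulrA.
rewrite !E2 in difA *.
move: difA dif h1 h2 h3 => k1 k2 k3 k4 k5.
have k6 : (1 - eps) * (1 - r) <= (1 - eps) * v by rewrite ler_wpM2l; lra.
have k7 : 0 <= eps * r by rewrite mulr_ge0// divr_ge0// ler0n.
lra.
Qed.

End Net.

(** * Moments of Gaussian vectors *)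

Section Density.
Local Open Scope ereal_scope.
Context d (T : measurableType d) (R : realType).
Variables (mu nu : {measure set T -> \bar R}) (g : T -> R).
Hypothesis g0 : forall x, (0 <= g x)%R.
Hypothesis mg : measurable_fun setT g.
Hypothesis nuE : forall A, measurable A -> nu A = \int[mu]_(x in A) (g x)%:E.

Import HBNNSimple.

(** [nuE] is the case of indicators; linearity gives simple functions and monotone convergence the
    rest. *)
Lemma integral_density (f : T -> \bar R) : measurable_fun setT f ->
  (forall x, 0 <= f x) -> \int[nu]_x f x = \int[mu]_x (f x * (g x)%:E).
Proof.
move=> mf f0.
pose f_ := nnsfun_approx measurableT mf.
have f_cvg x : (f_ n x)%:E @[n --> \oo] --> f x.
  by apply: cvg_nnsfun_approx => // y _; exact: f0.
transitivity (limn (fun n => \int[nu]_x (f_ n x)%:E)).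
  rewrite -monotone_convergence//.
  - by apply: eq_integral => y _; apply/esym/cvg_lim.
  - by move=> n; exact/measurable_EFinP/measurable_funP.
  - by move=> n y _; rewrite lee_fin.
  - by move=> y _ m n mn; rewrite lee_fin; exact/lefP/nd_nnsfun_approx.
transitivity (limn (fun n => \int[mu]_x ((f_ n x)%:E * (g x)%:E))); last first.
  rewrite -monotone_convergence//.
  - by apply: eq_integral => y _; apply/cvg_lim => //; exact: cvgeZr.
  - move=> n; apply: emeasurable_funM; last exact/measurable_EFinP.
    exact/measurable_EFinP/measurable_funP.
  - by move=> n y _; rewrite mule_ge0// lee_fin.
  - move=> y _ m n mn; rewrite lee_wpmul2r ?lee_fin//.
    exact/lefP/nd_nnsfun_approx.
congr (limn _); apply/funext => n.
under eq_integral do rewrite fimfunE -fsumEFin//.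
rewrite ge0_integral_fsum//; last 2 first.
- by move=> y; exact/measurable_EFinP/measurable_funM.
- by move=> y x _; rewrite EFinM nnfun_muleindic_ge0.
transitivity (\sum_(r \in range (f_ n))
    \int[mu]_x ((r * \1_(f_ n @^-1` [set r]) x)%:E * (g x)%:E)).
  apply: eq_fsbigr => r /[!inE] -[x _ rE].
  have r0 : (0 <= r)%R by rewrite -rE.
  under [RHS]eq_integral do rewrite EFinM -muleA.
  rewrite integralZl_indic_nnsfun// integral_indic// setIT nuE//.
  rewrite ge0_integralZl_EFin//; last 2 first.
  - by move=> y _; rewrite mule_ge0// lee_fin.
  - by apply: emeasurable_funM; exact/measurable_EFinP.
  congr (_ * _); rewrite integral_mkcond; apply: eq_integral => y _.
  rewrite patchE indicE; case: (y \in _); rewrite ?mul1e ?mul0e//.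
rewrite -ge0_integral_fsum//.
- apply: eq_integral => x _; rewrite [in RHS]fimfunE -fsumEFin//.
  by rewrite ge0_mule_fsuml// => r; rewrite EFinM nnfun_muleindic_ge0.
- move=> r; apply: emeasurable_funM; last exact/measurable_EFinP.
  exact/measurable_EFinP/measurable_funM.
- move=> r x _; apply: mule_ge0; last by rewrite lee_fin.
  by rewrite EFinM nnfun_muleindic_ge0.
Qed.

End Density.

(** A centred Gaussian exponent of variance [V], tilted by l (u + c x)^2, is a Gaussian exponent of
    variance V / a plus a constant. Keeping [a] a variable with an equation leaves [field] with the
    denominators V and a only. *)
Lemma complete_square (F : numFieldType) (V a l c u x : F) :
  V != 0 -> a != 0 -> a = 1 - 2 * l * c ^+ 2 * V ->
  - (x - 0) ^+ 2 / (V * 2) + l * (u + c * x) ^+ 2 =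
  l / a * u ^+ 2 + - (x - 2 * l * c * u * V / a) ^+ 2 / (V / a * 2).
Proof.
move=> V0 a0 aE; have Va : 2 * V * a != 0 by rewrite !mulf_neq0// pnatr_eq0.
apply: (mulfI Va).
have -> : 2 * V * a * (- (x - 0) ^+ 2 / (V * 2) + l * (u + c * x) ^+ 2) =
    - a * x ^+ 2 + 2 * V * a * l * (u + c * x) ^+ 2 by field.
have -> : 2 * V * a * (l / a * u ^+ 2 +
    - (x - 2 * l * c * u * V / a) ^+ 2 / (V / a * 2)) =
    2 * V * l * u ^+ 2 - (a * x - 2 * l * c * u * V) ^+ 2.
  by field; rewrite a0 V0.
by rewrite aE; ring.
Qed.

Section GaussianIntegral.
Context {R : realType}.
Local Notation mu := lebesgue_measure.

Lemma integral_normal_prob (s : R) (f : R -> \bar R) :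
  measurable_fun setT f -> (forall x, 0 <= f x)%E ->
  (\int[normal_prob 0 s]_x f x = \int[mu]_x (f x * (normal_pdf 0 s x)%:E))%E.
Proof.
move=> mf f0; apply: integral_density => //.
  exact: normal_pdf_ge0.
exact: measurable_normal_pdf.
Qed.

Lemma gauss_exp_sqr_pdf (s c l u x : R) : 0 < s -> 2 * l * c ^+ 2 * s ^+ 2 < 1 ->
  let a := 1 - 2 * l * c ^+ 2 * s ^+ 2 in
  expR (l * (u + c * x) ^+ 2) * normal_pdf 0 s x =
  (Num.sqrt a)^-1 * expR (l / a * u ^+ 2) *
    normal_pdf (2 * l * c * u * s ^+ 2 / a) (s / Num.sqrt a) x.
Proof.
move=> s0 ac a; have a0 : 0 < a by rewrite subr_gt0.
have aE : a = 1 - 2 * l * c ^+ 2 * s ^+ 2 by [].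
clearbody a; have sa0 : 0 < Num.sqrt a by rewrite sqrtr_gt0.
have s'0 : s / Num.sqrt a != 0 by rewrite mulf_neq0 ?invr_eq0 ?gt_eqF.
have pdfE (m s1 : R) : s1 != 0 ->
    normal_pdf m s1 x = normal_peak s1 * normal_fun m s1 x.
  by move=> s10; rewrite normal_pdfE.
rewrite (pdfE _ _ s'0) (pdfE 0 s) ?gt_eqF//.
have -> : normal_peak (s / Num.sqrt a) = Num.sqrt a * normal_peak s.
  rewrite /normal_peak expr_div_n sqr_sqrtr ?(ltW a0)//.
  have -> : s ^+ 2 / a * pi *+ 2 = a^-1 * (s ^+ 2 * pi *+ 2) :> R.
    by rewrite (mulrC (s ^+ 2) a^-1) -mulrA -mulrnAr.
  by rewrite sqrtrM ?invr_ge0 ?(ltW a0)// sqrtrV ?(ltW a0)// invfM invrK.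
have E : normal_fun 0 s x * expR (l * (u + c * x) ^+ 2) =
    expR (l / a * u ^+ 2) *
    normal_fun (2 * l * c * u * s ^+ 2 / a) (s / Num.sqrt a) x.
  rewrite /normal_fun -!expRD; congr expR.
  have -> : (s / Num.sqrt a) ^+ 2 = s ^+ 2 / a.
    by rewrite expr_div_n sqr_sqrtr ?(ltW a0).
  rewrite -(mulr_natr (s ^+ 2) 2) -(mulr_natr (s ^+ 2 / a) 2).
  by apply: complete_square; rewrite ?gt_eqF ?exprn_gt0.
by rewrite mulrC -[LHS]mulrA E [RHS]mulrACA mulKf ?gt_eqF.
Qed.

(** The offset [u] stands for the other terms of a linear combination while one coordinate is
    integrated out. *)
Lemma gauss_exp_sqr (s c l u : R) : 0 < s -> 2 * l * c ^+ 2 * s ^+ 2 < 1 ->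
  let a := 1 - 2 * l * c ^+ 2 * s ^+ 2 in
  (\int[normal_prob 0 s]_x (expR (l * (u + c * x) ^+ 2))%:E =
   ((Num.sqrt a)^-1 * expR (l / a * u ^+ 2))%:E)%E.
Proof.
move=> s0 ac a.
have mE : measurable_fun setT (fun x : R => (expR (l * (u + c * x) ^+ 2))%:E).
  apply/measurable_EFinP; apply: measurableT_comp => //.
  apply: measurable_funM => //; apply: measurable_funX.
  by apply: measurable_funD => //; exact: measurable_funM.
rewrite (integral_normal_prob s mE); last by move=> x; rewrite lee_fin expR_ge0.
transitivity (\int[mu]_x (((Num.sqrt a)^-1 * expR (l / a * u ^+ 2))%:E *
    (normal_pdf (2 * l * c * u * s ^+ 2 / a) (s / Num.sqrt a) x)%:E))%E.
  by apply: eq_integral => x _; rewrite -!EFinM gauss_exp_sqr_pdf.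
rewrite ge0_integralZl_EFin//.
- by rewrite integral_normal_pdf mule1.
- by move=> x _; rewrite lee_fin normal_pdf_ge0.
- by apply/measurable_EFinP; exact: measurable_normal_pdf.
Qed.

End GaussianIntegral.

Section PairMap.
Context d d1 d2 (T : measurableType d) (T1 : measurableType d1)
  (T2 : measurableType d2).

Definition pair_map (U : T -> T1) (V : T -> T2) (w : T) : T1 * T2 := (U w, V w).

Lemma measurable_pair_map (U : {mfun T >-> T1}) (V : {mfun T >-> T2}) :
  measurable_fun setT (pair_map U V).
Proof. exact: measurable_fun_pair. Qed.

HB.instance Definition _ (U : {mfun T >-> T1}) (V : {mfun T >-> T2}) :=
  isMeasurableFun.Build _ _ _ _ (pair_map U V) (measurable_pair_map U V).

End PairMap.

(** * Independence and integration of one coordinate at a time *)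

Section Independence.
Local Open Scope ereal_scope.
Context d (Omega : measurableType d) (R : realType) (P : probability Omega R).

(** Uniqueness of product measures extends the identity from rectangles. The constant is absorbed
    into the second factor, so that the target is itself a product measure. *)
Lemma prob_pair_rect d1 d2 (T1 : measurableType d1) (T2 : measurableType d2)
    (U : {mfun Omega >-> T1}) (V : {mfun Omega >-> T2}) (F : set Omega)
    (c : {nonneg R}) : measurable F ->
  (forall A C, measurable A -> measurable C ->
    P ((U @^-1` A `&` V @^-1` C) `&` F) =
    P (U @^-1` A) * (c%:num%:E * P (V @^-1` C))) ->
  forall D, measurable D -> P ((pair_map U V) @^-1` D `&` F) =
    c%:num%:E * (distribution P U \x distribution P V) D.
Proof.
move=> mF PF D mD.
pose m'' :
  {measure set (T1 * T2) -> \bar R} := pushforward (mrestr P mF) (pair_map U V).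
pose m' := m'' (measurable_pair_map U V).
pose m2 : {sigma_finite_measure set T2 -> \bar R} := mscale c (distribution P V).
pose m3 : {measure set (T1 * T2) -> \bar R} :=
  mscale c (distribution P U \x distribution P V).
have E1 := @product_measure_unique _ _ _ _ _ (distribution P U) m2 m' _ D mD.
have E2 := @product_measure_unique _ _ _ _ _ (distribution P U) m2 m3 _ D mD.
transitivity (m' D) => //.
rewrite -E1; last by move=> A C mA mC; exact: PF.
rewrite E2// => A C mA mC.
by rewrite /m3/= /mscale/= product_measure1E// muleCA.
Qed.

Variables (I : choiceType) (X : I -> {RV P >-> R}).
Hypothesis indX : mutually_independent X.

Definition cyl (J : {fset I}) (B : I -> set R) : set Omega :=
  \bigcap_(i in [set` J]) (X i @^-1` B i).

Lemma measurable_cyl J B : (forall i, measurable (B i)) -> measurable (cyl J B).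
Proof.
move=> mB; apply: fin_bigcap_measurable => // i _.
exact: measurable_funPTI.
Qed.

Lemma prob_cyl J B : (forall i, measurable (B i)) ->
  P (cyl J B) = \prod_(i <- J) P (X i @^-1` B i).
Proof. by move=> mB; exact: indX. Qed.

Lemma cyl_setT J : cyl J (fun=> setT) = setT.
Proof. by rewrite /cyl; apply/seteqP; split. Qed.

Definition indep_fam d' (T' : measurableType d') (U : {mfun Omega >-> T'})
    (J : {fset I}) : Prop :=
  forall A B, measurable A -> (forall i, measurable (B i)) ->
    P (U @^-1` A `&` cyl J B) = P (U @^-1` A) * P (cyl J B).

Lemma indep_fam_cst d' (T' : measurableType d') (y : T') J :
  indep_fam (cst y) J.
Proof.
move=> A B mA mB; rewrite preimage_cst; case: ifPn => _.
  by rewrite setTI probability_setT mul1e.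
by rewrite set0I measure0 mul0e.
Qed.

Lemma indep_fam_comp d' d2 (T' : measurableType d') (T2 : measurableType d2)
    (U : {mfun Omega >-> T'}) (V : {mfun Omega >-> T2}) (f : T' -> T2) J :
  measurable_fun setT f -> (forall w, V w = f (U w)) ->
  indep_fam U J -> indep_fam V J.
Proof.
move=> mf VE UJ A B mA mB.
have -> : V @^-1` A = U @^-1` (f @^-1` A).
  by apply/seteqP; split=> w /=; rewrite VE.
by apply: UJ => //; rewrite -[X in measurable X]setTI; exact: mf.
Qed.

Section Step.
Context d' (T' : measurableType d') (U : {mfun Omega >-> T'}).
Variables (J : {fset I}) (j : I).
Hypothesis jJ : j \notin J.
Hypothesis UJ : indep_fam U (j |` J)%fset.

(** On a cylinder over [J] the pair still has the product law. The full cylinder gives the joint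
    law, and comparing the two gives independence from [J]. *)
Let key D B : measurable D -> (forall i, measurable (B i)) ->
  P ((pair_map U (X j)) @^-1` D `&` cyl J B) =
  P (cyl J B) * (distribution P U \x distribution P (X j)) D.
Proof.
move=> mD mB; have mF := measurable_cyl J mB.
have cfin : P (cyl J B) \is a fin_num by exact: fin_num_measure.
pose c : {nonneg R} := NngNum (fine_ge0 (measure_ge0 P (cyl J B))).
have -> : P (cyl J B) = c%:num%:E by rewrite /= fineK.
apply: prob_pair_rect => // A C mA mC.
(* The constraint on [X j] becomes one more coordinate of the cylinder, where [UJ] applies. *)
pose B' i := if i == j then C else B i.
have mB' i : measurable (B' i) by rewrite /B'; case: eqP.
have cylE : cyl (j |` J)%fset B' = X j @^-1` C `&` cyl J B.
  apply/seteqP; split=> [w h|w [h1 h2] i /=].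
    split; first by have := h j; rewrite /B' /= eqxx; apply; rewrite fset1U1.
    move=> i /= iJ; have := h i; rewrite /B' /=.
    have -> : (i == j) = false by apply: contraNF jJ => /eqP <-.
    by apply; rewrite fset1Ur.
  move=> /fset1UP[->|iJ]; rewrite /B'; first by rewrite eqxx.
  by case: eqP => [->//|_]; exact: h2.
rewrite -setIA -cylE UJ// prob_cyl// big_fsetU1//=; congr (_ * _).
rewrite fineK// prob_cyl// muleC; congr (_ * _); last by rewrite /B' eqxx.
apply: eq_big_seq => i iJ; rewrite /B'.
by have -> : (i == j) = false by apply: contraNF jJ => /eqP <-.
Qed.

Let dist_pair D : measurable D ->
  P ((pair_map U (X j)) @^-1` D) = (distribution P U \x distribution P (X j)) D.
Proof.
move=> mD; have := key mD (fun=> measurableT).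
by rewrite cyl_setT setIT probability_setT mul1e.
Qed.

Lemma indep_fam_pair : indep_fam (pair_map U (X j)) J.
Proof. by move=> D B mD mB; rewrite key// dist_pair// muleC. Qed.

Lemma expect_pair (f : T' * R -> \bar R) :
  measurable_fun setT f -> (forall x, 0 <= f x) ->
  \int[P]_w f (U w, X j w) =
  \int[P]_w \int[distribution P (X j)]_y f (U w, y).
Proof.
move=> mf f0.
transitivity (\int[distribution P (pair_map U (X j))]_x f x).
  by rewrite ge0_integral_distribution.
transitivity (\int[distribution P U \x distribution P (X j)]_x f x).
  by apply: eq_measure_integral => D mD _; exact: dist_pair.
rewrite fubini_tonelli1// ge0_integral_distribution//.
- by apply: measurable_fun_fubini_tonelli_F.
- by move=> x; exact: integral_ge0.
Qed.

End Step.

End Independence.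

Section NormalLaw.
Context (R : realType).

(* lebesgue_measure and normal_prob live on measurableTypeR R, whose
   sigma-algebra is that of R but whose display differs; integrals are carried
   over by the identity map. *)
Let idTR : measurableTypeR R -> R := idfun.
Let midTR : measurable_fun setT idTR. Proof. exact: (@measurable_id _ _ setT). Qed.

Lemma integral_law_normal (nu : {measure set R -> \bar R}) (s : R)
    (f : R -> \bar R) :
  (forall B : set R, measurable B -> nu B = normal_prob 0 s B) ->
  measurable_fun setT f -> (forall x, 0%R <= f x)%E ->
  (\int[nu]_x f x = \int[normal_prob 0 s]_x f x)%E.
Proof.
move=> nuE mf f0.
pose N' : {measure set R -> \bar R} := pushforward (normal_prob 0 s) idTR.
rewrite (@eq_measure_integral _ _ _ setT (N' midTR)).
  by rewrite ge0_integral_pushforward.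
by move=> A mA _; apply: nuE.
Qed.

End NormalLaw.

Section GaussianSums.
Context d (Omega : measurableType d) (R : realType) (P : probability Omega R).
Variables (I : choiceType) (X : I -> {RV P >-> R}) (s : R).
Hypothesis s0 : 0 < s.
Hypothesis indX : mutually_independent X.
Hypothesis lawX : forall i B, measurable B ->
  distribution P (X i) B = normal_prob 0 s B.

(** What is needed of a variable built from the [X k] with k in [K], expressed without
    sub-sigma-algebras. *)
Definition indep_off d' (T' : measurableType d') (U : {mfun Omega >-> T'})
    (K : seq I) : Prop :=
  forall J : {fset I}, (forall i, i \in J -> i \notin K) -> indep_fam X U J.

Definition lin_comb (c : I -> R) (K : seq I) (w : Omega) : R :=
  \sum_(k <- K) c k * X k w.

Lemma measurable_lin_comb c K : measurable_fun setT (lin_comb c K).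
Proof.
apply: measurable_sum => k; apply: measurable_funM => //.
Qed.

HB.instance Definition _ c K :=
  isMeasurableFun.Build _ _ _ _ (lin_comb c K) (measurable_lin_comb c K).

Lemma indep_off_lin_comb (V : {mfun Omega >-> R}) c K K0 :
  uniq K -> (forall k, k \in K -> k \notin K0) ->
  indep_off V K0 -> indep_off (pair_map V (lin_comb c K)) (K ++ K0).
Proof.
elim: K => [|k K IH] /=.
  move=> _ _ iV J JK; apply: (indep_fam_comp (U := V) (f := fun v => (v, 0 : R))).
  - exact: measurable_fun_pair.
  - by move=> w; rewrite /= /pair_map /lin_comb big_nil.
  - exact: iV.
move=> /andP[kK uK] KK0 iV J JK.
have kJ : k \notin J.
  by apply/negP => /JK; rewrite inE eqxx.
have iU : indep_fam X (pair_map V (lin_comb c K)) (k |` J)%fset.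
  apply: IH => //; first by move=> i iK; apply: KK0; rewrite inE iK orbT.
  move=> i /fset1UP[->|/JK]; last by rewrite inE negb_or => /andP[].
  by rewrite mem_cat negb_or kK KK0// inE eqxx.
apply: (indep_fam_comp (f := fun x : (R * R) * R => (x.1.1, c k * x.2 + x.1.2)))
  (indep_fam_pair indX kJ iU).
  apply: measurable_fun_pair.
    exact: (measurableT_comp measurable_fst measurable_fst).
  apply: measurable_funD.
    by apply: measurable_funM => //; exact: measurable_snd.
  exact: (measurableT_comp measurable_snd measurable_fst).
by move=> w; rewrite /= /pair_map /lin_comb big_cons.
Qed.

(** Coordinates are integrated out one by one, so that no law of a sum of Gaussians has to be
    identified: each step multiplies by a^(-1/2) and turns [l] into l / a. The factor h(V) carries
    along the rows already treated. *)
Lemma expect_lin_comb (V : {mfun Omega >-> R}) c K K0 (h : R -> R) l :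
  uniq K -> (forall k, k \in K -> k \notin K0) -> indep_off V K0 ->
  measurable_fun setT h -> (forall v, 0 <= h v) ->
  2 * l * s ^+ 2 * (\sum_(k <- K) c k ^+ 2) < 1 ->
  (\int[P]_w (h (V w) * expR (l * lin_comb c K w ^+ 2))%:E =
   ((Num.sqrt (1 - 2 * l * s ^+ 2 * (\sum_(k <- K) c k ^+ 2)))^-1)%:E *
   \int[P]_w (h (V w))%:E)%E.
Proof.
move=> + + iV mh h0; elim: K l => [|k K IH] l /=.
  rewrite big_nil mulr0 subr0 sqrtr1 invr1 mul1e => _ _ _.
  apply: eq_integral => w _.
  by rewrite /lin_comb big_nil expr0n/= mulr0 expR0 mulr1.
move=> /andP[kK uK] KK0; rewrite !big_cons; set Q := \sum_(j <- K) c j ^+ 2.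
have Q0 : 0 <= Q by apply: sumr_ge0 => j _; exact: sqr_ge0.
move=> lQ; set q := c k ^+ 2.
have q0 : 0 <= q by exact: sqr_ge0.
have s2 : 0 < s ^+ 2 by rewrite exprn_gt0.
(* The last conjunct is the condition of the induction hypothesis for the new parameter l / a. *)
have [la [a0 laQ]] : 2 * l * q * s ^+ 2 < 1 /\ (0 < 1 - 2 * l * q * s ^+ 2 /\
   2 * (l / (1 - 2 * l * q * s ^+ 2)) * s ^+ 2 * Q < 1).
  have la : 2 * l * q * s ^+ 2 < 1.
    have [l0|l0] := leP l 0.
      have : 0 <= - l * q * s ^+ 2.
        by apply: mulr_ge0 (ltW s2); apply: mulr_ge0; rewrite ?oppr_ge0.
      lra.
    have : 0 <= l * s ^+ 2 * Q.
      exact: mulr_ge0 (mulr_ge0 (ltW l0) (ltW s2)) Q0.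
    move: lQ; rewrite -/q; lra.
  have a0 : 0 < 1 - 2 * l * q * s ^+ 2 by rewrite subr_gt0.
  split=> //; split=> //.
  have -> : 2 * (l / (1 - 2 * l * q * s ^+ 2)) * s ^+ 2 * Q =
     (2 * l * s ^+ 2 * Q) / (1 - 2 * l * q * s ^+ 2) by field; rewrite gt_eqF.
  rewrite ltr_pdivrMr// mul1r; move: lQ; rewrite -/q; lra.
have uKK0 : forall k, k \in K -> k \notin K0.
  by move=> i iK; apply: KK0; rewrite inE iK orbT.
have iU : indep_fam X (pair_map V (lin_comb c K)) (k |` fset0)%fset.
  apply: (indep_off_lin_comb c uK uKK0 iV) => i /fset1UP[->|]; last by rewrite in_fset0.
  by rewrite mem_cat negb_or kK KK0// inE eqxx.
pose f (x : (R * R) * R) : \bar R :=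
  (h x.1.1 * expR (l * (x.1.2 + c k * x.2) ^+ 2))%:E.
have mf : measurable_fun setT f.
  apply/measurable_EFinP; apply: measurable_funM.
    apply: measurableT_comp => //.
    exact: (measurableT_comp measurable_fst measurable_fst).
  apply: measurableT_comp => //; apply: measurable_funM => //.
  apply: measurable_funX; apply: measurable_funD.
    exact: (measurableT_comp measurable_snd measurable_fst).
  by apply: measurable_funM => //; exact: measurable_snd.
have f0 x : (0 <= f x)%E by rewrite lee_fin mulr_ge0 ?expR_ge0.
transitivity (\int[P]_w f (pair_map V (lin_comb c K) w, X k w))%E.
  apply: eq_integral => w _; rewrite /f /pair_map /= /lin_comb big_cons.
  by rewrite (addrC (c k * _)).
rewrite (expect_pair indX _ iU mf f0) ?in_fset0//.
set a := 1 - 2 * l * q * s ^+ 2 in a0 laQ *.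
transitivity (\int[P]_w (((Num.sqrt a)^-1)%:E *
    (h (V w) * expR (l / a * lin_comb c K w ^+ 2))%:E))%E.
  apply: eq_integral => w _.
  transitivity (\int[normal_prob 0 s]_y ((h (V w))%:E *
      (expR (l * (lin_comb c K w + c k * y) ^+ 2))%:E))%E.
    have mw : measurable_fun setT (fun y : R => f (pair_map V (lin_comb c K) w, y)).
      by apply: (measurableT_comp mf); exact: measurable_fun_pair.
    rewrite (integral_law_normal (lawX k) mw (fun y => f0 _)).
    by apply: eq_integral => y _; rewrite -EFinM.
  rewrite ge0_integralZl_EFin//.
  - rewrite gauss_exp_sqr// -!EFinM; congr EFin.
    by rewrite -/q -/a; ring.
  - apply/measurable_EFinP; apply: measurableT_comp => //.
    apply: measurable_funM => //; apply: measurable_funX.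
    by apply: measurable_funD => //; exact: measurable_funM.
rewrite ge0_integralZl_EFin//; last first.
- apply/measurable_EFinP; apply: measurable_funM; first exact: measurableT_comp.
  by apply: measurableT_comp => //; apply: measurable_funM => //; apply: measurable_funX.
- by move=> w _; rewrite lee_fin mulr_ge0 ?expR_ge0.
rewrite IH// -/Q muleA -EFinM -invfM -sqrtrM ?(ltW a0)//; congr ((Num.sqrt _)^-1%:E * _)%E.
transitivity (a - 2 * l * s ^+ 2 * Q); last by rewrite /a; ring.
by clear -a0; clearbody a Q; move: (s ^+ 2) => V; field; rewrite gt_eqF.
Qed.

End GaussianSums.

(** * Scalar inequalities behind the tail bounds *)

Section ScalarBounds.
Context {R : realType}.

(** From exp(-y) >= 1 - y at y = x - 2 x^2, because (1 + x)(1 - x + 2 x^2) = 1 + x^2 (1 + 2x) >=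
    1. *)
Lemma inv_sqrt1D_le (x : R) : - 2^-1 <= x ->
  (Num.sqrt (1 + x))^-1 <= expR (- (x - 2 * x ^+ 2) / 2).
Proof.
move=> x2; have x1 : 0 < 1 + x by lra.
have h : expR (x - 2 * x ^+ 2) <= 1 + x.
  have e1 := expR_ge1Dx (- (x - 2 * x ^+ 2)).
  rewrite -[leLHS]invrK -expRN invf_ple ?posrE ?expR_gt0//.
  apply: le_trans e1; rewrite -(ler_pM2l x1) divff ?gt_eqF//.
  have : 0 <= x ^+ 2 * (1 + 2 * x) by rewrite mulr_ge0 ?sqr_ge0//; lra.
  lra.
rewrite mulNr expRN lef_pV2 ?posrE ?expR_gt0 ?sqrtr_gt0//.
have -> : expR ((x - 2 * x ^+ 2) / 2) = Num.sqrt (expR (x - 2 * x ^+ 2)).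
  rewrite -[in RHS](divfK (_ : 2 != 0 :> R) (x - 2 * x ^+ 2)) ?pnatr_eq0//.
  by rewrite mulr_natr mulr2n expRD -expr2 sqrtr_sqr ger0_norm ?expR_ge0.
by rewrite ler_wsqrtr.
Qed.

(** Valid for [l] of either sign: negative values serve the lower tail, positive ones the upper tail
    and the excess. *)
Lemma pow_inv_sqrt1B_le (l : R) t : l <= 4^-1 ->
  (Num.sqrt (1 - 2 * l))^-1 ^+ t <= expR (t%:R * (l + 4 * l ^+ 2)).
Proof.
move=> l4; have := @inv_sqrt1D_le (- (2 * l)); rewrite lerN2 => h.
have {}h : (Num.sqrt (1 - 2 * l))^-1 <= expR (l + 4 * l ^+ 2).
  by apply: le_trans (h _) _; rewrite ?ler_expR; lra.
rewrite expRM_natl; apply: lerXn2r h; rewrite nnegrE ?expR_ge0//.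
Qed.

(** With r = N / v > q >= 1 one has r - q <= r^2 - q^2 <= exp(r^2 - q^2). An exponential moment of
    the squared norm thus controls the z-th moment of the excess. *)
Lemma excess_pointwise (N v q z b : R) : 1 <= z -> 0 < v -> 1 <= q -> 0 <= N ->
  z <= b ->
  Num.max 0 (N - q * v) `^ z <= v `^ z * expR (b * ((N / v) ^+ 2 - q ^+ 2)).
Proof.
move=> z1 v0 q1 N0 zb; have z0 : 0 < z by exact: lt_le_trans z1.
have [h|h] := leP (N - q * v) 0.
  by rewrite powR0 ?gt_eqF// mulr_ge0 ?powR_ge0 ?expR_ge0.
set r := N / v; have NE : N = r * v by rewrite divfK// gt_eqF.
have rq : q < r by rewrite ltr_pdivlMr// -subr_gt0.
rewrite NE -mulrBl mulrC powRM ?(ltW v0) ?subr_ge0 ?(ltW rq)//.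
rewrite ler_wpM2l ?powR_ge0//.
have y0 : 0 <= r ^+ 2 - q ^+ 2 by nra.
have ry : r - q <= r ^+ 2 - q ^+ 2 by nra.
apply: (@le_trans _ _ (expR (r ^+ 2 - q ^+ 2) `^ z)); last first.
  by rewrite /powR gt_eqF ?expR_gt0// expRK ler_expR ler_wpM2r.
apply: ge0_ler_powR; rewrite ?nnegrE ?expR_ge0 ?subr_ge0 ?(ltW rq) ?(ltW z0)//.
apply: le_trans ry _; apply: le_trans (expR_ge1Dx _).
by rewrite lerDr.
Qed.

(** Chernoff exponents with parameter -e/8 here, e/16 for the excess and 1/4 for the upper tail,
    whose threshold is 2^2 = 4. *)
Lemma lower_exponent (e T : R) : 0 < e -> e <= 1 -> 0 <= T ->
  e / 8 * T * (1 - e) ^+ 2 + T * (- (e / 8) + 4 * (- (e / 8)) ^+ 2) <=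
  - (T * e ^+ 2 / 16).
Proof.
move=> e0 e1 T0.
have e1' : 0 <= 1 - e by rewrite subr_ge0.
have := mulr_ge0 T0 (mulr_ge0 (sqr_ge0 e) e1').
nra.
Qed.

Lemma excess_exponent (e T : R) : 0 < e -> e <= 1 -> 0 <= T ->
  T * (e / 16 + 4 * (e / 16) ^+ 2) - e / 16 * T * (1 + e / 4) ^+ 2 <=
  - (T * e ^+ 2 / 64).
Proof.
move=> e0 e1 T0.
have := mulr_ge0 T0 (mulr_ge0 (ltW e0) (sqr_ge0 e)).
have := mulr_ge0 T0 (sqr_ge0 e).
nra.
Qed.

Lemma upper_exponent (e T : R) : 0 < e -> e <= 1 -> 0 <= T ->
  T * (4^-1 + 4 * (4^-1) ^+ 2) - 4^-1 * T * 4 <= - (T * e ^+ 2 / 16).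
Proof.
move=> e0 e1 T0.
have : 0 <= T * (1 - e ^+ 2).
  by rewrite mulr_ge0// subr_ge0 expr_le1 ?(ltW e0).
lra.
Qed.

End ScalarBounds.

Section JLMoment.
Context disp (Omega : measurableType disp) (R : realType) (P : probability Omega R).
Variables (d t : nat) (G : 'I_t -> 'I_d -> {RV P >-> R}).
Hypothesis t0 : (0 < t)%N.
Hypothesis GJL : gaussian_JL G.

Let X (ij : 'I_t * 'I_d) := G ij.1 ij.2.
Let s : R := Num.sqrt t%:R^-1.

Let s0 : 0 < s. Proof. by rewrite sqrtr_gt0 invr_gt0 ltr0n. Qed.

Let lawX i B : measurable B -> distribution P (X i) B = normal_prob 0 s B.
Proof. by move=> mB; apply: (proj1 GJL). Qed.

Let indX : mutually_independent X. Proof. exact: proj2 GJL. Qed.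

Section Vector.
Variable a : 'cV[R]_d.

Let c (ij : 'I_t * 'I_d) := a ij.2 0.
Let row (i : 'I_t) := [seq (i, j) | j <- enum 'I_d].

Let sqsum (r : seq 'I_t) (w : Omega) : R :=
  \sum_(i <- r) lin_comb X c (row i) w ^+ 2.

Let measurable_sqsum r : measurable_fun setT (sqsum r).
Proof.
apply: measurable_sum => i; apply: measurable_funX.
exact: measurable_lin_comb.
Qed.

HB.instance Definition _ r :=
  isMeasurableFun.Build _ _ _ _ (sqsum r) (measurable_sqsum r).

Let row_notin i r : i \notin r ->
  forall k, k \in row i -> k \notin [seq (i, j) | i <- r, j <- enum 'I_d].
Proof.
move=> ir k /mapP[j _ ->]; apply: contra ir => /allpairsPdep[i' [j' [i'r _ [-> _]]]].
exact: i'r.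
Qed.

Let row_uniq i : uniq (row i).
Proof. by rewrite map_inj_uniq ?enum_uniq// => j j' []. Qed.

Let indep_sqsum r : uniq r ->
  indep_off X (sqsum r) [seq (i, j) | i <- r, j <- enum 'I_d].
Proof.
elim: r => [_|i r IH /andP[ir ur]] J JK.
  apply: (indep_fam_comp (U := cst (0 : R)) (f := id)) => //.
    by move=> w; rewrite /= /sqsum big_nil.
  exact: indep_fam_cst.
have := indep_off_lin_comb indX c (row_uniq i) (row_notin ir) (IH ur).
move=> /(_ J JK); apply: (indep_fam_comp (f := fun x : R * R => x.2 ^+ 2 + x.1)).
  apply: measurable_funD; last exact: measurable_fst.
  by apply: measurable_funX; exact: measurable_snd.
by move=> w; rewrite /= /sqsum big_cons.
Qed.

Let sumc i : \sum_(k <- row i) c k ^+ 2 = norm2 a ^+ 2.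
Proof.
rewrite big_map big_enum sqr_norm2; apply: eq_bigr => j _.
by rewrite expr2.
Qed.

Let s2E : s ^+ 2 = t%:R^-1.
Proof. by rewrite sqr_sqrtr// invr_ge0 ler0n. Qed.

(** One row at a time: the sum over the remaining rows plays the part of [V] in
    [expect_lin_comb]. *)
Let expect_sqsum r l : uniq r -> 2 * l / t%:R * norm2 a ^+ 2 < 1 ->
  (\int[P]_w (expR (l * sqsum r w))%:E =
   (((Num.sqrt (1 - 2 * l / t%:R * norm2 a ^+ 2))^-1) ^+ size r)%:E)%E.
Proof.
move=> + hl; elim: r => [_|i r IH /andP[ir ur]].
  under eq_integral do rewrite /sqsum big_nil mulr0 expR0.
  rewrite integral_cst// mul1e; exact: probability_setT.
transitivity (\int[P]_w (expR (l * sqsum r w) *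
    expR (l * lin_comb X c (row i) w ^+ 2))%:E)%E.
  apply: eq_integral => w _.
  by rewrite -expRD -mulrDr /sqsum big_cons addrC.
have hl' : 2 * l * s ^+ 2 * (\sum_(k <- row i) c k ^+ 2) < 1 by rewrite sumc s2E.
have mh : measurable_fun setT (fun v : R => expR (l * v)).
  by apply: measurableT_comp => //; exact: measurable_funM.
rewrite (expect_lin_comb s0 indX lawX (V := sqsum r) (row_uniq i)
  (row_notin ir) (indep_sqsum ur) mh (fun v => expR_ge0 _) hl').
by rewrite IH// sumc s2E -EFinM -exprS.
Qed.

Let norm2_sqsum w : norm2 (JL_matrix G w *m a) ^+ 2 = sqsum (enum 'I_t) w.
Proof.
rewrite sqr_norm2 /dotv /sqsum big_enum; apply: eq_bigr => i _.
rewrite -expr2; congr (_ ^+ 2); rewrite mxE /lin_comb big_map big_enum.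
by apply: eq_bigr => j _; rewrite mxE mulrC.
Qed.

Lemma expect_exp_norm2 l : 2 * l / t%:R * norm2 a ^+ 2 < 1 ->
  (\int[P]_w (expR (l * norm2 (JL_matrix G w *m a) ^+ 2))%:E =
   ((Num.sqrt (1 - 2 * l / t%:R * norm2 a ^+ 2))^-1 ^+ t)%:E)%E.
Proof.
move=> hl; under eq_integral do rewrite norm2_sqsum.
by rewrite expect_sqsum ?enum_uniq// size_enum_ord.
Qed.

Lemma measurable_norm2_JL :
  measurable_fun setT (fun w => norm2 (JL_matrix G w *m a)).
Proof.
apply: (measurableT_comp (f := @Num.sqrt R)
  (g := fun w => \sum_i (JL_matrix G w *m a) i 0 ^+ 2)).
  apply: continuous_measurable_fun; exact: sqrt_continuous.
apply: measurable_sum => i; apply: measurable_funX.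
rewrite (_ : (fun _ => _) = lin_comb X c (row i)).
  exact: measurable_lin_comb.
apply/funext => w; rewrite mxE /lin_comb big_map big_enum.
by apply: eq_bigr => j _; rewrite mxE mulrC.
Qed.

End Vector.

End JLMoment.

(** * Concentration of the Gaussian map *)

Section Markov.
Context d (T : measurableType d) (R : realType) (P : probability T R).

Lemma measurable_set_le (f g : T -> R) : measurable_fun setT f ->
  measurable_fun setT g -> measurable [set w | f w <= g w].
Proof.
by move=> mf mg; rewrite -[X in measurable X]setTI; exact: measurable_fun_le.
Qed.

Lemma measurable_set_lt (f g : T -> R) : measurable_fun setT f ->
  measurable_fun setT g -> measurable [set w | f w < g w].
Proof.
move=> mf mg.
rewrite (_ : [set w | f w < g w] = ~` [set w | g w <= f w]).
  exact/measurableC/measurable_set_le.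
by apply/seteqP; split=> w /=; rewrite real_ltNge ?num_real// => /negP.
Qed.

Lemma markov_real (g : T -> R) (c : R) : measurable_fun setT g ->
  (forall w, 0 <= g w) -> 0 < c ->
  (P [set w | (c <= g w)%R] <= (c^-1)%:E * \int[P]_w (g w)%:E)%E.
Proof.
move=> mg g0 c0.
have mE : measurable [set w | c <= g w].
  exact: measurable_set_le.
rewrite -(@lee_pmul2l _ c%:E)// muleA -EFinM divff ?gt_eqF// mul1e.
rewrite -[leLHS](_ : \int[P]_(w in [set w | (c <= g w)%R]) c%:E = _)%E; last first.
  by rewrite integral_cst.
apply: (@le_trans _ _ (\int[P]_(w in [set w | (c <= g w)%R]) (g w)%:E))%E.
  apply: ge0_le_integral => //.
  - by move=> w _; rewrite lee_fin ltW.
  - by apply/measurable_EFinP; exact: measurable_funTS.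
apply: ge0_subset_integral => //; last by move=> w _; rewrite lee_fin.
exact/measurable_EFinP.
Qed.

End Markov.

Section JLTails.
Context disp (Omega : measurableType disp) (R : realType) (P : probability Omega R).
Variables (d t : nat) (G : 'I_t -> 'I_d -> {RV P >-> R}).
Hypothesis t0 : (0 < t)%N.
Hypothesis GJL : gaussian_JL G.

Let tp : 0 < t%:R :> R. Proof. by rewrite ltr0n. Qed.

Lemma expect_exp_le (u : 'cV[R]_d) (l : R) : 0 < norm2 u -> l <= 4^-1 ->
  (\int[P]_w (expR (l * t%:R * (norm2 (JL_matrix G w *m u) / norm2 u) ^+ 2))%:E <=
   (expR (t%:R * (l + 4 * l ^+ 2)))%:E)%E.
Proof.
move=> u0 l4; have u2 : 0 < norm2 u ^+ 2 by rewrite exprn_gt0.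
have E : 2 * (l * t%:R / norm2 u ^+ 2) / t%:R * norm2 u ^+ 2 = 2 * l.
  move: (gt_eqF tp) (gt_eqF u0); move: (t%:R : R) (norm2 u) => T v T0 v0.
  by field; rewrite T0 v0.
have h : 2 * (l * t%:R / norm2 u ^+ 2) / t%:R * norm2 u ^+ 2 < 1.
  by rewrite E; move: l4; lra.
have := expect_exp_norm2 t0 GJL h; rewrite E => H.
apply: le_trans (_ : (((Num.sqrt (1 - 2 * l))^-1 ^+ t)%:E <= _)%E).
  rewrite -H le_eqVlt; apply/orP; left; apply/eqP; apply: eq_integral => w _.
  by congr (expR _)%:E; rewrite expr_div_n mulrA mulrAC.
by rewrite lee_fin pow_inv_sqrt1B_le.
Qed.

Let measurable_exp (u : 'cV[R]_d) (b : R) : measurable_fun setT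
  (fun w => expR (b * (norm2 (JL_matrix G w *m u) / norm2 u) ^+ 2)).
Proof.
apply: measurableT_comp => //; apply: measurable_funM => //.
apply: measurable_funX; apply: measurable_funM => //.
exact: measurable_norm2_JL.
Qed.

Lemma JL_lower_tail (u : 'cV[R]_d) (e : R) : 0 < e -> e <= 1 ->
  (P [set w | (norm2 (JL_matrix G w *m u) < (1 - e) * norm2 u)%R] <=
   (expR (- (t%:R * e ^+ 2 / 16)))%:E)%E.
Proof.
move=> e0 e1; have [u0|u0] := eqVneq (norm2 u) 0.
  rewrite (_ : [set _ | _] = set0) ?measure0 ?lee_fin ?expR_ge0//.
  by apply/seteqP; split=> w //=; rewrite u0 mulr0 ltNge norm2_ge0.
have up : 0 < norm2 u by rewrite lt0r u0 norm2_ge0.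
pose b := - (e / 8) * t%:R.
pose c := expR (b * (1 - e) ^+ 2).
have b0 : b <= 0 by rewrite /b mulNr oppr_le0 mulr_ge0// divr_ge0// ltW.
pose g w := expR (b * (norm2 (JL_matrix G w *m u) / norm2 u) ^+ 2).
have mset : measurable [set w | c <= g w].
  by apply: measurable_set_le => //; exact: measurable_exp.
apply: (@le_trans _ _ (P [set w | (c <= g w)%R])).
  apply: le_measure; rewrite ?inE//.
    by apply: measurable_set_lt => //; exact: measurable_norm2_JL.
  move=> w /= h; rewrite /c /g ler_expR ler_wnM2l//.
  rewrite ler_pXn2r ?nnegrE ?divr_ge0 ?norm2_ge0 ?subr_ge0//.
  by rewrite ler_pdivrMr// ltW.
have c0 : 0 < c by exact: expR_gt0.
apply: le_trans (markov_real P (measurable_exp u b) (fun w => expR_ge0 _) c0) _.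
have e4 : - (e / 8) <= 4^-1 by lra.
apply: le_trans (lee_wpmul2l _ (expect_exp_le up e4)) _.
  by rewrite lee_fin invr_ge0 expR_ge0.
rewrite -EFinM lee_fin -expRN -expRD ler_expR.
apply: (le_trans _ (lower_exponent e0 e1 (ltW tp))).
by rewrite lerD2r /b mulNr mulNr opprK.
Qed.

(** The exponent is weakened to that of the lower tail, so that both kinds of failure of [net_ok]
    share one factor. *)
Lemma JL_upper_tail (u : 'cV[R]_d) (e : R) : 0 < e -> e <= 1 ->
  (P [set w | (2 * norm2 u < norm2 (JL_matrix G w *m u))%R] <=
   (expR (- (t%:R * e ^+ 2 / 16)))%:E)%E.
Proof.
move=> e0 e1; have [u0|u0] := eqVneq (norm2 u) 0.
  rewrite (_ : [set _ | _] = set0) ?measure0 ?lee_fin ?expR_ge0//.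
  apply/seteqP; split=> w //=.
  by rewrite (norm2_eq0 u0) mulmx0 !norm20 mulr0 ltxx.
have up : 0 < norm2 u by rewrite lt0r u0 norm2_ge0.
pose b : R := 4^-1 * t%:R.
pose c := expR (b * 4).
have b0 : 0 <= b by rewrite /b mulr_ge0.
pose g w := expR (b * (norm2 (JL_matrix G w *m u) / norm2 u) ^+ 2).
have mset : measurable [set w | c <= g w].
  by apply: measurable_set_le => //; exact: measurable_exp.
apply: (@le_trans _ _ (P [set w | (c <= g w)%R])).
  apply: le_measure; rewrite ?inE//.
    by apply: measurable_set_lt => //; exact: measurable_norm2_JL.
  move=> w /= h; rewrite /c /g ler_expR ler_wpM2l//.
  have -> : (4 : R) = 2 ^+ 2 by ring.
  rewrite ler_pXn2r ?nnegrE ?divr_ge0 ?norm2_ge0//.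
  by rewrite ler_pdivlMr// ltW.
have c0 : 0 < c by exact: expR_gt0.
apply: le_trans (markov_real P (measurable_exp u b) (fun w => expR_ge0 _) c0) _.
apply: le_trans (lee_wpmul2l _ (expect_exp_le up (lexx _))) _.
  by rewrite lee_fin invr_ge0 expR_ge0.
rewrite -EFinM lee_fin -expRN -expRD ler_expR.
by apply: (le_trans _ (upper_exponent e0 e1 (ltW tp))); rewrite addrC.
Qed.

Lemma JL_excess (u : 'cV[R]_d) (e z : R) : 0 < e -> e <= 1 -> 1 <= z ->
  z <= e / 16 * t%:R ->
  (\int[P]_w (Num.max 0 (norm2 (JL_matrix G w *m u) - (1 + e / 4) * norm2 u) `^ z)%:E
   <= (norm2 u `^ z * expR (- (t%:R * e ^+ 2 / 64)))%:E)%E.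
Proof.
move=> e0 e1 z1 zt; have z0 : 0 < z by exact: lt_le_trans z1.
have [u0|u0] := eqVneq (norm2 u) 0.
  rewrite u0 powR0 ?gt_eqF// mul0r integral0_eq// => w _.
  by rewrite (norm2_eq0 u0) mulmx0 norm20 mulr0 subrr maxxx powR0 ?gt_eqF.
have up : 0 < norm2 u by rewrite lt0r u0 norm2_ge0.
pose b : R := e / 16 * t%:R; pose q := 1 + e / 4.
have q1 : 1 <= q by rewrite lerDl divr_ge0// ltW.
pose g w := expR (b * (norm2 (JL_matrix G w *m u) / norm2 u) ^+ 2).
pose K := norm2 u `^ z * expR (- (b * q ^+ 2)).
have K0 : 0 <= K by rewrite mulr_ge0 ?powR_ge0 ?expR_ge0.
have mN := measurable_norm2_JL G u.
apply: (@le_trans _ _ (\int[P]_w (K * g w)%:E)%E).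
  apply: ge0_le_integral => //.
  - by move=> w _; rewrite lee_fin powR_ge0.
  - apply/measurable_EFinP; apply: (measurableT_comp (measurable_powR z)).
    apply: measurable_maxr => //; apply: measurable_funB => //.
  - apply/measurable_EFinP; apply: measurable_funM => //; exact: measurable_exp.
  move=> w _; rewrite lee_fin /K /g -mulrA -expRD [X in expR X]addrC -mulrBr.
  by apply: excess_pointwise => //; exact: norm2_ge0.
under eq_integral do rewrite EFinM.
rewrite ge0_integralZl_EFin//.
- have e4 : e / 16 <= 4^-1 by lra.
  apply: le_trans (lee_wpmul2l _ (expect_exp_le up e4)) _; first by rewrite lee_fin.
  rewrite -EFinM lee_fin /K -[leLHS]mulrA -expRD ler_wpM2l ?powR_ge0// ler_expR.
  by apply: (le_trans _ (excess_exponent e0 e1 (ltW tp))); rewrite addrC.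
- by move=> w _; rewrite lee_fin expR_ge0.
- by apply/measurable_EFinP; exact: measurable_exp.
Qed.

(** On the event, exp(l |A u|^2) = 1, while its expectation tends to 0 as [l] tends to minus
    infinity. *)
Lemma JL_injective (u : 'cV[R]_d) : u != 0 ->
  measurable [set w | JL_matrix G w *m u = 0] /\
  P [set w | JL_matrix G w *m u = 0] = 0%E.
Proof.
move=> u0; have up : 0 < norm2 u.
  by rewrite lt0r norm2_ge0 andbT; apply: contra_neq u0 => /norm2_eq0.
have mN := measurable_norm2_JL G u.
have EE : [set w | JL_matrix G w *m u = 0] =
    [set w | 0 < norm2 u] `&` [set w | norm2 (JL_matrix G w *m u) <= 0].
  apply/seteqP; split=> w /=; first by move=> ->; rewrite norm20.
  by move=> [_ h]; apply/norm2_eq0/eqP; rewrite eq_le h norm2_ge0.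
have mE : measurable [set w | JL_matrix G w *m u = 0].
  rewrite EE; apply: measurableI.
    exact: measurable_set_lt.
  exact: measurable_set_le.
split=> //; apply/eqP; rewrite eq_le measure_ge0 andbT.
apply/lee_addgt0Pr => e e0; rewrite add0e.
have [e1|e1] := leP 1 e.
  by apply: le_trans (probability_le1 _ mE) _; rewrite lee_fin.
(* Chosen so that the moment is exactly e^t, which is at most e because t >= 1. *)
pose l : R := - ((e ^- 2 - 1) / 2 * t%:R / norm2 u ^+ 2).
have lE : 2 * l / t%:R * norm2 u ^+ 2 = 1 - e ^- 2.
  rewrite /l; move: (gt_eqF tp) (gt_eqF up) (gt_eqF e0).
  move: (t%:R : R) (norm2 u) => T v T0 v0 e0'.
  by field; rewrite T0 v0 e0'.
have hl : 2 * l / t%:R * norm2 u ^+ 2 < 1.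
  by rewrite lE ltrBlDr ltrDl invr_gt0 exprn_gt0.
have H := expect_exp_norm2 t0 GJL hl.
have mg : measurable_fun setT (fun w => expR (l * norm2 (JL_matrix G w *m u) ^+ 2)).
  by apply: measurableT_comp => //; apply: measurable_funM => //; exact: measurable_funX.
have := markov_real P mg (fun w => expR_ge0 _) ltr01; rewrite invr1 mul1e H.
rewrite lE opprB subrKC -exprVn sqrtr_sqr ger0_norm ?invr_ge0 ?(ltW e0)// invrK.
move=> h; apply: le_trans (le_trans h _).
  apply: le_measure; rewrite ?inE//; first by apply: measurable_set_le.
  by move=> w /= ->; rewrite norm20 expr0n/= mulr0 expR0.
by rewrite lee_fin -[leRHS]expr1 ler_wiXn2l ?(ltW e0) ?(ltW e1).
Qed.

End JLTails.

(** * Existence and measurability of optimal costs *)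

Section Minimizer.
Import numFieldNormedType.Exports.
Context {R : realType}.

Lemma lz_le_sum (z : R) (I : Type) (r : seq I) (g : I -> R) : 1 <= z ->
  (forall i, 0 <= g i) -> lz z r g <= \sum_(i <- r) g i.
Proof.
move=> z1 g0; have S0 (s : seq I) : 0 <= \sum_(i <- s) g i by apply: sumr_ge0.
have z0 : 0 < z by exact: lt_le_trans z1.
rewrite (lz_le_powR z1)//; elim: r => [|i r IH].
  by rewrite !big_nil powR0// gt_eqF.
rewrite !big_cons; set S := \sum_(j <- r) g j in IH *.
have zz : 0 <= z - 1 by rewrite subr_ge0.
rewrite -(@mulr_powRB1 _ (g i + S))// ?addr_ge0 ?S0// mulrDl.
have h (x y : R) : 0 <= x -> x <= y -> x `^ z <= x * y `^ (z - 1).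
  move=> x0 xy; rewrite -(@mulr_powRB1 _ x)//; apply: ler_wpM2l => //.
  by apply: ge0_ler_powR => //; rewrite nnegrE// (le_trans x0 xy).
apply: lerD; first by apply: h; rewrite ?lerDl ?S0.
by apply: le_trans IH _; apply: h; rewrite ?lerDr ?S0.
Qed.

Lemma norm2_le_sum m (v : 'cV[R]_m) : norm2 v <= \sum_i `|v i 0|.
Proof.
rewrite -{1}(mul1mx v) mulmx_sum_col; apply: le_trans (ler_norm2_sum _ _) _.
apply: ler_sum => i _; rewrite norm2Z ler_piMr//.
rewrite norm2E /dotv (bigD1 i)//= big1 => [|j ji].
  by rewrite !mxE eqxx mulr1 addr0 sqrtr1.
by rewrite !mxE (negbTE ji) mulr0.
Qed.

Lemma lz_perturb (z : R) (I : eqType) m (r : seq I) (f g : I -> 'cV[R]_m) :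
  1 <= z -> lz z r (fun i => norm2 (f i)) <=
    lz z r (fun i => norm2 (g i)) + \sum_(i <- r) norm2 (f i - g i).
Proof.
move=> z1; have n0 (h : I -> 'cV[R]_m) i : 0 <= norm2 (h i) by exact: norm2_ge0.
apply: le_trans (_ : lz z r (fun i => norm2 (g i) + norm2 (f i - g i)) <= _).
  apply: (lz_le z1) => i _; rewrite norm2_ge0/=.
  by apply: le_trans (ler_norm2D _ _); rewrite subrKC.
apply: le_trans (minkowski_lz z1 r (n0 g) (n0 (fun i => f i - g i))) _.
by rewrite lerD2l lz_le_sum// => i; exact: norm2_ge0.
Qed.

Lemma pad_columns t m k (B : 'M[R]_(t, m)) : (m <= k)%N ->
  exists B' : 'M[R]_(t, k), B' *m B'^T = B *m B^T /\
    ((forall i j, `|B i j| <= 1) -> forall i j, `|B' i j| <= 1).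
Proof.
move=> /subnKC <-; exists (row_mx B 0); split.
  by rewrite tr_row_mx mul_row_col trmx0 mulmx0 addr0.
move=> h i j; case: (split_ordP j) => j' ->; first by rewrite row_mxEl.
by rewrite row_mxEr mxE normr0.
Qed.

Lemma span_cols_mem t m (B : 'M[R]_(t, m)) c :
  B *m c \in span [seq col j B | j <- enum 'I_m].
Proof.
rewrite mulmx_sum_col; apply: rpred_sum => j _; apply/rpredZ/memv_span.
by apply/map_f; rewrite mem_enum.
Qed.

Variables (t k : nat) (z : R) (Y : {fset 'cV[R]_t}).
Hypothesis z1 : 1 <= z.

(* B B^T y lies in the span of the columns of B whether or not they are
   orthonormal, so minimising over all B with entries in [-1, 1] suffices. *)
Let F (v : 'rV[R]_(t * k)) : R :=
  lz z Y (fun y => norm2 (y - vec_mx v *m (vec_mx v)^T *m y)).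

(** An explicit bound on |F v - F v0|, continuous in the entries of [v] and zero at [v0]; continuity
    of [F] follows by squeezing. *)
Let D (v v0 : 'rV[R]_(t * k)) : R := \sum_(y <- Y)
  \sum_i `|((vec_mx v *m (vec_mx v)^T *m y) - (vec_mx v0 *m (vec_mx v0)^T *m y)) i 0|.

Let D_perturb v v0 : F v <= F v0 + D v v0 /\ F v0 <= F v + D v v0.
Proof.
pose M (v1 : 'rV[R]_(t * k)) (y : 'cV[R]_t) := vec_mx v1 *m (vec_mx v1)^T *m y.
have E (y a b : 'cV[R]_t) : y - a - (y - b) = b - a.
  by rewrite opprB addrC addrA subrK.
split.
  have h := lz_perturb (Y : seq 'cV[R]_t) (fun y => y - M v y)
    (fun y => y - M v0 y) z1.
  apply: le_trans h _.
  apply: lerD => //; apply: ler_sum => y _; rewrite E norm2B.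
  exact: norm2_le_sum.
have h := lz_perturb (Y : seq 'cV[R]_t) (fun y => y - M v0 y)
  (fun y => y - M v y) z1.
apply: le_trans h _.
apply: lerD => //; apply: ler_sum => y _; rewrite E.
exact: norm2_le_sum.
Qed.

Let cvg_sumr (I : Type) (r : seq I) (T : Type) (Fl : set_system T)
    (FF : Filter Fl) (f : I -> T -> R) (l : I -> R) :
  (forall i, f i v @[v --> Fl] --> l i) ->
  (\sum_(i <- r) f i v) @[v --> Fl] --> \sum_(i <- r) l i.
Proof.
move=> fc; elim: r => [|i r IH].
  by rewrite big_nil; under eq_fun do rewrite big_nil; exact: cvg_cst.
by rewrite big_cons; under eq_fun do rewrite big_cons; exact: cvgD.
Qed.

Let D_cvg (v0 : 'rV[R]_(t * k)) (Fl : set_system 'rV[R]_(t * k)) (FF : Filter Fl) :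
  (forall i, v 0 i @[v --> Fl] --> (v0 0 i : R)) -> D v v0 @[v --> Fl] --> D v0 v0.
Proof.
move=> cv; rewrite /D; apply: cvg_sumr => y; apply: cvg_sumr => i.
apply: cvg_norm.
pose g (v : 'rV[R]_(t * k)) :=
  \sum_j (\sum_l v 0 (mxvec_index i l) * v 0 (mxvec_index j l)) * y j 0 -
   (vec_mx v0 *m (vec_mx v0)^T *m y) i 0.
suff gE v : (vec_mx v *m (vec_mx v)^T *m y - vec_mx v0 *m (vec_mx v0)^T *m y) i 0 = g v.
  rewrite gE; under eq_fun do rewrite gE.
  apply: cvgB; last exact: cvg_cst.
  apply: cvg_sumr => j; apply: cvgM; last exact: cvg_cst.
  by apply: cvg_sumr => l; apply: cvgM; exact: cv.
rewrite mxE [in RHS]/g [X in _ + X]mxE; congr (_ - _); rewrite mxE.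
apply: eq_bigr => j _; congr (_ * _).
by rewrite mxE; apply: eq_bigr => l _; rewrite !mxE.
Qed.

Let F_continuous : continuous F.
Proof.
move=> v0; have D0 : D v0 v0 = 0.
  by rewrite /D big1// => y _; rewrite big1// => i _; rewrite subrr mxE normr0.
have Dc : D v v0 @[v --> v0] --> (0 : R).
  rewrite -[X in _ --> X]D0; apply: (D_cvg (nbhs_filter v0)) => i.
  exact: coord_continuous.
apply: (@squeeze_cvgr _ _ (nbhs_filter v0) _ (fun v => F v0 - D v v0) (fun v => F v0 + D v v0)).
- apply: nearW => v; have [h1 h2] := D_perturb v v0.
  have aux (a b c : R) : a <= b + c -> a - c <= b by rewrite lerBlDr.
  by apply/andP; split; [exact: aux h2|exact: h1].
- by rewrite -[X in _ --> X]subr0; apply: cvgB => //; exact: cvg_cst.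
- by rewrite -[X in _ --> X]addr0; apply: cvgD => //; exact: cvg_cst.
Qed.

(** The column span of a minimiser of [F] on the compact box costs at most the minimum. Conversely
    an orthonormal basis of any competitor, padded with zero columns, lies in the box and realises
    its cost. *)
Lemma optimal_subspace_exists :
  exists S : {vspace 'cV[R]_t}, optimal_subspace k z Y S.
Proof.
pose box : set 'rV[R]_(t * k) := [set v | forall i, `[(-1 : R), 1]%classic (v ord0 i)].
have box0 : box !=set0.
  by exists 0 => i /=; rewrite mxE in_itv/= lerN10 ler01.
have boxc : compact box.
  apply: (@rV_compact _ _ (fun=> `[(-1 : R), 1]%classic)) => i.
  exact: segment_compact.
have [v _ vmin] := EVT_min_rV box0 boxc (continuous_subspaceT F_continuous).
pose S := span [seq col j (vec_mx v : 'M[R]_(t, k)) | j <- enum 'I_k].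
exists S; split; first by rewrite (leq_trans (dim_span _))// size_map size_enum_ord.
move=> S' dS'; apply: (@le_trans _ _ (F v)).
  have pt (y : 'cV[R]_t) : y \in (Y : seq 'cV[R]_t) ->
      0 <= norm2 (y - orthoproj S y) <= norm2 (y - vec_mx v *m (vec_mx v)^T *m y).
    move=> _; rewrite norm2_ge0/=; apply: orthoproj_min; rewrite -mulmxA.
    exact: span_cols_mem.
  exact: (lz_le z1 pt).
have [m [B [mS BB BS]]] := orthonormal_basis S'.
have [B' [B'E B'1]] := pad_columns B (leq_trans mS dS').
have B1 i j : `|B i j| <= 1.
  have n1 : norm2 (col j B) = 1.
    rewrite colE norm2_isometry// norm2E /dotv (bigD1 j)//= big1 => [|l lj].
      by rewrite mxE !eqxx mulr1 addr0 sqrtr1.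
    by rewrite mxE (negbTE lj) mul0r.
  by rewrite -n1; apply: le_trans (coef_le_norm2 (col j B) i); rewrite mxE.
have := vmin (mxvec B'); rewrite inE => h; apply: le_trans (h _) _.
  move=> i /=; case/mxvec_indexP: i => i j.
  by rewrite mxvecE in_itv/= -ler_norml; exact: B'1.
have pt (y : 'cV[R]_t) : y \in (Y : seq 'cV[R]_t) ->
    0 <= norm2 (y - vec_mx (mxvec B') *m (vec_mx (mxvec B'))^T *m y) <=
    norm2 (y - orthoproj S' y).
  by move=> _; rewrite norm2_ge0/= mxvecK B'E (orthoproj_mulmx y BB BS) mulmxA.
exact: (lz_le z1 pt).
Qed.

End Minimizer.

Section RationalSubspaces.
Context {R : realType}.
Variables (t k : nat).

(** A countable dense family; too long lists fall back to the zero subspace, so every list is a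
    legitimate competitor. *)
Definition rat_subspace (L : seq 'cV[rat]_t) : {vspace 'cV[R]_t} :=
  if (size L <= k)%N then span [seq map_mx ratr q | q <- L] else 0%VS.

Lemma dim_rat_subspace L : (\dim (rat_subspace L) <= k)%N.
Proof.
rewrite /rat_subspace; case: ifP => [Lk|_]; last by rewrite dimv0.
by rewrite (leq_trans (dim_span _))// size_map.
Qed.

Lemma rat_approx (v : 'cV[R]_t) (e : R) : 0 < e ->
  exists q : 'cV[rat]_t, norm2 (v - map_mx ratr q) <= t%:R * e.
Proof.
move=> e0.
have h i : exists q : rat, `|v i 0 - ratr q| <= e.
  have lt_e : v i 0 - e < v i 0 + e by rewrite ltrD2l gtrN.
  have [q] := rat_in_itvoo lt_e; rewrite in_itv/= => /andP[q1 q2].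
  exists q; rewrite distrC ler_distl; apply/andP; split; exact: ltW.
have [q qP] := choice h.
exists (\col_i q i); apply: le_trans (norm2_le_sum _) _.
rewrite mulr_natl -[t in X in _ <= X]card_ord -sumr_const; apply: ler_sum => i _.
by rewrite !mxE.
Qed.

Lemma rat_subspace_dense (z : R) (Y : {fset 'cV[R]_t}) (S : {vspace 'cV[R]_t}) c :
  1 <= z -> (\dim S <= k)%N -> cost z Y S < c ->
  exists L, cost z Y (rat_subspace L) < c.
Proof.
move=> z1 dS Sc; have [m [B [mS BB BS]]] := orthonormal_basis S.
pose K : R := \sum_(y <- Y) \sum_(j < m) `|(B^T *m y) j 0| * t%:R.
have K0 : 0 <= K.
  by apply: sumr_ge0 => y _; apply: sumr_ge0 => j _; rewrite mulr_ge0.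
(* Moving every basis vector by at most t e changes the cost by at most K e, which is below the
   available gap. *)
pose e := (c - cost z Y S) / (1 + K).
have K1 : 0 < 1 + K by rewrite ltr_pwDl.
have e0 : 0 < e by rewrite divr_gt0 ?subr_gt0.
have [q qP] := choice (fun j => rat_approx (col j B) e0).
exists [seq q j | j <- enum 'I_m].
set V := rat_subspace _.
have qV (a : 'cV[R]_m) : \sum_j a j 0 *: map_mx ratr (q j) \in V.
  rewrite /V /rat_subspace size_map size_enum_ord (leq_trans mS dS).
  apply: rpred_sum => j _; apply: rpredZ; apply: memv_span.
  by rewrite map_f// map_f// mem_enum.
pose r (y : 'cV[R]_t) := \sum_j (B^T *m y) j 0 *: (map_mx ratr (q j) : 'cV[R]_t).
apply: (@le_lt_trans _ _ (lz z (Y : seq 'cV[R]_t) (fun y => norm2 (y - r y)))).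
  have pt (y : 'cV[R]_t) : y \in (Y : seq 'cV[R]_t) ->
     0 <= norm2 (y - orthoproj V y) <= norm2 (y - r y).
    by move=> _; rewrite norm2_ge0/=; apply: orthoproj_min; exact: qV.
  exact: (lz_le z1 pt).
have h := lz_perturb (Y : seq 'cV[R]_t) (fun y => y - r y)
  (fun y => y - orthoproj S y) z1.
apply: (le_lt_trans h); rewrite -ltrBrDl.
apply: (@le_lt_trans _ _ (K * e)).
  rewrite /K mulr_suml; apply: ler_sum => y _.
  rewrite (orthoproj_mulmx y BB BS) opprB [X in norm2 X]addrC addrA subrK.
  rewrite mulmx_sum_col /r -sumrB; apply: le_trans (ler_norm2_sum _ _) _.
  rewrite mulr_suml; apply: ler_sum => j _; rewrite -scalerBr norm2Z -mulrA.
  by rewrite ler_wpM2l.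
rewrite /e mulrCA gtr_pMr ?subr_gt0// ltr_pdivrMr// mul1r ltrDr.
exact: ltr01.
Qed.

End RationalSubspaces.

Section MeasurableCost.
Context disp (Omega : measurableType disp) {R : realType}.

Lemma measurable_norm2 m (v : Omega -> 'cV[R]_m) :
  (forall i, measurable_fun setT (fun w => v w i 0)) ->
  measurable_fun setT (fun w => norm2 (v w)).
Proof.
move=> mv; apply: (measurableT_comp (f := @Num.sqrt R)
  (g := fun w => \sum_i v w i 0 ^+ 2)).
  apply: continuous_measurable_fun; exact: sqrt_continuous.
by apply: measurable_sum => i; exact: measurable_funX.
Qed.

Lemma measurable_mulmx_cst m n (M : 'M[R]_(n, m)) (v : Omega -> 'cV[R]_m) :
  (forall i, measurable_fun setT (fun w => v w i 0)) ->
  forall i, measurable_fun setT (fun w => (M *m v w) i 0).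
Proof.
move=> mv i; under eq_fun do rewrite mxE.
by apply: measurable_sum => j; exact: measurable_funM.
Qed.

Variables (d t k : nat) (z : R) (X : {fset 'cV[R]_d}) (A : Omega -> 'M[R]_(t, d)).
Hypothesis z1 : 1 <= z.
Hypothesis mA : forall i j, measurable_fun setT (fun w => A w i j).

Let mAx (x : 'cV[R]_d) i : measurable_fun setT (fun w => (A w *m x) i 0).
Proof.
under eq_fun do rewrite mxE.
by apply: measurable_sum => j; exact: measurable_funM.
Qed.

Let dist (S : {vspace 'cV[R]_t}) w (x : 'cV[R]_d) := norm2 (A w *m x - orthoproj S (A w *m x)).

Let measurable_dist S x : measurable_fun setT (fun w => dist S w x).
Proof.
have [m [B [_ BB BS]]] := orthonormal_basis S.
apply: measurable_norm2 => i; under eq_fun do rewrite mxE [X in _ + X]mxE.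
apply: measurable_funB; first exact: mAx.
under eq_fun do rewrite (orthoproj_mulmx _ BB BS).
by do 2 apply: measurable_mulmx_cst.
Qed.

(* image_mx is a set: points of X with the same image are counted once, so each
   gets its share of the multiplicity. *)
Let count w (x : 'cV[R]_d) : R := \sum_(x' <- X) (A w *m x' == A w *m x)%:R.

Let measurable_count x : measurable_fun setT (fun w => count w x).
Proof.
apply: measurable_sum => x'.
have -> : (fun w => (A w *m x' == A w *m x)%:R) =
    \1_[set w | norm2 (A w *m (x' - x)) <= 0] :> (Omega -> R).
  apply/funext => w; rewrite indicE; congr (_ %:R); congr nat_of_bool.
  apply/idP/idP => [/eqP h|/set_mem /= h]; first apply/mem_set => /=.
    by rewrite mulmxBr h subrr norm20.
  rewrite -subr_eq0 -mulmxBr; apply/eqP/norm2_eq0/eqP.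
  by rewrite eq_le h norm2_ge0.
apply: measurable_indic; apply: measurable_set_le => //.
exact: measurable_norm2.
Qed.

(** The inverse is written as a power with exponent -1, so that measurability of [powR] covers
    it. *)
Let cost_image S w : cost z (image_mx (A w) X) S =
  (\sum_(x <- X) dist S w x `^ z * count w x `^ (- 1)) `^ z^-1.
Proof.
congr (_ `^ _); rewrite [RHS](partition_big_imfset _ (mulmx (A w))).
rewrite big_seq [RHS]big_seq; apply: eq_bigr => y /imfsetP[x /= xX yE].
pose cy : R := \sum_(x <- X) (A w *m x == y)%:R.
have cy0 : 0 < cy.
  rewrite /cy (big_fsetD1 x)//= -yE eqxx ltr_wpDr//.
  by apply: sumr_ge0 => ? _; exact: ler0n.
transitivity (\sum_(x' <- X | A w *m x' == y)
    norm2 (y - orthoproj S y) `^ z * cy^-1); last first.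
  apply: eq_bigr => x' /eqP x'y; rewrite /dist /count x'y powR_inv1//.
  exact: ltW.
rewrite -big_distrr/= -[LHS]mulr1; congr (_ * _).
rewrite big_mkcond/=.
rewrite (eq_bigr (fun x' => (A w *m x' == y)%:R * cy^-1)).
  by rewrite -mulr_suml divff// gt_eqF.
by move=> x' _; case: eqP; rewrite ?mul1r ?mul0r.
Qed.

Lemma measurable_cost S :
  measurable_fun setT (fun w => cost z (image_mx (A w) X) S).
Proof.
under eq_fun do rewrite cost_image.
apply: (measurableT_comp (measurable_powR _)).
apply: measurable_sum => x; apply: measurable_funM.
  exact: (measurableT_comp (measurable_powR _)).
exact: (measurableT_comp (measurable_powR _)).
Qed.

(** By density the optimal cost is the infimum over countably many rational subspaces: it is at
    least [lo] when none of them costs less, and at most [hi] when for every n some costs less than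
    hi + 1/(n+1). *)
Lemma measurable_optimal_cost (lo hi : R) :
  measurable [set w | exists S, [/\ optimal_subspace k z (image_mx (A w) X) S,
    lo <= cost z (image_mx (A w) X) S & cost z (image_mx (A w) X) S <= hi]].
Proof.
pose C w S := cost z (image_mx (A w) X) S.
pose V L : {vspace 'cV[R]_t} := rat_subspace k L.
rewrite (_ : [set w | _] =
  ~` (\bigcup_L [set w | C w (V L) < lo]) `&`
  \bigcap_n (\bigcup_L [set w | C w (V L) < hi + n.+1%:R^-1])).
  apply: measurableI; first apply: measurableC; last first.
    apply: bigcapT_measurable => n; apply: countable_bigcupT_measurable.
      exact: countableP.
    by move=> L; apply: measurable_set_lt => //; exact: measurable_cost.
  apply: countable_bigcupT_measurable; first exact: countableP.
  by move=> L; apply: measurable_set_lt => //; exact: measurable_cost.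
apply/seteqP; split=> w /=.
  move=> [S [[dS optS] loS Shi]]; split.
    move=> [L _ /= h]; have := le_trans loS (optS _ (dim_rat_subspace k L)).
    by rewrite leNgt h.
  move=> n _; have lt_hi : cost z (image_mx (A w) X) S < hi + n.+1%:R^-1.
    by apply: le_lt_trans Shi _; rewrite ltrDl invr_gt0 ltr0n.
  have [L hL] := rat_subspace_dense z1 dS lt_hi.
  by exists L.
move=> [nlo allhi].
have [S [dS optS]] := optimal_subspace_exists k (image_mx (A w) X) z1.
exists S; split=> //.
  rewrite leNgt; apply/negP => lt_lo; apply: nlo.
  by have [L hL] := rat_subspace_dense z1 dS lt_lo; exists L.
apply/ler_addgt0Pr => e e0.
have [n ne] : exists n, n.+1%:R^-1 < e.
  exists (Num.truncn e^-1); rewrite invf_plt ?posrE//.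
  exact: truncnS_gt.
have [L _ /= hL] := allhi n I.
apply: le_trans (optS _ (dim_rat_subspace k L)) _.
by apply/ltW/(lt_le_trans hL); rewrite lerD2l ltW.
Qed.

End MeasurableCost.

(** * Failure events *)

Lemma union_bound d (T : measurableType d) (R : realType) (P : probability T R)
    (I : eqType) (r : seq I) (F : I -> set T) (c : R) :
  (forall i, i \in r -> measurable (F i)) ->
  (forall i, i \in r -> (P (F i) <= c%:E)%E) ->
  measurable [set w | exists2 i, i \in r & F i w] /\
  (P [set w | exists2 i, i \in r & F i w] <= ((size r)%:R * c)%:E)%E.
Proof.
elim: r => [|i r IH] mF Fc.
  rewrite (_ : [set _ | _] = set0) ?measure0 ?mul0r//.
  by apply/seteqP; split=> w // -[].
have [||mU PU] := IH.
- by move=> j jr; apply: mF; rewrite inE jr orbT.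
- by move=> j jr; apply: Fc; rewrite inE jr orbT.
rewrite (_ : [set _ | _] = F i `|` [set w | exists2 i, i \in r & F i w]).
  split; first by apply: measurableU => //; apply: mF; rewrite mem_head.
  apply: le_trans (measureU2 _ _ _) _ => //; first by apply: mF; rewrite mem_head.
  rewrite /= -natr1 addrC mulrDl mul1r EFinD leeD//.
  by apply: Fc; rewrite mem_head.
apply/seteqP; split=> w /=.
  move=> [j]; rewrite inE => /predU1P[->|jr] Fj; [by left|by right; exists j].
move=> [Fi|[j jr Fj]]; first by exists i => //; rewrite mem_head.
by exists j => //; rewrite inE jr orbT.
Qed.

Section ExpectedMass.
Context disp (Omega : measurableType disp) {R : realType} (P : probability Omega R).
Context {T : eqType}.
Variables (X : seq T) (sig : T -> R) (bad : Omega -> seq T -> bool).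
Variables (n : nat) (delta : R).
Hypothesis sig0 : forall x, 0 <= sig x.
Hypothesis sig1 : \sum_(x <- X) sig x = 1.
Hypothesis mbad : forall s, measurable [set w | bad w s].
Hypothesis Pbad : forall s, (size s <= n)%N -> (P [set w | bad w s] <= delta%:E)%E.

Lemma measurable_mass j s : measurable_fun setT (fun w => mass X sig (bad w) j s).
Proof.
elim: j s => [|j IH] s /=; last first.
  by apply: measurable_sum => x; apply: measurable_funM.
rewrite (_ : (fun _ => _) = \1_[set w | bad w s]); first exact: measurable_indic.
apply/funext => w; rewrite indicE; congr (nat_of_bool _)%:R.
by apply/idP/idP => [h|/set_mem//]; exact/mem_set.
Qed.

(** The law of the tuples does not depend on the outcome, so the expectation enters the weighted
    sums and acts on one fixed tuple at a time. *)
Lemma expect_mass j s : (j + size s <= n)%N ->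
  (\int[P]_w (mass X sig (bad w) j s)%:E <= delta%:E)%E.
Proof.
elim: j s => [|j IH] s /= js.
  rewrite (_ : (fun _ => _) = (fun w => (\1_[set w | bad w s] w)%:E)).
    by rewrite integral_indic// setIT; exact: Pbad.
  apply/funext => w; rewrite indicE; congr (nat_of_bool _)%:R%:E.
  by apply/idP/idP => [h|/set_mem//]; exact/mem_set.
under eq_integral do rewrite -sumEFin.
rewrite ge0_integral_sum//; last 2 first.
- move=> x; apply/measurable_EFinP; apply: measurable_funM => //.
  exact: measurable_mass.
- by move=> x w _; rewrite lee_fin mulr_ge0// mass_ge0.
rewrite -[leRHS]mul1e -sig1 -sumEFin ge0_sume_distrl; last first.
  by move=> x _; rewrite lee_fin.
apply: lee_sum => x _; under eq_integral do rewrite EFinM.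
rewrite ge0_integralZl_EFin//.
- by apply: lee_wpmul2l; [rewrite lee_fin|apply: IH; rewrite /= addnS].
- by move=> w _; rewrite lee_fin mass_ge0.
- by apply/measurable_EFinP; exact: measurable_mass.
Qed.

Lemma mass_tail c : 0 < c ->
  measurable [set w | c <= \sum_(j < n) mass X sig (bad w) j.+1 [::]] /\
  (P [set w | (c <= \sum_(j < n) mass X sig (bad w) j.+1 [::])%R]
     <= (c^-1 * (n%:R * delta))%:E)%E.
Proof.
move=> c0.
have mS : measurable_fun setT
    (fun w => \sum_(j < n) mass X sig (bad w) j.+1 [::]).
  by apply: measurable_sum => j; exact: measurable_mass.
split; first exact: measurable_set_le.
apply: le_trans (markov_real _ mS _ c0) _.
  by move=> w; apply: sumr_ge0 => j _; exact: mass_ge0.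
rewrite EFinM; apply: lee_wpmul2l; first by rewrite lee_fin invr_ge0 ltW.
under eq_integral do rewrite -sumEFin.
rewrite ge0_integral_sum//; last 2 first.
- by move=> j; apply/measurable_EFinP; exact: measurable_mass.
- by move=> j w _; rewrite lee_fin mass_ge0.
rewrite mulr_natl -[n in X in (_ <= X)%E]card_ord -sumr_const -sumEFin.
by apply: lee_sum => j _; apply: expect_mass; rewrite addn0.
Qed.

End ExpectedMass.

Section JLEvents.
Context disp (Omega : measurableType disp) {R : realType} (P : probability Omega R).
Variables (d t : nat) (G : 'I_t -> 'I_d -> {RV P >-> R}).
Hypothesis t0 : (0 < t)%N.
Hypothesis GJL : gaussian_JL G.
Let JL := JL_matrix G.

(** A union bound over the grid points and columns of an orthonormal basis. The event is failure of
    the finite test [net_ok], whose measurability is plain. *)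
Lemma subspace_embedding (V : {vspace 'cV[R]_d}) (N M : nat) (e : R) :
  (\dim V <= N)%N -> (0 < M)%N -> 0 < e -> e <= 1 ->
  exists b : Omega -> bool, [/\ measurable [set w | b w],
    (P [set w | b w] <=
      (((2 * M).+1%:R ^+ N + N%:R) * expR (- (t%:R * e ^+ 2 / 16)))%:E)%E &
    forall w, ~~ b w -> forall v, v \in V ->
      (1 - (e + 3 * N%:R / M%:R)) * norm2 v <= norm2 (JL w *m v)].
Proof.
move=> VN M0 e0 e1; have [m [B [mV BB BV]]] := orthonormal_basis V.
have mN : (m <= N)%N := leq_trans mV VN.
exists (fun w => ~~ net_ok B M e (JL w)).
set p := expR _; have p0 : 0 <= p by exact: expR_ge0.
have colB j := norm2_col_orthonormal j BB.
pose low (g : {ffun 'I_m -> 'I_(2 * M).+1}) := [set w |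
  norm2 (JL w *m grid_point B g) < (1 - e) * norm2 (grid_point B g)].
pose up j := [set w | 2 * norm2 (col j B) < norm2 (JL w *m col j B)].
have [||m1 P1] := @union_bound _ _ _ P _ (enum {ffun 'I_m -> 'I_(2 * M).+1}) low p.
- by move=> g _; apply: measurable_set_lt => //; exact: measurable_norm2_JL.
- by move=> g _; exact: JL_lower_tail.
have [||m2 P2] := @union_bound _ _ _ P _ (enum 'I_m) up p.
- by move=> j _; apply: measurable_set_lt => //; exact: measurable_norm2_JL.
- by move=> j _; exact: JL_upper_tail.
have EE : [set w | ~~ net_ok B M e (JL w)] =
    [set w | exists2 g, g \in enum {ffun 'I_m -> 'I_(2 * M).+1} & low g w] `|`
    [set w | exists2 j, j \in enum 'I_m & up j w].
  apply/seteqP; split=> w /=.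
    rewrite /net_ok negb_and !negb_forall => /orP[]/existsP[i]; rewrite -ltNge => h.
      by left; exists i; rewrite ?mem_enum.
    by right; exists i; rewrite ?mem_enum// /up/= colB mulr1.
  rewrite /net_ok negb_and !negb_forall => -[][i _ h]; apply/orP.
    by left; apply/existsP; exists i; rewrite -ltNge.
  by right; apply/existsP; exists i; move: h; rewrite /up/= colB mulr1 -ltNge.
split.
- by rewrite EE; exact: measurableU.
- rewrite EE; apply: le_trans (measureU2 _ m1 m2) _.
  apply: le_trans (leeD P1 P2) _; rewrite -EFinD lee_fin -mulrDl.
  rewrite ler_wpM2r// -!cardE card_ffun !card_ord natrX lerD ?ler_nat//.
  by rewrite ler_weXn2l// ler1n.
move=> w; rewrite negbK => ok v /BV[c ->].
apply: le_trans (net_okP M0 _ BB ok c); last by rewrite (ltW e0) e1.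
rewrite ler_wpM2r ?norm2_ge0// lerD2l lerN2 lerD2l ler_wpM2r ?invr_ge0//.
by rewrite ler_wpM2l// ler_nat.
Qed.

Lemma injective_event (X : {fset 'cV[R]_d}) :
  exists2 E, measurable E /\ P E = 0%E & forall w, ~ E w ->
    {in X &, injective (mulmx (JL w))}.
Proof.
pose r := [seq uv <- [seq (u, v) | u <- (X : seq _), v <- (X : seq _)] | uv.1 != uv.2].
have rP uv : uv \in r -> uv.1 - uv.2 != 0.
  by rewrite mem_filter subr_eq0 => /andP[].
have [||mE PE] := @union_bound _ _ _ P _ r
  (fun uv => [set w | JL w *m (uv.1 - uv.2) = 0]) 0.
- by move=> uv /rP /(JL_injective t0 GJL)[].
- by move=> uv /rP /(JL_injective t0 GJL)[_ ->].
eexists.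
  split; first exact: mE.
  by apply/eqP; rewrite eq_le measure_ge0 andbT; rewrite mulr0 in PE.
move=> w nE u v uX vX uv; apply: contrapT => /eqP neq; apply: nE.
exists (u, v); last by rewrite /= mulmxBr uv subrr.
by rewrite mem_filter neq/=; apply/allpairsP; exists (u, v).
Qed.

Lemma excess_tail (X : seq 'cV[R]_d) (S : {vspace 'cV[R]_d}) (e z : R) :
  0 < e -> e <= 1 -> 1 <= z -> z <= e / 16 * t%:R ->
  let F := [set w | e ^+ 2 / 100 * opt z X S < lz z X (excess S e (JL w))] in
  measurable F /\
  (P F <= ((100 / e ^+ 2) `^ z * expR (- (t%:R * e ^+ 2 / 64)))%:E)%E.
Proof.
move=> e0 e1 z1 zt F; have z0 : 0 < z by exact: lt_le_trans z1.
have q0 : 0 < e ^+ 2 / 100 by rewrite divr_gt0// exprn_gt0.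
have mexc x : measurable_fun setT (fun w => excess S e (JL w) x `^ z).
  apply: (measurableT_comp (measurable_powR z)); apply: measurable_maxr => //.
  by apply: measurable_funB => //; exact: measurable_norm2_JL.
have mlz : measurable_fun setT (fun w => lz z X (excess S e (JL w))).
  by apply: (measurableT_comp (measurable_powR _)); exact: measurable_sum.
have mF : measurable F by exact: measurable_set_lt.
split=> //.
(* If [opt] vanishes, all residuals and hence all excesses are 0. *)
have [opt0|opt0] := eqVneq (opt z X S) 0.
  rewrite (_ : F = set0) ?measure0 ?lee_fin ?mulr_ge0 ?powR_ge0 ?expR_ge0//.
  apply/seteqP; split=> w //=; rewrite /F/= opt0 mulr0 /lz big_seq big1.
    by rewrite powR0 ?ltxx// invr_eq0 gt_eqF.
  move=> x xX; have rx : residual S x = 0 := lz_eq0 z1 opt0 xX.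
  by rewrite /excess rx (norm2_eq0 rx) mulmx0 norm20 mulr0 subrr maxxx powR0 ?gt_eqF.
have op : 0 < opt z X S by rewrite lt0r opt0 lz_ge0.
have c0 : 0 < (e ^+ 2 / 100 * opt z X S) `^ z.
  by apply: powR_gt0; apply: mulr_gt0.
pose g w := \sum_(x <- X) excess S e (JL w) x `^ z.
have mg : measurable_fun setT g by exact: measurable_sum.
apply: (@le_trans _ _ (P [set w | (e ^+ 2 / 100 * opt z X S) `^ z <= g w])).
  apply: le_measure; rewrite ?inE//; first exact: measurable_set_le.
  by move=> w /ltW; rewrite powR_le_lz// ltW// mulr_gt0.
apply: le_trans (markov_real _ mg _ c0) _.
  by move=> w; apply: sumr_ge0 => x _; exact: powR_ge0.
under eq_integral do rewrite /g -sumEFin.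
rewrite ge0_integral_sum//; last 2 first.
- by move=> x; apply/measurable_EFinP.
- by move=> x w _; rewrite lee_fin powR_ge0.
set p := expR _.
apply: (@le_trans _ _ ((((e ^+ 2 / 100 * opt z X S) `^ z)^-1)%:E *
    (\sum_(x <- X) (residual S x `^ z * p)%:E))%E).
  apply: lee_wpmul2l; first by rewrite lee_fin invr_ge0 ltW.
  by apply: lee_sum => x _; exact: JL_excess.
rewrite sumEFin -EFinM lee_fin -mulr_suml -powR_lz// -/(opt z X S).
rewrite mulrA ler_wpM2r ?expR_ge0// powRM ?(ltW q0) ?(ltW op)// invfM mulfVK.
  by rewrite (powR_inv _ q0) invf_div.
by rewrite gt_eqF// powR_gt0.
Qed.

End JLEvents.

(** * Both inequalities for a fixed matrix *)

Section GoodOutcome.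
Context {R : realType}.

Lemma inv_1eps_le (e : R) : 0 < e -> e < 1 -> (1 + e)^-1 <= 1 - e / 2.
Proof.
move=> e0 e1; rewrite -[leLHS]mul1r ler_pdivrMr ?addr_gt0//.
have := mulr_ge0 (ltW e0) (ltW (_ : 0 < 1 - e)); rewrite subr_gt0 => /(_ e1).
have -> : e * (1 - e) = e - e * e by ring.
have -> : (1 - e / 2) * (1 + e) = 1 + e / 2 - e * e / 2 by field.
lra.
Qed.

Lemma upper_cost_arith (e O : R) : 0 < e -> e < 1 -> 0 <= O ->
  (1 + e / 4) * O + e ^+ 2 / 100 * O <= (1 + e) * O.
Proof.
move=> e0 e1 O0; rewrite -mulrDl ler_wpM2r//.
have : e * e <= e by rewrite ler_piMl// ltW.
rewrite expr2; lra.
Qed.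

Variables (d t k n : nat) (z : R) (X : {fset 'cV[R]_d}) (S : {vspace 'cV[R]_d}).
Variables (A : 'M[R]_(t, d)) (bad : seq 'cV[R]_d -> bool).
Hypothesis z1 : 1 <= z.
Hypothesis optS : optimal_subspace k z X S.

(** Each image point is charged to one of its preimages; the remaining preimages only add to the
    right side. *)
Lemma cost_image_le (S' : {vspace 'cV[R]_t}) : cost z (image_mx A X) S' <=
  lz z (X : seq 'cV[R]_d) (fun x => norm2 (A *m x - orthoproj S' (A *m x))).
Proof.
have z0 : 0 < z := lt_le_trans ltr01 z1.
rewrite [cost _ _ _]/(lz _ _ _) (lz_le_powR z1)// ?lz_ge0// (powR_lz z1).
rewrite [leRHS](partition_big_imfset _ (mulmx A)).
rewrite big_seq [leRHS]big_seq; apply: ler_sum => y /imfsetP[x /= xX ->].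
rewrite [leRHS]big_mkcond/= (big_fsetD1 x)//= eqxx lerDl.
by apply: sumr_ge0 => x' _; case: ifP => // _; exact: powR_ge0.
Qed.

Lemma cost_image_inj (S' : {vspace 'cV[R]_t}) : {in X &, injective (mulmx A)} ->
  cost z (image_mx A X) S' =
  lz z (X : seq 'cV[R]_d) (fun x => norm2 (A *m x - orthoproj S' (A *m x))).
Proof. by move=> injA; rewrite /cost /lz big_imfset. Qed.

Lemma good_outcome (e : R) : 0 < e -> e < 1 ->
  {in X &, injective (mulmx A)} ->
  lz z (X : seq 'cV[R]_d) (excess S e A) <= e ^+ 2 / 100 * opt z X S ->
  (forall s w, ~~ bad s -> w \in extend S s ->
     (1 - e / 32) * norm2 w <= norm2 (A *m w)) ->
  shrink e ^+ n < ((e / 100) ^+ 2 / (1 + (e / 100) ^+ 2)) ^+ k ->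
  (0 < opt z X S -> \sum_(j < n) mass X (weight z X S) bad j.+1 [::] <
     ((e ^+ 2 / 100) `^ z) ^+ n * threshold z e) ->
  exists S', [/\ optimal_subspace k z (image_mx A X) S',
    (1 + e)^-1 * cost z X S <= cost z (image_mx A X) S' &
    cost z (image_mx A X) S' <= (1 + e) * cost z X S].
Proof.
move=> e0 e1 injA excA badP nk massA; have [dS oS] := optS.
have [S' [dS' oS']] := optimal_subspace_exists k (image_mx A X) z1.
have O0 : 0 <= cost z X S by exact: lz_ge0.
exists S'; split=> //; last first.
  pose AS : {vspace 'cV[R]_t} := (linfun (mulmx A) @: S)%VS.
  have dAS : (\dim AS <= k)%N by rewrite (leq_trans _ dS)// -(limg_ker_dim (linfun (mulmx A)) S) leq_addl.
  apply: (le_trans (oS' _ dAS)); apply: (le_trans (cost_image_le _)).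
  apply: (le_trans _ (upper_cost_arith e0 e1 O0)).
  pose f x := (1 + e / 4) * residual S x.
  have f0 x : 0 <= f x by rewrite mulr_ge0 ?residual_ge0// addr_ge0// divr_ge0// ltW.
  apply: (@le_trans _ _ (lz z (X : seq 'cV[R]_d) (fun x => f x + excess S e A x))).
    apply: (lz_le z1) => x _; rewrite norm2_ge0/=.
    apply: le_trans (norm2_mul_residual _ _ _ _); rewrite mulmxBr.
    apply: orthoproj_min; apply/memv_imgP; exists (orthoproj S x).
      exact: orthoproj_mem.
    by rewrite lfunE.
  have g0 x : 0 <= excess S e A x by exact: excess_ge0.
  apply: (le_trans (minkowski_lz z1 (X : seq 'cV[R]_d) f0 g0)).
  apply: lerD excA; rewrite (lzZ z1) ?addr_ge0 ?divr_ge0 ?(ltW e0)//.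
  exact: residual_ge0.
(* At cost 0 the weights do not form a probability, but the lower bound is trivial. *)
have [opt0|optp] := eqVneq (cost z X S) 0.
  by rewrite opt0 mulr0; exact: lz_ge0.
have op : 0 < opt z X S by rewrite lt0r optp.
apply: (@le_trans _ _ ((1 - e / 2) * opt z X S)).
  by rewrite ler_wpM2r// inv_1eps_le.
rewrite (cost_image_inj S' injA) leNgt; apply/negP => /ltW viol.
have := massA op; rewrite ltNge => /negP; apply.
have Hg : good_embedding z (X : seq 'cV[R]_d) S A bad e by split.
exact: (violation_mass z1 oS op dS' Hg viol nk).
Qed.

End GoodOutcome.

(** * Choice of the parameters *)

Section ParameterChoice.
Context {R : realType}.

Lemma exp2n_le_expR n : 2 ^+ n <= expR n%:R :> R.
Proof.
rewrite -[n%:R]mulr1 expRM_natl lerXn2r ?nnegrE ?expR_ge0//.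
by have := expR_ge1Dx (1 : R); rewrite -[1 + 1]/(2 : R).
Qed.

Lemma expR_N5 : expR (- 5) <= 20^-1 :> R.
Proof.
rewrite expRN lef_pV2 ?posrE ?expR_gt0//.
by apply: le_trans (exp2n_le_expR 5); rewrite -natrX ler_nat.
Qed.

Lemma shrink_le_expR (e : R) : 0 < e -> e < 1 -> shrink e <= expR (- (e / 24)).
Proof.
move=> e0 e1; apply: le_trans (expR_ge1Dx _).
rewrite /shrink ler_pdivrMr//.
have p : 0 < (1 + e / 8) ^+ 2 by rewrite exprn_gt0// addr_gt0// divr_gt0.
rewrite -lerBrDr -[leLHS]mul1r ler_pdivrMr//.
have -> : ((1 + - (e / 24)) * 3 - 2) * (1 + e / 8) ^+ 2 =
  1 + e * (8 - e - e ^+ 2 / 8) / 64 by field.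
have e2 : e ^+ 2 <= 1 by rewrite expr_le1 ?(ltW e0) ?(ltW e1).
rewrite lerDl divr_ge0// mulr_ge0 ?(ltW e0)//; lra.
Qed.

(** All quantities are put in the form exp(c L), so that comparing them reduces to comparing
    exponents. *)
Lemma inv_sqr_le_expR (e L : R) (c : nat) a : 0 < e -> e^-1 <= expR (L - 1) ->
  1 <= L -> (2 <= c)%N -> 0 <= a -> a <= 2 ^+ c -> a / e ^+ 2 <= expR (c%:R * L).
Proof.
move=> e0 eL L1 c2 a0 ac.
apply: (@le_trans _ _ (expR c%:R * (expR (L - 1)) ^+ 2)).
  rewrite ler_pM ?invr_ge0 ?exprn_ge0 ?(ltW e0)//.
    exact: le_trans ac (exp2n_le_expR _).
  by rewrite -exprVn lerXn2r ?nnegrE ?invr_ge0 ?expR_ge0 ?(ltW e0).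
rewrite -expRM_natl -expRD ler_expR.
have c2R : 2 <= c%:R :> R by rewrite (ler_nat _ 2).
have := mulr_ge0 (_ : 0 <= c%:R - 2) (_ : 0 <= L - 1).
by rewrite !subr_ge0 => /(_ c2R L1); lra.
Qed.

Lemma inv_le_expR (e L : R) (c : nat) a : 0 < e -> e^-1 <= expR (L - 1) ->
  1 <= L -> (1 <= c)%N -> 0 <= a -> a <= 2 ^+ c -> a / e <= expR (c%:R * L).
Proof.
move=> e0 eL L1 c1 a0 ac.
apply: (@le_trans _ _ (expR c%:R * expR (L - 1))).
  rewrite ler_pM ?invr_ge0 ?(ltW e0)//.
  exact: le_trans ac (exp2n_le_expR _).
rewrite -expRD ler_expR.
have c1R : 1 <= c%:R :> R by rewrite (ler_nat _ 1).
have := mulr_ge0 (_ : 0 <= c%:R - 1) (_ : 0 <= L - 1).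
by rewrite !subr_ge0 => /(_ c1R L1); lra.
Qed.

(** The left side is at most exp(-n e / 24) and the right side at least exp(-15 k L), because 2 *
    100^2 <= 2^15; and 360 = 15 * 24. *)
Lemma shrink_power_lt (k n : nat) (e L : R) : 0 < e -> e < 1 ->
  e^-1 <= expR (L - 1) -> 1 <= L -> 360 * (k%:R * L / e) < n%:R ->
  shrink e ^+ n < ((e / 100) ^+ 2 / (1 + (e / 100) ^+ 2)) ^+ k.
Proof.
move=> e0 e1 eL L1 nk; have /andP[s0 _] := shrink_itv e0.
apply: (@le_lt_trans _ _ (expR (n%:R * - (e / 24)))).
  rewrite expRM_natl lerXn2r ?nnegrE ?expR_ge0 ?(ltW s0)//.
  exact: shrink_le_expR.
apply: (@lt_le_trans _ _ (expR (k%:R * - (15%:R * L)))).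
  rewrite ltr_expR !mulrN ltrN2.
  move: nk; rewrite mulrA ltr_pdivrMr// => nk.
  have -> : n%:R * (e / 24) = n%:R * e / 24 by field.
  rewrite ltr_pdivlMr//.
  by have -> : k%:R * (15 * L) * 24 = 360 * (k%:R * L) by ring.
rewrite expRM_natl lerXn2r ?nnegrE ?expR_ge0//.
  by rewrite divr_ge0 ?addr_ge0// sqr_ge0.
have D0 : 0 < (e / 100) ^+ 2 by rewrite exprn_gt0// divr_gt0.
have D1 : (e / 100) ^+ 2 <= 1.
  by rewrite expr_le1 ?divr_ge0 ?(ltW e0)// ler_pdivrMr// mul1r; lra.
apply: (@le_trans _ _ ((e / 100) ^+ 2 / 2)); last first.
  rewrite ler_pM2l// lef_pV2 ?posrE ?addr_gt0//; lra.
rewrite expRN -[leRHS]invrK lef_pV2 ?posrE ?expR_gt0 ?invr_gt0 ?divr_gt0//.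
have -> : ((e / 100) ^+ 2 / 2)^-1 = (200 * 100) / e ^+ 2 by field; rewrite gt_eqF.
by apply: inv_sqr_le_expR; rewrite // ?mulr_ge0//; lra.
Qed.

Lemma net_size_le (N M : nat) (W e L : R) : 0 < e -> e < 1 -> 1 <= L ->
  e^-1 <= expR (L - 1) -> 1 <= W -> W <= L * expR (L - 1) ->
  N%:R <= 362 * W -> M%:R <= 192 * (N%:R / e) + 1 ->
  (2 * M).+1%:R <= expR (18%:R * L).
Proof.
move=> e0 e1 L1 eL W1 WL NW MN.
have ie1 : 1 <= e^-1 by rewrite invf_ge1// ltW.
have We : W <= W / e by rewrite ler_peMr// (le_trans ler01).
have Ne : N%:R / e <= 362 * (W / e).
  by rewrite mulrA ler_wpM2r// invr_ge0 ltW.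
have L0 : 0 <= L by exact: le_trans L1.
have LE : L <= expR (L - 1) by have := expR_ge1Dx (L - 1); lra.
have WE : W / e <= expR (L - 1) ^+ 3.
  rewrite exprSr; apply: ler_pM; rewrite ?invr_ge0 ?(le_trans ler01 W1) ?(ltW e0)//.
  by apply: le_trans WL _; rewrite expr2 ler_wpM2r// expR_ge0.
apply: (@le_trans _ _ (expR 18%:R * expR (L - 1) ^+ 3)).
  have h : (2 * M).+1%:R <= 2 ^+ 18 * (W / e).
    rewrite -natr1 natrM.
    have -> : 2 ^+ 18 = 512 * 512 :> R by ring.
    move: (M%:R : R) (N%:R / e) (W / e) MN Ne We W1 => m nn w.
    lra.
  apply: le_trans h _; apply: ler_pM => //; last exact: exp2n_le_expR.
  by rewrite (le_trans _ We)// (le_trans ler01).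
by rewrite -expRM_natl -expRD ler_expR; lra.
Qed.

(** In units of z L W the positive terms are at most 2527 + 8 + 722 + 6516 = 9773, which leaves room
    for 5 below 100^2. *)
Lemma failure_exponent (z L W n N T : R) : 1 <= z -> 1 <= L -> 1 <= W ->
  n <= 361 * W -> N <= 362 * W -> 100 ^+ 2 * (z * (L * W)) <= T ->
  n * (7 * L * z) + 8 * L * z + 2 * n + N * (18 * L) - T <= - 5.
Proof.
move=> z1 L1 W1 nW NW TT.
have LW1 : 1 <= L * W by rewrite mulr_ege1.
have LWz : L * W <= z * (L * W) by rewrite ler_peMl// (le_trans ler01).
have WLW : W <= L * W by rewrite ler_peMl// (le_trans ler01).
have L0 : 0 <= L := le_trans ler01 L1.
have z0 : 0 <= z := le_trans ler01 z1.
have h1 : n * (7 * L * z) <= 361 * W * (7 * L * z).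
  by rewrite ler_wpM2r// !mulr_ge0.
have h2 : N * (18 * L) <= 362 * W * (18 * L) by rewrite ler_wpM2r// mulr_ge0.
have h3 : L * z <= z * (L * W) by rewrite mulrC ler_wpM2l// ler_peMr.
move: h1 h2.
have -> : 361 * W * (7 * L * z) = 2527 * (z * (L * W)) by ring.
have -> : 362 * W * (18 * L) = 6516 * (L * W) by ring.
have -> : 8 * L * z = 8 * (L * z) by ring.
move: TT; rewrite expr2; move: (n * (7 * _ * _)) (N * (18 * _)) T (z * (L * W)) (L * z) (L * W) LW1 LWz WLW h3 => *.
lra.
Qed.

Lemma powR_le_expR (x y z : R) : 0 <= x -> 0 <= z -> x <= expR y ->
  x `^ z <= expR (y * z).
Proof.
by move=> x0 z0 xy; rewrite expRM ge0_ler_powR ?nnegrE ?expR_ge0.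
Qed.

(** The coefficients 7 and 8 come from 100 <= 2^7 and 200 <= 2^8, and 18 from the size of the
    grid. *)
Lemma failure_prob (n N M : nat) (z e L W T : R) : 0 < e -> e < 1 -> 1 <= z ->
  1 <= L -> e^-1 <= expR (L - 1) -> 1 <= W -> W <= L * expR (L - 1) ->
  n%:R <= 361 * W -> N%:R <= 362 * W ->
  (0 < M)%N -> M%:R <= 192 * (N%:R / e) + 1 ->
  100 ^+ 2 * (z * (L * W)) <= T ->
  (((e ^+ 2 / 100) `^ z) ^+ n * threshold z e)^-1 *
    (n%:R * (((2 * M).+1%:R ^+ N + N%:R) * expR (- T))) <= 20^-1.
Proof.
move=> e0 e1 z1 L1 eL W1 WL nW NW M0 MN TW.
have z0 : 0 <= z := le_trans ler01 z1.
have q0 : 0 < e ^+ 2 / 100 by rewrite divr_gt0// exprn_gt0.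
have h0 : 0 < e / 200 by rewrite divr_gt0.
have hq : (((e ^+ 2 / 100) `^ z) ^+ n)^-1 <= expR (n%:R * (7 * L * z)).
  rewrite expRM_natl -exprVn lerXn2r ?nnegrE ?expR_ge0 ?invr_ge0 ?powR_ge0//.
  rewrite powR_inv// invf_div; apply: powR_le_expR => //.
    by rewrite divr_ge0// sqr_ge0.
  by apply: inv_sqr_le_expR => //; rewrite -natrX ler_nat.
have ht : (threshold z e)^-1 <= expR (8 * L * z).
  rewrite /threshold powR_inv// invf_div; apply: powR_le_expR => //.
    by rewrite divr_ge0// ltW.
  by apply: inv_le_expR => //; rewrite -natrX ler_nat.
have hn : n%:R * ((2 * M).+1%:R ^+ N + N%:R) <=
    expR (2 * n%:R) * expR (N%:R * (18 * L)) :> R.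
  have B0 : 0 <= (2 * M).+1%:R ^+ N :> R by rewrite exprn_ge0.
  have NB : N%:R <= (2 * M).+1%:R ^+ N :> R.
    rewrite -natrX ler_nat; apply: leq_trans (ltnW (ltn_expl N (ltnSn 1))) _.
    by case: (N) => // N'; rewrite leq_exp2r// ltnS muln_gt0.
  apply: (@le_trans _ _ (2 * n%:R * (2 * M).+1%:R ^+ N)).
    rewrite [2 * _]mulrC -mulrA ler_wpM2l//; lra.
  apply: ler_pM; rewrite ?mulr_ge0//.
    by have := expR_ge1Dx (2 * n%:R : R); lra.
  rewrite expRM_natl lerXn2r ?nnegrE ?expR_ge0//.
  exact: net_size_le W1 WL NW MN.
rewrite invfM; apply: (@le_trans _ _
  (expR (n%:R * (7 * L * z)) * expR (8 * L * z) *
    (expR (2 * n%:R) * expR (N%:R * (18 * L)) * expR (- T)))).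
  apply: ler_pM.
  - by rewrite mulr_ge0 ?invr_ge0 ?exprn_ge0 ?powR_ge0.
  - by rewrite !mulr_ge0 ?expR_ge0// addr_ge0// exprn_ge0.
  - by apply: ler_pM => //; rewrite ?invr_ge0 ?exprn_ge0 ?powR_ge0.
  - by rewrite mulrA ler_wpM2r ?expR_ge0.
rewrite -!expRD; apply: le_trans expR_N5; rewrite ler_expR.
have := failure_exponent z1 L1 W1 nW NW TW.
by rewrite !addrA.
Qed.

(** In the bound on [C], 100^2 is the budget of [failure_exponent]; 16 and 64^2 undo the tail
    exponent t (e/64)^2 / 16. *)
Lemma parameters (k t : nat) (z e C : R) : 100 ^+ 2 * (16 * (64 * 64)) <= C ->
  (0 < k)%N -> 1 <= z -> 0 < e -> e < 1 ->
  C * (z * k%:R ^+ 2 * (1 + ln (k%:R / e)) `^ 2 / e ^+ 3) <= t%:R ->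
  [/\ (0 < t)%N, z <= e / 16 * t%:R,
    (100 / e ^+ 2) `^ z * expR (- (t%:R * e ^+ 2 / 64)) <= 20^-1 &
    exists n M, [/\ (0 < M)%N, e / 64 + 3 * (k + n)%:R / M%:R <= e / 32,
      shrink e ^+ n < ((e / 100) ^+ 2 / (1 + (e / 100) ^+ 2)) ^+ k &
      (((e ^+ 2 / 100) `^ z) ^+ n * threshold z e)^-1 *
        (n%:R * (((2 * M).+1%:R ^+ (k + n) + (k + n)%:R) *
          expR (- (t%:R * (e / 64) ^+ 2 / 16)))) <= 20^-1]].
Proof.
move=> hC k0 z1 e0 e1; set L := 1 + ln (k%:R / e) => tC.
have C0 : 1000 * 1000 <= C by move: hC; rewrite expr2; lra.
have Cp : 0 <= C by lra.
have K1 : 1 <= k%:R :> R by rewrite (ler_nat _ 1).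
have Kp : 0 < k%:R :> R := lt_le_trans ltr01 K1.
have z0 : 0 <= z := le_trans ler01 z1.
have ie1 : 1 <= e^-1 by rewrite invf_ge1// ltW.
have Ke1 : 1 <= k%:R / e by rewrite mulr_ege1.
have L1 : 1 <= L by rewrite /L lerDl ln_ge0.
have LE : expR (L - 1) = k%:R / e.
  by rewrite /L [1 + _]addrC addrK lnK// posrE divr_gt0.
have eL : e^-1 <= expR (L - 1) by rewrite LE ler_peMl// invr_ge0 ltW.
pose W := k%:R * L / e.
have WE : W = L * expR (L - 1) by rewrite LE /W mulrAC mulrC.
have W1 : 1 <= W by rewrite WE LE mulr_ege1.
have L0 : 0 <= L := le_trans ler01 L1.
have W0 : 0 <= W := le_trans ler01 W1.
have kW : k%:R <= W.
  by rewrite WE LE mulrCA ler_peMr ?(ltW Kp)// mulr_ege1.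
have LW1 : 1 <= L * W by rewrite mulr_ege1.
have zLW1 : 1 <= z * (L * W) by rewrite mulr_ege1.
have tW : C * (z * (L * W)) <= t%:R * e ^+ 2.
  have e2 : 0 < e ^+ 2 by rewrite exprn_gt0.
  rewrite -ler_pdivrMr//; apply: (le_trans _ tC); rewrite -[leLHS]mulrA ler_wpM2l//.
  have L2 : L `^ 2 = L ^+ 2 by rewrite -powR_mulrn.
  rewrite L2.
  have -> : z * (L * W) / e ^+ 2 = z * k%:R * L ^+ 2 / e ^+ 3.
    by rewrite /W; field; rewrite gt_eqF.
  rewrite ler_wpM2r ?invr_ge0 ?exprn_ge0 ?(ltW e0)// ler_wpM2r ?sqr_ge0//.
  by rewrite ler_wpM2l// expr2 ler_peMl// ltW.
have WD : W = k%:R * L / e by [].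
clearbody L W.
have CzLW : 1000 * 1000 * (z * (L * W)) <= C * (z * (L * W)).
  by rewrite ler_wpM2r// (le_trans ler01).
have hCzLW : 100 ^+ 2 * (16 * (64 * 64)) * (z * (L * W)) <= C * (z * (L * W)).
  by rewrite ler_wpM2r// (le_trans ler01).
have zLW : z <= z * (L * W) by rewrite ler_peMr.
have e2e : e ^+ 2 <= e by rewrite expr2 ler_piMl// ltW.
have te : t%:R * e ^+ 2 <= t%:R * e by rewrite ler_wpM2l.
split.
- case: t tC tW te => // _ + _; rewrite mul0r => h; exfalso; move: h.
  by apply/negP; rewrite -ltNge; apply: mulr_gt0; [lra|exact: lt_le_trans zLW1].
-   have -> : e / 16 * t%:R = (t%:R * e) / 16 by ring.
  move: (t%:R * e) (t%:R * e ^+ 2) (C * (z * (L * W))) (z * (L * W)) tW te CzLW zLW z1 => a b c f *; lra.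
- apply: (@le_trans _ _ (expR (7 * L * z) * expR (- (t%:R * e ^+ 2 / 64)))).
    rewrite ler_wpM2r ?expR_ge0//; apply: powR_le_expR => //.
      by rewrite divr_ge0// sqr_ge0.
    by apply: inv_sqr_le_expR => //; rewrite -natrX ler_nat.
  rewrite -expRD; apply: le_trans expR_N5; rewrite ler_expR.
  have : 7 * L * z <= 7 * (z * (L * W)).
    by rewrite -mulrA ler_wpM2l// mulrC ler_wpM2l// ler_peMr.
    move: (7 * L * z) (t%:R * e ^+ 2) (C * (z * (L * W))) (z * (L * W)) zLW1 CzLW tW => a b c f *; lra.
(* The least integer above 360 W; it is at most 361 W because W >= 1. *)
pose n := (Num.truncn (360 * W)%R).+1.
have nW1 : 360 * W < n%:R by exact: truncnS_gt.
have nW2 : n%:R <= 361 * W.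
  rewrite /n -[leLHS]natr1; have : (Num.truncn (360 * W)%R)%:R <= 360 * W.
    by rewrite truncn_le mulr_ge0 ?ler0n.
  move: ((Num.truncn (360 * W)%R)%:R : R) => m; lra.
clearbody n.
have NW : (k + n)%:R <= 362 * W by rewrite natrD; lra.
have Ne0 : 0 <= 192 * ((k + n)%:R / e) by rewrite mulr_ge0// divr_ge0// ltW.
(* With 192 = 3 * 64, the grid error 3 (k + n) / M is at most e / 64, the half of e / 32 left by the
   tail bound. *)
pose M := (Num.truncn (192 * ((k + n)%:R / e))%R).+1.
have M1 : 192 * ((k + n)%:R / e) < M%:R by exact: truncnS_gt.
have M2 : M%:R <= 192 * ((k + n)%:R / e) + 1.
  by rewrite /M -[leLHS]natr1 lerD2r truncn_le.
have M0 : (0 < M)%N by [].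
clearbody M; exists n, M; split=> //.
- have Mp : 0 < M%:R :> R by rewrite ltr0n.
  have : 3 * (k + n)%:R / M%:R <= e / 64; last by lra.
  rewrite ler_pdivrMr//; move: M1; rewrite mulrA ltr_pdivrMr//.
  move: ((k + n)%:R : R) (M%:R : R) => a b.
  have -> : e / 64 * b = (b * e) / 64 by ring.
  move: (b * e) => c; lra.
- by apply: (shrink_power_lt e0 e1 eL L1); rewrite -WD.
- apply: (failure_prob e0 e1 z1 L1 eL W1 _ nW2 NW M0 M2); first by rewrite WE.
  have -> : t%:R * (e / 64) ^+ 2 / 16 = t%:R * e ^+ 2 / (16 * (64 * 64)) by field.
  rewrite ler_pdivlMr//; apply: (le_trans _ tW); apply: le_trans hCzLW.
  by rewrite mulrAC.
Qed.

End ParameterChoice.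

(** * Failure events combined *)

Section Assembly.
Context disp (Omega : measurableType disp) {R : realType} (P : probability Omega R).
Variables (d t : nat) (G : 'I_t -> 'I_d -> {RV P >-> R}).
Hypothesis t0 : (0 < t)%N.
Hypothesis GJL : gaussian_JL G.
Let JL := JL_matrix G.

Lemma bad_family (S : {vspace 'cV[R]_d}) (k n M : nat) (e : R) :
  (\dim S <= k)%N -> 0 < e -> e < 1 -> (0 < M)%N ->
  e / 64 + 3 * (k + n)%:R / M%:R <= e / 32 ->
  exists bad : Omega -> seq 'cV[R]_d -> bool,
    [/\ forall s, measurable [set w | bad w s],
     forall s, (size s <= n)%N -> (P [set w | bad w s] <=
      (((2 * M).+1%:R ^+ (k + n) + (k + n)%:R) *
        expR (- (t%:R * (e / 64) ^+ 2 / 16)))%:E)%E &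
     forall w s v, ~~ bad w s -> v \in extend S s ->
      (1 - e / 32) * norm2 v <= norm2 (JL w *m v)].
Proof.
move=> dS e0 e1 M0 eM.
set p := (_ * expR _).
have hb s : exists b : Omega -> bool, [/\ measurable [set w | b w],
    (size s <= n)%N -> (P [set w | b w] <= p%:E)%E &
    forall w v, ~~ b w -> v \in extend S s ->
      (1 - e / 32) * norm2 v <= norm2 (JL w *m v)].
  (* Sequences longer than [n] are declared bad outright; no probability bound is asked of them. *)
  have [sn|ns] := leqP (size s) n; last first.
    by exists (fun=> true); split => //; rewrite set_true.
  have dV : (\dim (extend S s) <= k + n)%N.
    apply: leq_trans (dimv_add_leqif _ _) _; apply: leq_add => //.
    exact: leq_trans (dim_span _) sn.
  have e64 : 0 < e / 64 by rewrite divr_gt0.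
  have e641 : e / 64 <= 1 by rewrite ler_pdivrMr//; lra.
  have [b [mb Pb bP]] := subspace_embedding t0 GJL dV M0 e64 e641.
  exists b; split => // w v nb vV; apply: le_trans (bP w nb v vV).
  by rewrite ler_wpM2r ?norm2_ge0// lerD2l lerN2.
have [b bP] := choice hb.
exists (fun w s => b s w); split.
- by move=> s; have [] := bP s.
- by move=> s; have [] := bP s.
- by move=> w s v; have [_ _ h] := bP s; exact: h.
Qed.

Lemma mass_event (S : {vspace 'cV[R]_d}) (X : seq 'cV[R]_d) (z : R)
    (bad : Omega -> seq 'cV[R]_d -> bool) (n : nat) (delta c : R) : 1 <= z ->
  (forall s, measurable [set w | bad w s]) ->
  (forall s, (size s <= n)%N -> (P [set w | bad w s] <= delta%:E)%E) ->
  0 < c -> c^-1 * (n%:R * delta) <= 20^-1 ->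
  exists F, [/\ measurable F, (P F <= (20^-1 : R)%:E)%E &
    forall w, ~ F w -> 0 < opt z X S ->
      \sum_(j < n) mass X (weight z X S) (bad w) j.+1 [::] < c].
Proof.
move=> z1 mbad Pbad c0 cd.
have [op|nop] := boolP (0 < opt z X S); last first.
  by exists set0; split; rewrite ?measure0//= => w _ h; rewrite h in nop.
have [mF PF] := mass_tail (weight_ge0 z X S) (sum_weight z1 op) mbad Pbad c0.
exists [set w | c <= \sum_(j < n) mass X (weight z X S) (bad w) j.+1 [::]].
split=> //; first by apply: le_trans PF _; rewrite lee_fin.
by move=> w /= /negP h _; rewrite ltNge.
Qed.

Lemma union3_bound (E F1 F2 F3 : set Omega) (a b : R) :
  measurable E -> measurable F1 -> measurable F2 -> measurable F3 ->
  P F1 = 0%E -> (P F2 <= a%:E)%E -> (P F3 <= b%:E)%E ->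
  (forall w, ~ F1 w -> ~ F2 w -> ~ F3 w -> E w) ->
  ((1 - (a + b))%:E <= P E)%E.
Proof.
move=> mE m1 m2 m3 P1 P2 P3 h.
have mU : measurable (F1 `|` (F2 `|` F3)) by do 2 apply: measurableU => //.
apply: (@le_trans _ _ (P (~` (F1 `|` (F2 `|` F3))))); last first.
  apply: le_measure; rewrite ?inE//; first exact: measurableC.
  by move=> w /= /not_orP[n1 /not_orP[n2 n3]]; exact: h.
rewrite probability_setC// EFinB; apply: leeB => //.
apply: le_trans (measureU2 _ m1 (measurableU _ _ m2 m3)) _.
have P1' : (P F1 <= 0)%E by rewrite P1.
rewrite -[leRHS]add0e; apply: (leeD P1').
by apply: le_trans (measureU2 _ m2 m3) _; rewrite EFinD leeD.
Qed.

End Assembly.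

Theorem theorem5p1 (R : realType) :
  exists C C' : R, [/\ 0 < C, 0 < C' &
    forall (d k t : nat) (z eps : R) (X : {fset 'cV[R]_d})
      (S : {vspace 'cV[R]_d}),
    (0 < k)%N -> 1 <= z -> 0 < eps < 1 ->
    optimal_subspace k z X S ->
    C * (z * k%:R ^+ 2 * (1 + ln (k%:R / eps)) `^ C' / eps ^+ 3) <= t%:R ->
    forall (disp : measure_display) (Omega : measurableType disp)
      (P : probability Omega R) (G : 'I_t -> 'I_d -> {RV P >-> R}),
    gaussian_JL G ->
    let E := [set w : Omega | exists S' : {vspace 'cV[R]_t},
      let Y := image_mx (JL_matrix G w) X in
      [/\ optimal_subspace k z Y S',
          (1 + eps)^-1 * cost z X S <= cost z Y S' &
          cost z Y S' <= (1 + eps) * cost z X S]] in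
    measurable E /\ ((9 / 10)%:E <= P E)%E].
Proof.
exists (100 ^+ 2 * (16 * (64 * 64))), 2; split=> //.
move=> d k t z e X S k0 z1 /andP[e0 e1] oS tC disp Omega P G GJL E.
have [t0 zt Pexc [n [M [M0 eM nk Pmass]]]] := parameters (lexx _) k0 z1 e0 e1 tC.
have mE : measurable E.
  apply: (measurable_optimal_cost (A := JL_matrix G) k X z1) => i j.
  under eq_fun do rewrite mxE.
  exact: measurable_funPT.
split=> //; have [dS _] := oS.
have [bad [mbad Pbad badP]] := bad_family t0 GJL dS e0 e1 M0 eM.
have [F1 [mF1 PF1] injP] := injective_event t0 GJL X.
have [mF2 PF2] := excess_tail t0 GJL (X : seq 'cV[R]_d) S e0 (ltW e1) z1 zt.
have c0 : 0 < ((e ^+ 2 / 100) `^ z) ^+ n * threshold z e.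
  by rewrite mulr_gt0 ?exprn_gt0 ?powR_gt0 ?divr_gt0 ?exprn_gt0.
have [F3 [mF3 PF3 massP]] :=
  mass_event S (X : seq 'cV[R]_d) z1 mbad Pbad c0 Pmass.
have P2 := le_trans PF2 (_ : (_ <= (20^-1 : R)%:E)%E).
(* Excess and mass of bad tuples fail with probability at most 1/20 each, injectivity with
   probability 0. *)
have -> : 9 / 10 = 1 - (20^-1 + 20^-1) :> R by field.
apply: (union3_bound mE mF1 mF2 mF3 PF1 (P2 _) PF3); first by rewrite lee_fin.
move=> w n1 n2 n3; apply: (good_outcome z1 oS e0 e1 (injP w n1) _ _ nk (massP w n3)).
  by rewrite leNgt; apply/negP.
by move=> s v; exact: badP.
Qed.
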